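(* Consider a family of irreducible birth and death chains $\mathcal{F}=\{(\Omega_n,K_n,\pi_n)\mid n=1,2,\dots\}$, where $\Omega_n=\{0,1,\dots,n\}$, $K_n$ has birth, death and holding rates $p_{n,i},q_{n,i},r_{n,i}$, and $\pi_n$ is the stationary distribution of $K_n$. For $n\ge 1$, let $i_n\in\{0,\dots,n\}$ be a state satisfying $\pi_n([0,i_n])\ge 1/2$ and $\pi_n([i_n,n])\ge 1/2$ and set \[ t_n=\max\left\{\sum_{k=0}^{i_n-1}\frac{\pi_n([0,k])}{\pi_n(k)p_{n,k}},\ \sum_{k=i_n+1}^n\frac{\pi_n([k,n])}{\pi_n(k)q_{n,k}}\right\} \] and \[ \ell_n=\max\left\{\max_{j:j<i_n}\sum_{k=j}^{i_n-1}\frac{\pi_n([0,j])}{\pi_n(k)p_{n,k}},\ \max_{j:j>i_n}\sum_{k=i_n+1}^j\frac{\pi_n([j,n])}{\pi_n(k)q_{n,k}}\right\}. \] Then, for any $\epsilon\in(0,1/2)$ and $\delta\in(0,1)$, there is a constant $C=C(\epsilon,\delta)>1$ such that \[ C^{-1}t_n\le \min\{T_{n,\mathrm{TV}}^{(c)}(\epsilon),T_{n,\mathrm{TV}}^{(\delta)}(\epsilon)\}\le\max\{T_{n,\mathrm{TV}}^{(c)}(\epsilon),T_{n,\mathrm{TV}}^{(\delta)}(\epsilon)\}\le Ct_n \] for $n$ large enough. Moreover, the following are equivalent. (1) $\mathcal{F}_c$ has a total variation cutoff. (2) For $\delta\in(0,1)$, $\mathcal{F}_\delta$ has a total variation cutoff.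 (3) $t_n/\ell_n\to\infty$.
   Context: A birth and death chain on $\{0,1,\dots,n\}$ with birth rates $p_i$, death rates $q_i$ and holding rates $r_i$ (nonnegative, $p_i+q_i+r_i=1$, $p_n=q_0=0$) is the Markov chain with transition matrix $K(i,i+1)=p_i$, $K(i,i-1)=q_i$, $K(i,i)=r_i$ and all other entries $0$. It is irreducible iff $p_iq_{i+1}>0$ for $0\le i<n$, and then it has a unique stationary distribution $\pi$. Write $\pi(A)=\sum_{i\in A}\pi(i)$, with $[a,b]$ denoting the integers between $a$ and $b$. The index $j$ ranges over $\{0,\dots,n\}$; empty sums are $0$ and $\max\emptyset:=0$. For a transition matrix $K$ with stationary distribution $\pi$, the continuous time semigroup is $H_t=e^{-t(I-K)}$ and the $\delta$-lazy chain is $K_\delta=\delta I+(1-\delta)K$. With $\|\mu-\nu\|_{\mathrm{TV}}=\sup_A\{\mu(A)-\nu(A)\}$, set $d^{(c)}_{\mathrm{TV}}(t)=\sup_x\|H_t(x,\cdot)-\pi\|_{\mathrm{TV}}$ for real $t\ge 0$, $d^{(\delta)}_{\mathrm{TV}}(m)=\sup_x\|K_\delta^m(x,\cdot)-\pi\|_{\mathrm{TV}}$ for integers $m\ge0$, $T^{(c)}_{\mathrm{TV}}(\epsilon)=\inf\{t\ge0: d^{(c)}_{\mathrm{TV}}(t)\le\epsilon\}$ and $T^{(\delta)}_{\mathrm{TV}}(\epsilon)=\inf\{m\in\mathbb{Z}_{\ge 0}: d^{(\delta)}_{\mathrm{TV}}(m)\le\epsilon\}$. The subscript $n$ refers to $K_n$.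 $\mathcal{F}_c$ and $\mathcal{F}_\delta$ are the families of the continuous time chains, respectively $\delta$-lazy discrete time chains, associated with $\mathcal{F}$. A family with mixing times $T_{n,\mathrm{TV}}$ has a total variation cutoff if $\lim_{n\to\infty}T_{n,\mathrm{TV}}(\epsilon)/T_{n,\mathrm{TV}}(\eta)=1$ for all $0<\epsilon<\eta<1$ (with $T_{n,\mathrm{TV}}=T^{(c)}_{n,\mathrm{TV}}$ for $\mathcal{F}_c$ and $T^{(\delta)}_{n,\mathrm{TV}}$ for $\mathcal{F}_\delta$). *)

(* Defs.v *)
From HB Require Import structures.
From mathcomp Require Import all_boot all_order all_algebra.
From mathcomp Require Import all_classical all_reals all_analysis.

Set Implicit Arguments.
Unset Strict Implicit.
Unset Printing Implicit Defensive.

Import Order.TTheory GRing.Theory Num.Theory.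
Import numFieldNormedType.Exports.

Local Open Scope classical_set_scope.
Local Open Scope ring_scope.

Section FiniteChains.
Context {R : realType} {n : nat}.
Implicit Types (K : 'M[R]_n.+1) (mu nu pi : 'rV[R]_n.+1).

Definition irreducible_kernel K := forall x y, exists m, 0 < (K ^+ m) x y.

Definition stationary_distribution K pi :=
  [/\ forall x, 0 <= pi 0 x, \sum_x pi 0 x = 1 & pi *m K = pi].

(* [limn] is taken in the normed space of matrices (sup norm of the entries),
   where this series converges for every [A]. *)
Definition expmx (A : 'M[R]_n.+1) : 'M[R]_n.+1 :=
  limn (series (fun k => (k`!%:R)^-1 *: A ^+ k)).

Definition semigroup K (t : R) : 'M[R]_n.+1 := expmx (- t *: (1 - K)).

Definition lazy (delta : R) K : 'M[R]_n.+1 := delta *: 1 + (1 - delta) *: K.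

Definition mass mu (A : {set 'I_n.+1}) : R := \sum_(x in A) mu 0 x.

Definition tv_dist mu nu : R :=
  sup (range (fun A : {set 'I_n.+1} => mass mu A - mass nu A)).

Definition max_tv_dist (P : 'M[R]_n.+1) pi : R :=
  sup (range (fun x => tv_dist (row x P) pi)).

Definition tv_mixing_cont K pi (eps : R) : R :=
  inf [set t : R | 0 <= t /\ max_tv_dist (semigroup K t) pi <= eps].

(* The infimum of a set of natural numbers, viewed in [R].  Here and above the
   set is nonempty for irreducible [K], [0 < delta < 1] and [0 < eps], so the
   convention [inf set0 = 0] plays no role. *)
Definition tv_mixing_lazy (delta : R) K pi (eps : R) : R :=
  inf [set (m%:R : R) | m in
    [set m : nat | max_tv_dist (lazy delta K ^+ m) pi <= eps]].

End FiniteChains.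

Definition has_cutoff {R : realType} (T : nat -> R -> R) :=
  forall eps eta : R, 0 < eps -> eps < eta -> eta < 1 ->
    T n eps / T n eta @[n --> \oo] --> (1 : R).

Record bd_chain (R : realType) (n : nat) := BDChain {
  birth : 'I_n.+1 -> R;
  death : 'I_n.+1 -> R;
  hold : 'I_n.+1 -> R;
  birth_ge0 : forall i, 0 <= birth i;
  death_ge0 : forall i, 0 <= death i;
  hold_ge0 : forall i, 0 <= hold i;
  bd_rates_sum : forall i, birth i + death i + hold i = 1;
  birth_last : birth ord_max = 0;
  death_first : death ord0 = 0
}.

Section BirthDeath.
Context {R : realType} {n : nat}.
Implicit Types (X : bd_chain R n) (pi : 'rV[R]_n.+1) (i : 'I_n.+1).

Definition bd_kernel X : 'M[R]_n.+1 :=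
  \matrix_(i, j) if j == i.+1 :> nat then birth X i
                 else if i == j.+1 :> nat then death X i
                 else if i == j then hold X i else 0.

Definition mass_le pi i : R := mass pi [set k : 'I_n.+1 | (k <= i)%N].
Definition mass_ge pi i : R := mass pi [set k : 'I_n.+1 | (i <= k)%N].

Definition median_state pi i := 1 / 2 <= mass_le pi i /\ 1 / 2 <= mass_ge pi i.

Definition bd_t X pi i : R :=
  Num.max
    (\sum_(k < n.+1 | (k < i)%N) mass_le pi k / (pi 0 k * birth X k))
    (\sum_(k < n.+1 | (i < k)%N) mass_ge pi k / (pi 0 k * death X k)).

Definition bd_ell X pi i : R :=
  Num.max
    (\big[Num.max/0]_(j < n.+1 | (j < i)%N)
       \sum_(k < n.+1 | (j <= k < i)%N) mass_le pi j / (pi 0 k * birth X k))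
    (\big[Num.max/0]_(j < n.+1 | (i < j)%N)
       \sum_(k < n.+1 | (i < k <= j)%N) mass_ge pi j / (pi 0 k * death X k)).

End BirthDeath.

(* The families are indexed by [n >= 1]; nothing is required at [n = 0]. *)
Definition irreducible_bd_family {R : realType}
    (F : forall n, bd_chain R n) (pi : forall n, 'rV[R]_n.+1) :=
  forall n, (0 < n)%N ->
    irreducible_kernel (bd_kernel (F n)) /\
    stationary_distribution (bd_kernel (F n)) (pi n).

Definition median_family {R : realType}
    (pi : forall n, 'rV[R]_n.+1) (i : forall n, 'I_n.+1) :=
  forall n, (0 < n)%N -> median_state (pi n) (i n).

(* Main.v *)
(* Write [P] for the lazy kernel and [g u] for [P ^ u] applied to a centred
   indicator.
   - Upper bound: stopping the chain at the first visit to [z] gives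
     [|g (s + k) x| <= max_(u >= s) |g u z| + P_x (tau_z > k)].  The maximum is
     small for most [z]: its second moment is controlled by a Littlewood-Paley
     estimate and by the spectral gap, which is at least [C / ell] by Hardy's
     inequality.  For [z] between the quartiles [tau_z] has mean
     [t + O(ell)] and variance [O(ell t)] (up to the laziness), so Chebyshev's
     inequality applies.
   - Lower bound: Chebyshev's inequality for the time to reach a quantile from
     the end of the segment that attains the maximum in [t].
   Thus every mixing time is [t / (1 - delta) + O(sqrt (ell t))], and there is a
   cutoff as soon as [t / ell] tends to infinity.
   - Conversely a distance [eps] at time [m] makes [P ^ m] contract the functions
     of mean 0 by the factor [2 eps] in sup norm, hence in L2; a test function
     with Rayleigh quotient [O(1 / ell)] gives [m >= C ell log (1 / eps)], which
     is incompatible with a cutoff unless [t / ell] tends to infinity.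
   In continuous time [H_t] is the mixture of the powers of [K_(1/2)] with
   Poisson weights of mean [2 t]. *)

Require Import Defs.
From HB Require Import structures.
From mathcomp Require Import all_boot all_order all_algebra.
From mathcomp Require Import all_classical all_reals all_analysis.
From mathcomp Require Import ring lra zify.

Set Implicit Arguments.
Unset Strict Implicit.
Unset Printing Implicit Defensive.

Import Order.TTheory GRing.Theory Num.Theory.
Import numFieldNormedType.Exports.

Local Open Scope classical_set_scope.
Local Open Scope ring_scope.

(** No probability space and no spectral theorem are used. A kernel acts on functions [nat -> R]; a
    hitting time is known only through its survival function, and Chebyshev's inequality is a
    comparison of that function with a space-time supermartingale, by induction on time. Spectral
    calculus is replaced by inequalities between quadratic forms: summation by parts,
    Cauchy-Schwarz, log-convexity of moments. The obstacle in the upper bound is that the maximum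
    over times is controlled only on average over [z], never at a prescribed [z]. One good [z] in
    the bulk is enough, since every bulk state is reached in time with high probability: if mixing
    failed, the maximum would be large on the whole bulk, of mass at least 1/2, against the second
    moment bound. The window [sqrt (ell t)] also absorbs the Poisson fluctuations, of order
    [sqrt t], and the rounding to integers, because [1 <= ell]. For the converse, a cutoff bounds
    the mixing time at every small level [eps] by one fixed multiple of [t], so that [eps] can be
    sent to 0 against a constant. *)

Section NatSums.
Context {R : realFieldType}.
Implicit Types (F : nat -> nat -> R) (a g : nat -> R).

Lemma sum_triangle F m :
  \sum_(0 <= x < m) \sum_(x <= k < m) F x k =
  \sum_(0 <= k < m) \sum_(0 <= x < k.+1) F x k.
Proof.
elim: m => [|m IH]; first by rewrite !big_geq.
rewrite big_nat_recr //= big_nat1 [in RHS]big_nat_recr //= -IH.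
rewrite [X in _ = _ + X]big_nat_recr //= addrA -big_split /=; congr (_ + _).
by apply: eq_big_nat => x /andP[_ xm]; rewrite big_nat_recr //= ltnW.
Qed.

Lemma sum_by_parts a g m :
  \sum_(0 <= x < m.+1) (a x.+1 - a x) * g x =
  a m.+1 * g m - a 0%N * g 0%N - \sum_(0 <= x < m) a x.+1 * (g x.+1 - g x).
Proof.
elim: m => [|m IH]; first by rewrite big_nat1 big_geq //; ring.
by rewrite big_nat_recr //= IH [in RHS]big_nat_recr //=; ring.
Qed.

Lemma ler_sum_nat_ge0 (f : nat -> R) m p q :
  (p <= q)%N -> (forall x, (m <= x < q)%N -> 0 <= f x) ->
  \sum_(m <= x < p) f x <= \sum_(m <= x < q) f x.
Proof.
move=> pq f0; case: (leqP m p) => mp.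
  rewrite (big_cat_nat mp pq) /= lerDl big_nat.
  by apply: sumr_ge0 => x /andP[px xq]; apply: f0; rewrite xq (leq_trans mp).
rewrite big_geq ?(ltnW mp) // big_nat; apply: sumr_ge0 => x; exact: f0.
Qed.

(** The cross term [2 * g * D] is at most twice the square root of [(A * be) * (al * B)], hence at
    most [A * be + al * B]. This lets [hardy] build a weighted Cauchy-Schwarz inequality one edge at
    a time. *)
Lemma sqr_add_le (A B al be g D : R) : 0 <= A -> 0 <= B -> 0 <= al -> 0 <= be ->
  g ^+ 2 <= A * B -> D ^+ 2 <= al * be ->
  (g + D) ^+ 2 <= (A + al) * (B + be).
Proof.
move=> A0 B0 al0 be0 gAB Dab.
have H : `|2 * g * D| <= A * be + al * B.
  rewrite -ler_sqr ?nnegrE ?addr_ge0 ?mulr_ge0 //.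
  have -> : `|2 * g * D| ^+ 2 = 4 * (g ^+ 2 * D ^+ 2).
    by rewrite real_normK ?num_real //; ring.
  have : g ^+ 2 * D ^+ 2 <= A * B * (al * be) by rewrite ler_pM ?sqr_ge0.
  by move: (sqr_ge0 (A * be - al * B)); nra.
have := ler_norm (2 * g * D); move: gAB Dab H; nra.
Qed.

End NatSums.

(* A reversible birth and death chain as an electrical network: [ne x] is the
   conductance [pi(x-1) p(x-1) = pi(x) q(x)] of the edge [{x-1, x}], so that
   the two ends [ne 0] and [ne nsz.+1] carry no edge. *)
Record network (R : realFieldType) := Network {
  nsz : nat;
  nw : nat -> R;
  ne : nat -> R;
  nw_gt0 : forall x, (x <= nsz)%N -> 0 < nw x;
  nw_sum : \sum_(0 <= x < nsz.+1) nw x = 1;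
  ne_gt0 : forall x, (0 < x <= nsz)%N -> 0 < ne x;
  ne_first : ne 0 = 0;
  ne_last : ne nsz.+1 = 0;
  ne_le : forall x, (x <= nsz)%N -> ne x + ne x.+1 <= nw x
}.

(** * Networks: the one-step operator and its Dirichlet form *)

Section Network.
Context {R : realFieldType}.
Variable N : network R.
Local Notation n := (nsz N).
Local Notation w := (nw N).
Local Notation e := (ne N).
Implicit Types (f g : nat -> R) (c : R) (x y z : nat).

(* One step of the [(1 - c)]-lazy chain. *)
Definition step c f x :=
  f x + c / w x * (e x.+1 * (f x.+1 - f x) - e x * (f x - f x.-1)).

Definition lmass x := \sum_(0 <= j < x.+1) w j.
Definition res a b := \sum_(a <= k < b) (e k.+1)^-1.
(* The mean time to reach [z] from [x <= z] when [c = 1]; it is [hit z x / c] in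
   general. *)
Definition hit z x := \sum_(x <= k < z) lmass k / e k.+1.

Definition mean f := \sum_(0 <= x < n.+1) w x * f x.
Definition ip f g := \sum_(0 <= x < n.+1) w x * (f x * g x).
Definition energy f g := \sum_(0 <= x < n) e x.+1 * ((f x.+1 - f x) * (g x.+1 - g x)).

Lemma ne_ge0 x : (x <= n.+1)%N -> 0 <= e x.
Proof.
case: x => [|x]; first by rewrite ne_first.
rewrite ltnS leq_eqVlt => /predU1P[->|xn]; first by rewrite ne_last.
by rewrite ltW // ne_gt0.
Qed.

Lemma lmass_gt0 x : (x <= n)%N -> 0 < lmass x.
Proof.
move=> xn; rewrite /lmass big_nat_recr //= ltr_wpDl ?nw_gt0 //.
rewrite big_nat; apply: sumr_ge0 => j /andP[_ jx].
by rewrite ltW // nw_gt0 // (leq_trans (ltnW jx)).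
Qed.

Lemma le_lmass x y : (x <= y)%N -> (y <= n)%N -> lmass x <= lmass y.
Proof.
move=> xy yn; apply: ler_sum_nat_ge0 => // j /andP[_ jy].
by rewrite ltW // nw_gt0 // (leq_trans _ yn).
Qed.

Lemma lmass_le1 x : (x <= n)%N -> lmass x <= 1.
Proof. by move=> xn; rewrite -(nw_sum N); exact: le_lmass. Qed.

Lemma le_hit z x y : (x <= y)%N -> (y <= z)%N -> (z <= n)%N -> hit z y <= hit z x.
Proof.
move=> xy yz zn; rewrite /hit (big_cat_nat xy yz) /= lerDr big_nat.
apply: sumr_ge0 => k /andP[_ ky]; have kn := leq_trans (leq_trans ky yz) zn.
by rewrite divr_ge0 ?ltW ?lmass_gt0 ?ne_gt0 // ltnW.
Qed.

Lemma hit_ge0 z x : (z <= n)%N -> 0 <= hit z x.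
Proof.
move=> zn; rewrite /hit big_nat; apply: sumr_ge0 => k /andP[_ kz].
have kn := leq_trans (ltnW kz) zn.
by rewrite divr_ge0 ?ltW ?lmass_gt0 // ne_gt0 // (leq_trans kz).
Qed.

Lemma stepE c f x : (x <= n)%N ->
  step c f x = (1 - c * (e x + e x.+1) / w x) * f x + c * e x / w x * f x.-1
             + c * e x.+1 / w x * f x.+1.
Proof. by move=> xn; rewrite /step; field; rewrite lt0r_neq0 ?nw_gt0. Qed.

(** The comparison principle: by [ne_le] and [c <= 1] all the coefficients in [stepE] are
    nonnegative. Neighbours are compared only where they exist, because a missing edge has
    conductance 0. *)
Lemma le_step c f g x : 0 <= c <= 1 -> (x <= n)%N ->
  f x <= g x -> ((0 < x)%N -> f x.-1 <= g x.-1) -> ((x < n)%N -> f x.+1 <= g x.+1) ->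
  step c f x <= step c g x.
Proof.
move=> /andP[c0 c1] xn fgx fgl fgr; rewrite !stepE //.
have w0 := nw_gt0 xn.
apply: lerD; first apply: lerD.
- apply: ler_wpM2l => //; rewrite subr_ge0 ler_pdivrMr // mul1r.
  apply: le_trans (ne_le xn); rewrite -[leRHS]mul1r ler_wpM2r //.
  by rewrite addr_ge0 // ne_ge0 // ltnW.
- case: x xn fgl {fgx fgr} w0 => [|x] xn fgl w0; first by rewrite ne_first mulr0 !mul0r.
  apply: ler_wpM2l; last exact: fgl.
  by rewrite divr_ge0 ?(ltW w0) // mulr_ge0 // ne_ge0 // ltnW.
- have: (x <= n)%N by []; rewrite leq_eqVlt => /predU1P[->|xn'].
    by rewrite ne_last mulr0 !mul0r.
  apply: ler_wpM2l; last exact: fgr.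
  by rewrite divr_ge0 ?(ltW w0) // mulr_ge0 // ne_ge0.
Qed.

Lemma eq_step c f g x : f =1 g -> step c f x = step c g x.
Proof. by move=> fg; rewrite /step !fg. Qed.

Lemma step_cst c (a : R) x : step c (fun=> a) x = a.
Proof. by rewrite /step !subrr !mulr0 subrr mulr0 addr0. Qed.

Lemma step_lin c (a b : R) f g x :
  step c (fun y => a * f y + b * g y) x = a * step c f x + b * step c g x.
Proof. by rewrite /step; ring. Qed.

Lemma step_addc c (a : R) f x : step c (fun y => a + f y) x = a + step c f x.
Proof. by rewrite /step; ring. Qed.

(** Green's formula: summation by parts has no boundary terms because the two end edges carry no
    conductance. Self-adjointness and invariance of the mean follow from it. *)
Lemma ip_step c f g : ip (step c f) g = ip f g - c * energy f g.
Proof.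
rewrite /ip /energy.
pose a x := e x * (f x - f x.-1).
transitivity (\sum_(0 <= x < n.+1) w x * (f x * g x) +
              c * \sum_(0 <= x < n.+1) (a x.+1 - a x) * g x).
  rewrite mulr_sumr -big_split /=; apply: eq_big_nat => x /andP[_ xn].
  by rewrite /step /a /=; field; rewrite lt0r_neq0 ?nw_gt0.
rewrite sum_by_parts /a ne_last ne_first !mul0r subrr sub0r mulrN.
by congr (_ - c * _); apply: eq_bigr => x _ /=; rewrite mulrA.
Qed.

Lemma energyC f g : energy f g = energy g f.
Proof. by apply: eq_bigr => x _; rewrite [X in _ * X]mulrC. Qed.

Lemma ipC f g : ip f g = ip g f.
Proof. by apply: eq_bigr => x _; rewrite [X in _ * X]mulrC. Qed.

Lemma ip_stepC c f g : ip (step c f) g = ip f (step c g).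
Proof. by rewrite [RHS]ipC !ip_step energyC ipC. Qed.

Lemma ip_ge0 f : 0 <= ip f f.
Proof.
rewrite /ip big_nat; apply: sumr_ge0 => x /andP[_ xn].
by apply: mulr_ge0; [rewrite ltW ?nw_gt0 | rewrite -expr2 sqr_ge0].
Qed.

Lemma energy_ge0 f : 0 <= energy f f.
Proof.
rewrite /energy big_nat; apply: sumr_ge0 => x /andP[_ xn].
by apply: mulr_ge0; [rewrite ltW ?ne_gt0 | rewrite -expr2 sqr_ge0].
Qed.

Lemma mean_ip f : mean f = ip f (fun=> 1).
Proof. by apply: eq_bigr => x _; rewrite mulr1. Qed.

Lemma mean_step c f : mean (step c f) = mean f.
Proof.
rewrite !mean_ip ip_step /energy big1 ?mulr0 ?subr0 // => x _.
by rewrite subrr !mulr0.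
Qed.

Lemma ip_lin (a b : R) f g h :
  ip (fun y => a * f y + b * g y) h = a * ip f h + b * ip g h.
Proof.
rewrite /ip !mulr_sumr -big_split; apply: eq_bigr => x _ /=; ring.
Qed.

End Network.

(** * Hitting times *)

Section Hitting.
Context {R : realFieldType}.
Variable N : network R.
Local Notation n := (nsz N).
Local Notation w := (nw N).
Local Notation e := (ne N).
Local Notation W := (lmass N).
Variable c : R.
Hypothesis c01 : 0 < c <= 1.
Implicit Types (f g : nat -> R) (x y z m : nat).

(* The probability that the chain started at [x] avoids [z] up to time [m]. *)
Fixpoint surv z m x : R :=
  if m is m'.+1 then if x == z then 0 else step N c (surv z m') x
  else (x != z)%:R.

Let c0 : 0 < c. Proof. by case/andP: c01. Qed.
Let c_ge0 : 0 <= c <= 1. Proof. by case/andP: c01 => /ltW -> ->. Qed.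

Lemma surv_ge0 z m x : (x <= n)%N -> 0 <= surv z m x.
Proof.
elim: m x => [|m IH] x xn /=; first by case: (x != z).
case: ifP => // _; rewrite -[leLHS](step_cst N c 0 x).
by apply: le_step => // *; apply: IH => //; rewrite (leq_trans (leq_pred _)).
Qed.

Lemma surv_le1 z m x : (x <= n)%N -> surv z m x <= 1.
Proof.
elim: m x => [|m IH] x xn /=; first by case: (x != z).
case: ifP => // _; rewrite -[leRHS](step_cst N c 1 x).
by apply: le_step => // *; apply: IH => //; rewrite (leq_trans (leq_pred _)).
Qed.

(** Markov's inequality for a nonnegative supermartingale [F] stopped at [z]: on survival up to time
    [m] its final value is at least [phi]. The starting time [k] varies in the induction on the
    number of remaining steps. *)
Lemma supermartingale_upper z (F : nat -> nat -> R) (phi : R) m k :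
  (z <= n)%N ->
  (forall j x, (x < z)%N -> step N c (F j.+1) x <= F j x) ->
  (forall j, 0 <= F j z) ->
  (forall x, (x < z)%N -> phi <= F (k + m)%N x) ->
  forall x, (x <= z)%N -> phi * surv z m x <= F k x.
Proof.
move=> zn Fs Fz; elim: m k => [|m IH] k Fphi x xz /=.
  case: eqVneq => [->|xNz]; first by rewrite mulr0.
  by rewrite mulr1; have := Fphi x; rewrite addn0; apply; rewrite ltn_neqAle xNz.
case: eqVneq => [->|xNz]; first by rewrite mulr0.
have xz' : (x < z)%N by rewrite ltn_neqAle xNz.
apply: le_trans (Fs k x xz').
have -> : phi * step N c (surv z m) x = step N c (fun y => phi * surv z m y) x.
  by rewrite /step; ring.
have FI := IH k.+1; rewrite addSnnS in FI.
by apply: le_step => //; do ?[move=> _]; try apply: FI => //;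
  rewrite ?(leq_trans xz) // (leq_trans (leq_pred _)).
Qed.

(** The complementary event: here [F] is at least [phi] at the moment of the visit to [z], and only
    nonnegative at the end if there was none. *)
Lemma supermartingale_lower z (F : nat -> nat -> R) (phi : R) m k :
  (z <= n)%N ->
  (forall j x, (x < z)%N -> step N c (F j.+1) x <= F j x) ->
  (forall j, (j <= k + m)%N -> phi <= F j z) ->
  (forall x, (x < z)%N -> 0 <= F (k + m)%N x) ->
  forall x, (x <= z)%N -> phi * (1 - surv z m x) <= F k x.
Proof.
move=> zn Fs; elim: m k => [|m IH] k Fz F0 x xz /=.
  case: eqVneq => [->|xNz]; first by rewrite subr0 mulr1 Fz ?addn0.
  by rewrite subrr mulr0; have := F0 x; rewrite addn0; apply; rewrite ltn_neqAle xNz.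
case: eqVneq => [->|xNz]; first by rewrite subr0 mulr1 Fz ?leq_addr.
have xz' : (x < z)%N by rewrite ltn_neqAle xNz.
apply: le_trans (Fs k x xz').
have -> : phi * (1 - step N c (surv z m) x)
        = step N c (fun y => phi * (1 - surv z m y)) x.
  by rewrite /step; ring.
have FI := IH k.+1; rewrite addSnnS in FI.
by apply: le_step => //; do ?[move=> _]; try apply: FI => //;
  rewrite ?(leq_trans xz) // (leq_trans (leq_pred _)).
Qed.

Lemma lmassS x : W x.+1 = W x + w x.+1.
Proof. by rewrite /lmass big_nat_recr. Qed.

Lemma lmass0 : W 0 = w 0.
Proof. by rewrite /lmass big_nat1. Qed.

Lemma hitS z x : (x < z)%N -> hit N z x = W x / e x.+1 + hit N z x.+1.
Proof. by move=> xz; rewrite /hit big_ltn. Qed.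

Lemma hit_self z : hit N z z = 0.
Proof. by rewrite /hit big_geq. Qed.

(** The flux [e x.+1 * (hit N z x - hit N z x.+1)] equals [W x], which grows by exactly [w x] at
    [x]: the drift of [hit N z / c] is -1. *)
Lemma step_hit z x : (x < z)%N -> (z <= n)%N ->
  step N c (fun y => hit N z y / c) x = hit N z x / c - 1.
Proof.
move=> xz zn; have xn := leq_trans xz zn.
have wN0 : w x != 0 by rewrite gt_eqF // nw_gt0 // ltnW.
have eN0 : e x.+1 != 0 by rewrite gt_eqF // ne_gt0.
have cN0 := lt0r_neq0 c0.
rewrite /step (hitS xz); case: x xz xn wN0 eN0 => [|x] xz xn wN0 eN0 /=.
  by rewrite ne_first lmass0; field; rewrite cN0 eN0 wN0.
have eN0' : e x.+1 != 0 by rewrite gt_eqF // ne_gt0 //= ltnW.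
rewrite (hitS (ltnW xz)) (hitS xz) lmassS; field.
by rewrite ?cN0 ?wN0 ?eN0 ?eN0'.
Qed.

(** At [x] the sum [S] grows by [W ^+ 2 / e] over the two edges at [x]. Divided by [c * w x], this
    is the mean square of the one-step change of [hit N z / c]. *)
Let S x := \sum_(0 <= y < x.+1) W y ^+ 2 / e y.+1 + \sum_(0 <= y < x) W y ^+ 2 / e y.+1.
(* [om z x / c ^+ 2] dominates the variance of the time to reach [z] from [x]. *)
Let om z x := \sum_(x <= k < z) S k / e k.+1.

(** Before the visit to [z], the position [x] at time [k] makes [hit N z x / c + k] a martingale;
    the term in [om] compensates the growth of its square. *)
Let F z a k x := (hit N z x / c + k%:R - a) ^+ 2 + om z x / c ^+ 2.

Let F_super z a k x : (x < z)%N -> (z <= n)%N -> step N c (F z a k.+1) x <= F z a k x.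
Proof.
move=> xz zn; have xn := leq_trans xz zn.
have wN0 : w x != 0 by rewrite gt_eqF // nw_gt0 // ltnW.
have eN0 : e x.+1 != 0 by rewrite gt_eqF // ne_gt0.
have cN0 := lt0r_neq0 c0.
have omS y : (y < z)%N -> om z y = S y / e y.+1 + om z y.+1.
  by move=> yz; rewrite /om big_ltn.
(* The surplus -1 comes from compensating the second moment of the increment instead of its
   variance: the mean of the increment of [hit N z / c] is -1. *)
suff -> : step N c (F z a k.+1) x = F z a k x - 1 by rewrite gerBl.
rewrite /step /F -natr1; case: x xz xn wN0 eN0 => [|x] xz xn wN0 eN0 /=.
  rewrite (hitS xz) (omS _ xz) ne_first /S big_nat1 big_geq // lmass0.
  by field; rewrite ?cN0 ?wN0 ?eN0.
have eN0' : e x.+1 != 0 by rewrite gt_eqF // ne_gt0 //= ltnW.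
rewrite (hitS (ltnW xz)) (hitS xz) (omS _ (ltnW xz)) (omS _ xz).
have -> : S x.+1 = S x + (W x.+1 ^+ 2 / e x.+2 + W x ^+ 2 / e x.+1).
  by rewrite /S big_nat_recr //= [X in _ + X = _]big_nat_recr //=; ring.
rewrite lmassS; field.
by rewrite ?cN0 ?wN0 ?eN0 ?eN0'.
Qed.

Let edge_gt0 z k : (z <= n)%N -> (k < z)%N -> 0 < e k.+1.
Proof. by move=> zn kz; rewrite ne_gt0 // (leq_trans kz). Qed.

Let term_ge0 z k : (z <= n)%N -> (k < z)%N -> 0 <= W k ^+ 2 / e k.+1.
Proof.
by move=> zn kz; rewrite divr_ge0 ?sqr_ge0 // ltW // (edge_gt0 zn).
Qed.

Let S_ge0 z k : (z <= n)%N -> (k < z)%N -> 0 <= S k.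
Proof.
move=> zn kz; rewrite /S addr_ge0 // big_nat sumr_ge0 // => y /andP[_ yk];
  by rewrite (term_ge0 zn) // (leq_ltn_trans _ kz) // ltnW.
Qed.

Let om_ge0 z x : (z <= n)%N -> 0 <= om z x.
Proof.
move=> zn; rewrite /om big_nat; apply: sumr_ge0 => k /andP[_ kz].
by rewrite divr_ge0 ?(S_ge0 zn) // ltW // (edge_gt0 zn).
Qed.

Let om_le0 z x : (x <= z)%N -> (z <= n)%N -> om z x <= om z 0.
Proof.
move=> xz zn; rewrite {2}/om (big_cat_nat (leq0n x) xz) /= lerDr big_nat.
apply: sumr_ge0 => k /andP[_ kx]; have kz := leq_trans kx xz.
by rewrite divr_ge0 ?(S_ge0 zn) // ltW // (edge_gt0 zn).
Qed.

(** The variance is at most [2 * l] times the mean: [S k] is at most twice the sum of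
    [W y ^+ 2 / e y.+1] over [y <= k], and exchanging the sums produces [W y * res N y z <= l] in
    front of the term [W y / e y.+1] of [hit]. *)
Let om_bound z l : (z <= n)%N -> (forall j, (j < z)%N -> W j * res N j z <= l) ->
  om z 0 <= 2 * l * hit N z 0.
Proof.
move=> zn Hl.
have : om z 0 <= \sum_(0 <= k < z) \sum_(0 <= y < k.+1) 2 * (W y ^+ 2 / e y.+1 * (e k.+1)^-1).
  rewrite /om !big_nat; apply: ler_sum => k /andP[_ kz].
  rewrite -mulr_sumr -mulr_suml mulrA; apply: ler_wpM2r.
    by rewrite invr_ge0 ltW // (edge_gt0 zn).
  rewrite /S mulr_natl mulr2n lerD2l; apply: ler_sum_nat_ge0 => // y /andP[_ yk].
  by rewrite (term_ge0 zn) // (leq_trans yk).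
move/le_trans; apply; rewrite -sum_triangle /hit mulr_sumr !big_nat.
apply: ler_sum => y /andP[_ yz].
rewrite -mulr_sumr -mulr_sumr -/(res N y z).
have -> : 2 * (W y ^+ 2 / e y.+1 * res N y z) = 2 * (W y * res N y z) * (W y / e y.+1).
  by rewrite expr2; ring.
apply: ler_wpM2r; last by apply: ler_wpM2l => //; exact: Hl.
by rewrite divr_ge0 // ltW ?(edge_gt0 zn) ?lmass_gt0 // (leq_trans (ltnW yz)).
Qed.

(** Chebyshev's inequality for the upper tail, centred at [hit N z x / c]. Both this mean and [om]
    are largest when the start is 0, which makes the bound uniform in [x]. *)
Lemma surv_upper z l m x : (z <= n)%N ->
  (forall j, (j < z)%N -> W j * res N j z <= l) ->
  (x <= z)%N -> hit N z 0 / c <= m%:R ->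
  surv z m x * (m%:R - hit N z 0 / c) ^+ 2 <= 2 * l * hit N z 0 / c ^+ 2.
Proof.
move=> zn Hl xz hm; rewrite mulrC.
have h_le y : (y <= z)%N -> 0 <= hit N z y / c <= hit N z 0 / c.
  by move=> yz; rewrite divr_ge0 ?hit_ge0 ?(ltW c0) //= ler_pM2r ?invr_gt0 ?le_hit.
have om0 y : 0 <= om z y / c ^+ 2 by rewrite divr_ge0 ?om_ge0 ?sqr_ge0.
have := @supermartingale_upper z (F z (hit N z x / c)) ((m%:R - hit N z 0 / c) ^+ 2) m 0 zn _ _ _ x xz.
move/(_ _ _ _)/le_trans; apply=> [j y yz|j|y yz|].
- exact: F_super.
- by rewrite /F addr_ge0 ?sqr_ge0.
- rewrite /F add0n -[leLHS]addr0 lerD // ler_sqr ?nnegrE ?subr_ge0 //; last first.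
    by have /andP[] := h_le _ (ltnW yz); have /andP[] := h_le _ xz; lra.
  by have /andP[] := h_le _ (ltnW yz); have /andP[] := h_le _ xz; lra.
- rewrite /F addr0 subrr expr0n add0r ler_pM2r ?invr_gt0 ?exprn_gt0 //.
  by rewrite (le_trans (om_le0 xz zn)) // om_bound.
Qed.

Lemma surv_lower z l m : (z <= n)%N ->
  (forall j, (j < z)%N -> W j * res N j z <= l) ->
  m%:R <= hit N z 0 / c ->
  (1 - surv z m 0) * (hit N z 0 / c - m%:R) ^+ 2 <= 2 * l * hit N z 0 / c ^+ 2.
Proof.
move=> zn Hl hm; rewrite mulrC.
have om0 y : 0 <= om z y / c ^+ 2 by rewrite divr_ge0 ?om_ge0 ?sqr_ge0.
have := @supermartingale_lower z (F z (hit N z 0 / c)) ((hit N z 0 / c - m%:R) ^+ 2) m 0 zn _ _ _ 0 (leq0n _).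
move/(_ _ _ _)/le_trans; apply=> [j y yz|j jm|y yz|].
- exact: F_super.
- rewrite /F hit_self mul0r add0r -[_ - hit N z 0 / c]opprB sqrrN -[leLHS]addr0 lerD //.
  have jm' : (j%:R : R) <= m%:R by rewrite ler_nat.
  by rewrite ler_sqr ?nnegrE ?subr_ge0 ?lerD2l ?lerN2 // (le_trans jm').
- by rewrite /F addr_ge0 ?sqr_ge0.
- rewrite /F addr0 subrr expr0n add0r ler_pM2r ?invr_gt0 ?exprn_gt0 //.
  exact: om_bound.
Qed.

(** After time [m], the mean time still to wait is at most [hit N z 0 / c] wherever the chain is,
    and it is 0 if [z] was visited. Hence the mean from 0 is at most [m] plus the survival
    probability times itself. *)
Lemma surv_mean z m : (z <= n)%N -> hit N z 0 / c * (1 - surv z m 0) <= m%:R.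
Proof.
move=> zn.
suff H : forall x, (x <= z)%N -> hit N z x / c <= m%:R + surv z m x * (hit N z 0 / c).
  by rewrite mulrBr mulr1 lerBlDr mulrC -mulrA [_^-1 * _]mulrC; have := H 0%N isT; lra.
elim: m => [|m IH] x xz /=; rewrite ?add0r.
  case: eqVneq => [->|_]; first by rewrite hit_self mul0r mul0r.
  by rewrite mul1r ler_pM2r ?invr_gt0 ?le_hit.
case: eqVneq => [->|xNz]; first by rewrite hit_self mul0r mul0r addr0.
have xz' : (x < z)%N by rewrite ltn_neqAle xNz.
have -> : hit N z x / c = 1 + step N c (fun y => hit N z y / c) x.
  by rewrite step_hit // addrC subrK.
rewrite -nat1r -addrA lerD2l.
have -> : m%:R + step N c (surv z m) x * (hit N z 0 / c) =
          step N c (fun y => m%:R + surv z m y * (hit N z 0 / c)) x.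
  by rewrite /step; ring.
by apply: le_step => //; do ?[move=> _]; try apply: IH => //;
  rewrite ?(leq_trans xz) // (leq_trans (leq_pred _)).
Qed.

End Hitting.

(** * Hardy inequality *)

Section Hardy.
Context {R : rcfType}.
Variable N : network R.
Local Notation n := (nsz N).
Local Notation w := (nw N).
Local Notation e := (ne N).
Local Notation W := (lmass N).

(* Muckenhoupt's weighted Hardy inequality: Cauchy-Schwarz with the square
   roots of the resistances as weights. *)
Lemma hardy i (l : R) (g : nat -> R) : (i <= n)%N ->
  (forall j, (j < i)%N -> W j * res N j i <= l) -> g i = 0 ->
  \sum_(0 <= x < i) w x * g x ^+ 2 <=
  4 * l * \sum_(0 <= k < i) e k.+1 * (g k.+1 - g k) ^+ 2.
Proof.
move=> ni Hl gi0.
pose s x := Num.sqrt (res N x i); pose V x := Num.sqrt (W x).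
have e_gt0 k : (k < i)%N -> 0 < e k.+1 by move=> ki; rewrite ne_gt0 // (leq_trans ki).
have resS x : (x < i)%N -> res N x i = (e x.+1)^-1 + res N x.+1 i.
  by move=> xi; rewrite /res big_ltn.
have res_ge0 x : 0 <= res N x i.
  rewrite /res big_nat sumr_ge0 // => k /andP[_ ki].
  by rewrite invr_ge0 ltW ?e_gt0.
have s2 x : s x ^+ 2 = res N x i by rewrite sqr_sqrtr.
have s_ge0 x : 0 <= s x by rewrite sqrtr_ge0.
have s_gt0 x : (x < i)%N -> 0 < s x.
  by move=> xi; rewrite sqrtr_gt0 resS // ltr_wpDr // invr_gt0 e_gt0.
have V2 x : (x <= n)%N -> V x ^+ 2 = W x by move=> xn; rewrite sqr_sqrtr // ltW ?lmass_gt0.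
have V_gt0 x : (x <= n)%N -> 0 < V x by move=> xn; rewrite sqrtr_gt0 lmass_gt0.
(* Cauchy-Schwarz with weights [e * s]. The factor [2 * s x] bounds the sum of [1 / (e k.+1 * s k)]
   over [k >= x]: as [1 / e k.+1 = s k ^+ 2 - s k.+1 ^+ 2], each term is at most
   [2 * (s k - s k.+1)]. *)
have H1 x : (x <= i)%N ->
    g x ^+ 2 <= 2 * s x * \sum_(x <= k < i) e k.+1 * s k * (g k.+1 - g k) ^+ 2.
  move=> xi; rewrite -(subKn xi); move: (i - x)%N => d; elim: d => [|d IH].
    by rewrite subn0 gi0 expr0n big_geq // mulr0.
  case: (leqP i d) => di; first by rewrite (_ : (i - d.+1)%N = (i - d)%N) //; lia.
  have dS : (i - d)%N = (i - d.+1).+1 by lia.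
  move: IH; rewrite {}dS; have yi : (i - d.+1 < i)%N by lia.
  move: (i - d.+1)%N yi => y yi IH; rewrite big_ltn //.
  have rE := resS y yi; rewrite -!s2 in rE.
  have sy := s_gt0 y yi; have sy1 := s_ge0 y.+1; have ey := e_gt0 y yi.
  have s_le : s y.+1 <= s y by rewrite -ler_sqr ?nnegrE // rE lerDr invr_ge0 ltW.
  set B := \sum_(y.+1 <= k < i) _ in IH *.
  have B0 : 0 <= B.
    rewrite /B big_nat sumr_ge0 // => k /andP[_ ki].
    by rewrite mulr_ge0 ?sqr_ge0 // mulr_ge0 // ltW ?e_gt0.
  rewrite [X in X ^+ 2 <= _](_ : g y = g y.+1 + (g y - g y.+1)); last by ring.
  apply: le_trans (@sqr_add_le _ (2 * s y.+1) B ((e y.+1)^-1 / s y)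
    (e y.+1 * s y * (g y.+1 - g y) ^+ 2) _ _ _ _ _ _ _ _) _ => //.
  - by rewrite mulr_ge0.
  - by rewrite divr_ge0 // invr_ge0 ltW.
  - by rewrite mulr_ge0 ?sqr_ge0 // mulr_ge0 // ltW.
  - rewrite le_eqVlt; apply/orP; left; apply/eqP; field.
    by rewrite ?lt0r_neq0.
  - have Hs : 2 * s y.+1 + (e y.+1)^-1 / s y <= 2 * s y.
      rewrite -lerBrDl ler_pdivrMr //.
      have -> : (e y.+1)^-1 = s y ^+ 2 - s y.+1 ^+ 2 by rewrite rE; ring.
      nra.
    rewrite [B + _]addrC; apply: ler_wpM2r => //.
    by rewrite addr_ge0 // mulr_ge0 ?sqr_ge0 // mulr_ge0 // ltW.
(* With [L] the square root of [l] the hypothesis reads [V x * s x <= L]. Since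
   [w x = V x ^+ 2 - V x.-1 ^+ 2], each [w x * s x] is at most [2 * L * (V x - V x.-1)], and the sum
   telescopes. *)
have H2 k : (k < i)%N -> s k * (\sum_(0 <= x < k.+1) w x * s x) <= 2 * l.
  move=> ki.
  have l0 : 0 <= l.
    apply: le_trans (Hl k ki); apply: mulr_ge0 => //.
    by rewrite ltW ?lmass_gt0 // (leq_trans (ltnW ki)).
  pose L := Num.sqrt l.
  have L0 : 0 <= L by rewrite sqrtr_ge0.
  have L2 : L ^+ 2 = l by rewrite sqr_sqrtr.
  have sV x : (x < i)%N -> V x * s x <= L.
    move=> xi; have xn : (x <= n)%N by rewrite (leq_trans (ltnW xi)).
    have Vx := ltW (V_gt0 x xn).
    by rewrite -ler_sqr ?nnegrE ?mulr_ge0 // exprMn V2 // s2 L2 Hl.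
  have : \sum_(0 <= x < k.+1) w x * s x <= 2 * L * V k.
    elim: k ki => [|k IH] ki.
      have n0 : (0 <= n)%N by [].
      have := sV 0%N ki; rewrite big_nat1 -lmass0 -V2 //; have := V_gt0 0%N n0.
      by move: (s_ge0 0%N); nra.
    have kn : (k.+1 <= n)%N by rewrite (leq_trans (ltnW ki)).
    have := IH (ltnW ki); have := sV _ ki; rewrite [in X in _ -> _ -> X]big_nat_recr //=.
    have -> : w k.+1 = V k.+1 ^+ 2 - V k ^+ 2.
      by rewrite !V2 ?(ltnW kn) // lmassS; ring.
    have Vle : V k <= V k.+1 by rewrite ler_sqrt ?le_lmass ?ltW ?lmass_gt0.
    have := V_gt0 _ (ltnW kn); have := s_ge0 k.+1.
    move: (\sum_(0 <= x < k.+1) _) => T s0 Vk Vs IHk.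
    have : (V k.+1 + V k) * s k.+1 <= 2 * L by nra.
    have : 0 <= V k.+1 - V k by lra.
    by nra.
  move/(ler_wpM2l (s_ge0 k))/le_trans; apply.
  have := sV k ki; rewrite -L2; move: (s_ge0 k); nra.
have T1 : \sum_(0 <= x < i) w x * g x ^+ 2 <=
    \sum_(0 <= x < i) \sum_(x <= k < i) 2 * (w x * s x) * (e k.+1 * s k * (g k.+1 - g k) ^+ 2).
  rewrite !big_nat; apply: ler_sum => x /andP[_ xi].
  rewrite -mulr_sumr; have := H1 x (ltnW xi).
  have xn : (x <= n)%N by rewrite (leq_trans (ltnW xi)).
  by move/(ler_wpM2l (ltW (nw_gt0 xn)))/le_trans; apply; rewrite le_eqVlt; apply/orP; left; apply/eqP; ring.
(* After the exchange of sums each edge carries the quantity bounded in [H2]; the constant 4 is the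
   product of the factors 2 in [H1] and [H2]. *)
apply: (le_trans T1); rewrite sum_triangle mulr_sumr !big_nat.
apply: ler_sum => k /andP[_ ki].
rewrite -mulr_suml -mulr_sumr.
have -> : 2 * (\sum_(0 <= x < k.+1) w x * s x) * (e k.+1 * s k * (g k.+1 - g k) ^+ 2) =
  2 * (s k * \sum_(0 <= x < k.+1) w x * s x) * (e k.+1 * (g k.+1 - g k) ^+ 2) by ring.
apply: ler_wpM2r; first by rewrite mulr_ge0 ?sqr_ge0 // ltW ?e_gt0.
by have := H2 k ki; lra.
Qed.

End Hardy.

(** * Reflection and the bulk *)

Section Reflection.
Context {R : realFieldType}.
Variable N : network R.
Local Notation n := (nsz N).
Local Notation w := (nw N).
Local Notation e := (ne N).
Implicit Types (f g : nat -> R) (c : R) (x y z : nat).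

Lemma sum_nat_refl f m : \sum_(0 <= x < m.+1) f (m - x)%N = \sum_(0 <= x < m.+1) f x.
Proof. by rewrite big_nat_rev /=; apply: eq_big_nat => x /andP[_ xm]; congr f; lia. Qed.

Let rw x := w (n - x).
(** Edge [x] joins [x.-1] to [x]; its mirror image joins [n - x] to [n.+1 - x], and an edge is
    indexed by its upper end. *)
Let re x := e (n.+1 - x).
Let rw_gt0 x : (x <= n)%N -> 0 < rw x.
Proof. by move=> _; rewrite nw_gt0 // leq_subr. Qed.
Let rw_sum : \sum_(0 <= x < n.+1) rw x = 1.
Proof. by rewrite sum_nat_refl nw_sum. Qed.
Let re_gt0 x : (0 < x <= n)%N -> 0 < re x.
Proof. by move=> xn; rewrite ne_gt0 //; lia. Qed.
Let re_first : re 0 = 0. Proof. by rewrite /re subn0 ne_last. Qed.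
Let re_last : re n.+1 = 0. Proof. by rewrite /re subnn ne_first. Qed.
Let re_le x : (x <= n)%N -> re x + re x.+1 <= rw x.
Proof. by move=> xn; rewrite /re /rw subSS subSn // addrC ne_le // leq_subr. Qed.

Definition refl : network R := Network rw_gt0 rw_sum re_gt0 re_first re_last re_le.

Definition rmass x := \sum_(x <= j < n.+1) w j.
Definition rhit z x := \sum_(z <= k < x) rmass k.+1 / e k.+1.

Lemma sum_nat_shift_refl f a b m : (b <= m)%N ->
  \sum_(m - b <= x < m - a) f x = \sum_(a <= x < b) f (m - x.+1)%N.
Proof.
elim: b => [|b IH] bm; first by rewrite subn0 !big_geq // leq_subr.
case: (leqP a b) => ab; last by rewrite !big_geq //; lia.
rewrite big_nat_recr //= -IH ?(ltnW bm) // addrC big_ltn; last by lia.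
by congr (_ + _); apply: congr_big_nat => //; lia.
Qed.

Lemma lmass_refl x : (x <= n)%N -> lmass refl (n - x) = rmass x.
Proof.
move=> xn; rewrite /lmass /rmass /= -subSn // -{1}[n.+1](subnK (leqnn n.+1)) subnn add0n.
have := @sum_nat_shift_refl rw x n.+1 n.+1 (leqnn _); rewrite subnn => ->.
by apply: eq_big_nat => j /andP[_ jn]; rewrite /rw subSS subKn.
Qed.

Lemma rmass_refl x : (x <= n)%N -> \sum_((n - x)%N <= j < n.+1) nw refl j = lmass N x.
Proof.
move=> xn; rewrite /lmass /=.
have := @sum_nat_shift_refl rw 0 x.+1 n.+1; rewrite subn0 subSS => -> //.
by apply: eq_big_nat => j /andP[_ jx]; rewrite /rw subSS subKn //; lia.
Qed.

Lemma res_refl a b : (b <= n)%N -> res refl (n - b) (n - a) = res N a b.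
Proof.
move=> bn; rewrite /res /= sum_nat_shift_refl //.
by apply: eq_big_nat => j /andP[_ jb]; rewrite /re; congr (e _)^-1; lia.
Qed.

Lemma hit_refl z x : (x <= n)%N -> hit refl (n - z) (n - x) = rhit z x.
Proof.
move=> xn; rewrite /hit /rhit sum_nat_shift_refl //.
apply: eq_big_nat => k /andP[_ kx]; rewrite lmass_refl ?(leq_trans kx) //=.
by rewrite /re; congr (_ / e _); lia.
Qed.

(** Values of [f] beyond [n] are harmless: at [n] the value at [n.+1] is multiplied by the
    conductance 0, so functions on [nat] represent functions on the state space. *)
Lemma eq_step_le c f g x : (x <= n)%N -> (forall y, (y <= n)%N -> f y = g y) ->
  step N c f x = step N c g x.
Proof.
move=> xn fg; rewrite !stepE // (fg x) // (fg x.-1) ?(leq_trans (leq_pred _)) //; congr (_ + _).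
move: xn; rewrite leq_eqVlt => /predU1P[->|xn]; first by rewrite ne_last mulr0 !mul0r.
by rewrite fg.
Qed.

Lemma step_refl c f x : (x <= n)%N ->
  step refl c (fun y => f (n - y)%N) (n - x) = step N c f x.
Proof.
move=> xn; rewrite /step /= /re /rw subSS subKn // subSn ?leq_subr // subKn //.
have -> : e x.+1 * (f x.+1 - f x) = e x.+1 * (f (n - (n - x).-1)%N - f x).
  move: xn; rewrite leq_eqVlt => /predU1P[->|xn]; first by rewrite ne_last !mul0r.
  by congr (_ * (f _ - _)); lia.
have -> : (n - (n - x).+1 = x.-1)%N by lia.
by ring.
Qed.

End Reflection.

Section ReflectionSurv.
Context {R : realFieldType}.
Variable N : network R.
Local Notation n := (nsz N).

Lemma iter_step_refl c f m x : (x <= n)%N ->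
  iter m (step (refl N) c) (fun y => f (n - y)%N) (n - x)%N = iter m (step N c) f x.
Proof.
elim: m x => [|m IH] x xn /=; first by rewrite subKn.
rewrite -[RHS]step_refl //; apply: eq_step_le => /=; first exact: leq_subr.
by move=> y yn; rewrite -[in RHS]IH ?leq_subr // subKn.
Qed.

Lemma surv_refl (c : R) z m x : (x <= n)%N -> (z <= n)%N ->
  surv (refl N) c (n - z)%N m (n - x)%N = surv N c z m x.
Proof.
move=> xn zn; have E y : (y <= n)%N -> ((n - y)%N == (n - z)%N) = (y == z) by lia.
elim: m x xn => [|m IH] x xn /=; rewrite E //.
case: eqP => // _; rewrite -[RHS]step_refl //; apply: eq_step_le => /=; first exact: leq_subr.
by move=> y yn; rewrite -[in RHS]IH ?leq_subr // subKn.
Qed.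

Lemma ip_refl (f g : nat -> R) :
  ip (refl N) (fun y => f (n - y)%N) (fun y => g (n - y)%N) = ip N f g.
Proof. by rewrite /ip /= -[RHS]sum_nat_refl. Qed.

Lemma mean_refl (f : nat -> R) : mean (refl N) (fun y => f (n - y)%N) = mean N f.
Proof. by rewrite /mean /= -[RHS]sum_nat_refl. Qed.

Lemma energy_refl (f : nat -> R) :
  energy (refl N) (fun y => f (n - y)%N) (fun y => f (n - y)%N) = energy N f f.
Proof.
rewrite /energy /= big_nat_rev; apply: eq_big_nat => x /andP[_ xn].
have -> : (n.+1 - (0 + n - x.+1).+1 = x.+1)%N by lia.
have -> : (n - (0 + n - x.+1).+1 = x)%N by lia.
have -> : (n - (0 + n - x.+1) = x.+1)%N by lia.
by ring.
Qed.

(* [t] bounds the mean times to reach [i] from both ends, [l] the constants of the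
   Hardy inequalities on both sides of [i]. *)
Record median_bounds (M : network R) i t l : Prop := MedianBounds {
  mb_le : (i <= nsz M)%N;
  mb_lmass : 1 / 2 <= lmass M i;
  mb_rmass : 1 / 2 <= rmass M i;
  mb_hit : hit M i 0 <= t;
  mb_rhit : rhit M i (nsz M) <= t;
  mb_l_ge0 : 0 <= l;
  mb_left : forall j, (j < i)%N -> lmass M j * res M j i <= l;
  mb_right : forall j, (i < j <= nsz M)%N -> rmass M j * res M i j <= l }.

Lemma median_bounds_refl i t l : median_bounds N i t l -> median_bounds (refl N) (n - i) t l.
Proof.
case=> ni li ri hi rhi l0 Hl Hr; split => //=.
- exact: leq_subr.
- by rewrite lmass_refl.
- by rewrite /rmass rmass_refl.
- by rewrite -(subnn n) hit_refl.
- suff -> : rhit (refl N) (n - i) n = hit N i 0 by [].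
  rewrite /rhit /hit -{2}(subn0 n) sum_nat_shift_refl //; apply: eq_big_nat => k /andP[_ ki].
  rewrite /rmass -subSn ?subSS /=; last by lia.
  by rewrite rmass_refl; [congr (_ / ne N _); lia | lia].
- move=> j ji; have jn : (j <= n)%N by lia.
  have := Hr (n - j)%N; rewrite -lmass_refl ?leq_subr // subKn //.
  by rewrite -res_refl ?leq_subr // subKn //; apply; lia.
- move=> j /andP[ij jn].
  have := Hl (n - j)%N; rewrite -rmass_refl ?leq_subr // subKn //.
  by rewrite -res_refl // subKn //; apply; lia.
Qed.

End ReflectionSurv.

Section Bulk.
Context {R : realFieldType}.
Implicit Types (N : network R) (c t l : R).

Lemma le_rmass N x y : (x <= y)%N -> (y <= (nsz N).+1)%N -> rmass N y <= rmass N x.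
Proof.
move=> xy yn; rewrite /rmass (big_cat_nat xy yn) /= lerDr big_nat.
by apply: sumr_ge0 => k /andP[_ ky]; rewrite ltW // nw_gt0 //; lia.
Qed.

Lemma rmass_gt0 N x : (x <= nsz N)%N -> 0 < rmass N x.
Proof. by move=> xn; rewrite -lmass_refl // lmass_gt0 //= leq_subr. Qed.

Lemma res_cat N a b d : (a <= b)%N -> (b <= d)%N -> res N a d = res N a b + res N b d.
Proof. by move=> ab bd; rewrite /res (big_cat_nat ab bd). Qed.

Lemma hit_cat N z a b : (a <= b)%N -> (b <= z)%N -> hit N z a = hit N b a + hit N z b.
Proof. by move=> ab bd; rewrite /hit (big_cat_nat ab bd). Qed.

Lemma res_ge0 N a b : (b <= nsz N)%N -> 0 <= res N a b.
Proof.
move=> bn; rewrite /res big_nat sumr_ge0 // => k /andP[_ kb].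
by rewrite invr_ge0 ne_ge0 //; lia.
Qed.

Lemma hit_le_res N a b : (b <= nsz N)%N -> hit N b a <= res N a b.
Proof.
move=> bn; rewrite /hit /res !big_nat; apply: ler_sum => k /andP[_ kb].
rewrite -[leRHS]mul1r ler_wpM2r ?invr_ge0 ?ne_ge0 ?lmass_le1 //; lia.
Qed.

(** If [z] lies beyond [i], the mass 1/4 to its right and the Hardy bound force
    [res N i z <= 4 * l]. This resistance bounds the extra mean time from [i] to [z], since
    [lmass <= 1], and it adds [4 * l] to the Hardy constant of the left side. *)
Lemma hit_bulk N i t l z : median_bounds N i t l -> (z <= nsz N)%N ->
  1 / 4 <= rmass N z ->
  hit N z 0 <= t + 4 * l /\ forall j, (j < z)%N -> lmass N j * res N j z <= 5 * l.
Proof.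
move=> [ni li ri hi rhi l0 Hl Hr] zn rz.
case: (leqP z i) => zi.
  split.
    have -> : hit N z 0 = hit N i 0 - hit N i z by rewrite (hit_cat N (leq0n z) zi) addrK.
    by have := @hit_ge0 _ N i z ni; lra.
  move=> j jz; have ji := leq_trans jz zi.
  have := Hl j ji; rewrite (res_cat N (ltnW jz) zi) mulrDr.
  have : 0 <= lmass N j * res N z i.
    by rewrite mulr_ge0 ?res_ge0 // ltW // lmass_gt0 //; lia.
  by lra.
have resl : res N i z <= 4 * l.
  have := Hr z; rewrite zi zn => /(_ isT); have := @res_ge0 N i z zn; nra.
split.
  rewrite (hit_cat N (leq0n i) (ltnW zi)); have := @hit_le_res N i z zn; lra.
move=> j jz; have jn : (j <= nsz N)%N by lia.
have W1 := lmass_le1 jn; have W0 := ltW (lmass_gt0 jn).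
case: (ltnP j i) => ji.
  rewrite (res_cat N (ltnW ji) (ltnW zi)) mulrDr; have := Hl j ji.
  have := @res_ge0 N i z zn; nra.
have : res N j z <= res N i z.
  by rewrite (res_cat N ji (ltnW jz)) lerDr res_ge0.
have := ler_piMl (@res_ge0 N j z zn) W1; lra.
Qed.

Lemma surv_bulk_left N c i t l z m D x : 0 < c <= 1 ->
  median_bounds N i t l -> l <= t ->
  (z <= nsz N)%N -> 1 / 4 <= rmass N z -> (x <= z)%N ->
  0 < D -> (t + 4 * l) / c + D <= m%:R ->
  surv N c z m x * (c * D) ^+ 2 <= 50 * l * t.
Proof.
move=> c01 mb lt zn rz xz D0 Dm; have /andP[c0 _] := c01.
have [hz lz] := hit_bulk mb zn rz.
have l0 := mb_l_ge0 mb.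
have h0 := @hit_ge0 _ N z 0%N zn.
have hc : hit N z 0 / c <= (t + 4 * l) / c by rewrite ler_pM2r ?invr_gt0.
have hm : hit N z 0 / c <= m%:R by lra.
have := surv_upper c01 zn lz xz hm; rewrite ler_pdivlMr ?exprn_gt0 //.
rewrite exprMn mulrCA mulrA => H.
have Db : D ^+ 2 <= (m%:R - hit N z 0 / c) ^+ 2.
  by rewrite ler_sqr ?nnegrE ?subr_ge0 //; lra.
have sv0 : 0 <= surv N c z m x by apply: surv_ge0 => //; exact: leq_trans zn.
have : surv N c z m x * D ^+ 2 * c ^+ 2 <=
       surv N c z m x * (m%:R - hit N z 0 / c) ^+ 2 * c ^+ 2.
  by rewrite ler_wpM2r ?sqr_ge0 // ler_wpM2l.
(* The mean is at most [t + 4 * l], hence at most [5 * t] as [l <= t]. *)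
have : 2 * (5 * l) * hit N z 0 <= 50 * l * t by nra.
by move: H; lra.
Qed.

Lemma surv_bulk N c i t l z m D x : 0 < c <= 1 ->
  median_bounds N i t l -> l <= t ->
  (z <= nsz N)%N -> 1 / 4 <= lmass N z -> 1 / 4 <= rmass N z -> (x <= nsz N)%N ->
  0 < D -> (t + 4 * l) / c + D <= m%:R ->
  surv N c z m x * (c * D) ^+ 2 <= 50 * l * t.
Proof.
move=> c01 mb lt zn lz rz xn D0 Dm.
case: (leqP x z) => xz; first exact: (surv_bulk_left c01 mb).
rewrite -surv_refl //; apply: (surv_bulk_left c01 (median_bounds_refl mb)) => //.
- exact: leq_subr.
- by rewrite /rmass rmass_refl.
- exact/leq_sub2l/ltnW.
Qed.

(** If the last state satisfies the condition, the whole sum is at most [lmass] of that state;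
    otherwise it contributes nothing. *)
Lemma mass_small N a m : 0 <= a -> (m <= (nsz N).+1)%N ->
  \sum_(0 <= x < m | lmass N x < a) nw N x <= a.
Proof.
move=> a0; elim: m => [|m IH] mn; first by rewrite big_geq.
rewrite big_mkcond big_nat_recr //= -big_mkcond /=.
case: ifP => [Wa|_]; last by rewrite addr0 IH // ltnW.
apply: le_trans (ltW Wa); rewrite /lmass [leRHS]big_nat_recr //= lerD2r.
rewrite big_mkcond !big_nat; apply: ler_sum => x /andP[_ xm].
by case: ifP => // _; rewrite ltW // nw_gt0 //; lia.
Qed.

Lemma mass_bulk N :
  1 / 2 <= \sum_(0 <= x < (nsz N).+1 | (1 / 4 <= lmass N x) && (1 / 4 <= rmass N x)) nw N x.
Proof.
have a4 : 0 <= 1 / 4 :> R by rewrite divr_ge0.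
have A := @mass_small N (1/4) (nsz N).+1.
have B := @mass_small (refl N) (1/4) (nsz N).+1.
have B' : \sum_(0 <= x < (nsz N).+1 | rmass N x < 1 / 4) nw N x <= 1/4.
  apply: le_trans (B a4 (leqnn _)).
  rewrite big_mkcond [leRHS]big_mkcond -[leLHS]sum_nat_refl /=.
  rewrite !big_nat; apply: ler_sum => x /andP[_ xn].
  by rewrite -(lmass_refl (leq_subr x _)) subKn.
have := nw_sum N.
have := A a4 (leqnn _); move: B'.
rewrite !(big_mkcond (fun x => _ < _)) (big_mkcond (fun x => _ && _)).
move=> H1 H2 H3.
suff : \sum_(0 <= x < (nsz N).+1) nw N x <=
  \sum_(0 <= x < (nsz N).+1) (if (1 / 4 <= lmass N x) && (1 / 4 <= rmass N x) then nw N x else 0)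
  + (\sum_(0 <= x < (nsz N).+1) (if lmass N x < 1 / 4 then nw N x else 0)
  + \sum_(0 <= x < (nsz N).+1) (if rmass N x < 1 / 4 then nw N x else 0)) by lra.
rewrite -!big_split /= !big_nat; apply: ler_sum => x /andP[_ xn].
have w0 := ltW (nw_gt0 (_ : x <= nsz N)%N); have {}w0 := w0 xn.
case: (lerP (1/4) (lmass N x)) => _; case: (lerP (1/4) (rmass N x)) => _ /=; lra.
Qed.

End Bulk.

(** * Spectral gap and maximal inequality *)

Section SpectralGap.
Context {R : rcfType}.
Implicit Types (N : network R) (f g : nat -> R).

(** The variance is at most the second moment about [f i]. The function [f - f i] vanishes at [i],
    so that Hardy's inequality applies on each side, on the right through the reflection. *)
Lemma poincare N i t l f : median_bounds N i t l -> mean N f = 0 ->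
  ip N f f <= 4 * l * energy N f f.
Proof.
move=> mb f0; have ni := mb_le mb.
pose g x := f x - f i.
have gE : ip N f f <= \sum_(0 <= x < (nsz N).+1) nw N x * g x ^+ 2.
  have -> : \sum_(0 <= x < (nsz N).+1) nw N x * g x ^+ 2 =
            ip N f f - 2 * f i * mean N f + f i ^+ 2.
    have -> : f i ^+ 2 = \sum_(0 <= x < (nsz N).+1) nw N x * f i ^+ 2.
      by rewrite -mulr_suml nw_sum mul1r.
    rewrite /ip /mean mulr_sumr -sumrN.
    by rewrite -!big_split /=; apply: eq_bigr => x _; rewrite /g; ring.
  by rewrite f0 mulr0 subr0 lerDl sqr_ge0.
apply: (le_trans gE).
have HL := hardy ni (mb_left mb) (subrr (f i) : g i = 0).
have mbr := median_bounds_refl mb.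
have HR := hardy (mb_le mbr) (mb_left mbr) (_ : (fun x => g (nsz N - x)%N) _ = 0).
move: HR; rewrite subKn // => /(_ (subrr _)) HR.
have ni' : (i < (nsz N).+1)%N by [].
rewrite (big_cat_nat (leq0n i) (ltnW ni')) /= [X in _ + X <= _]big_ltn // /g subrr expr0n mulr0 add0r.
have -> : \sum_(i.+1 <= x < (nsz N).+1) nw N x * (f x - f i) ^+ 2 =
          \sum_(0 <= x < nsz N - i) nw (refl N) x * g (nsz N - x)%N ^+ 2.
  have := @sum_nat_shift_refl R (fun x => nw (refl N) x * g (nsz N - x)%N ^+ 2) i.+1 (nsz N).+1 (nsz N).+1 (leqnn _).
  rewrite subnn subSS => ->; apply: eq_big_nat => x /andP[_ xn] /=.
  by rewrite subSS subKn.
have -> : energy N f f = \sum_(0 <= k < i) ne N k.+1 * (g k.+1 - g k) ^+ 2 +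
   \sum_(0 <= k < nsz N - i) ne (refl N) k.+1 *
             (g (nsz N - k.+1)%N - g (nsz N - k)%N) ^+ 2.
  rewrite /energy (big_cat_nat (leq0n i) ni) /=; congr (_ + _).
    by apply: eq_bigr => k _; rewrite /g; ring.
  have := @sum_nat_shift_refl R (fun k => ne N (nsz N - k)%N * (g (nsz N - k.+1)%N - g (nsz N - k)%N) ^+ 2) i (nsz N) (nsz N) (leqnn _).
  rewrite subnn => ->; apply: eq_big_nat => k /andP[_ kn].
  have -> : (nsz N - (nsz N - k.+1) = k.+1)%N by lia.
  have -> : (nsz N - (nsz N - k.+1).+1 = k)%N by lia.
  by rewrite /g; ring.
by rewrite mulrDr; exact: lerD HL HR.
Qed.

Lemma step_sqr N c f x : 0 <= c <= 1 -> (x <= nsz N)%N ->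
  step N c f x ^+ 2 <= step N c (fun y => f y ^+ 2) x.
Proof.
move=> c01 xn; rewrite -subr_ge0.
have E (a : R) : step N c (fun y => (f y - a) ^+ 2) x =
    step N c (fun y => f y ^+ 2) x - 2 * a * step N c f x + a ^+ 2.
  by rewrite /step; ring.
rewrite (_ : _ - _ = step N c (fun y => (f y - step N c f x) ^+ 2) x); last by rewrite E; ring.
rewrite -[leLHS](step_cst N c 0 x).
by apply: le_step => // *; exact: sqr_ge0.
Qed.

Lemma ip_meanE N f : ip N f f = mean N (fun y => f y ^+ 2).
Proof. by apply: eq_bigr => x _; rewrite expr2. Qed.

Lemma ip_step_le N c f : 0 <= c <= 1 -> ip N (step N c f) (step N c f) <= ip N f f.
Proof.
move=> c01; rewrite !ip_meanE -(mean_step N c (fun y => f y ^+ 2)) /mean !big_nat.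
apply: ler_sum => x /andP[_ xn]; apply: ler_wpM2l; first by rewrite ltW ?nw_gt0.
exact: step_sqr.
Qed.

(* Laziness bounds the spectrum away from -1. *)
Lemma step_gap N c i t l f : 0 < c < 1 -> median_bounds N i t l -> 0 < l -> mean N f = 0 ->
  ip N (step N c f) (step N c f) <= (1 - (1 - c) * c / (2 * l)) * ip N f f.
Proof.
move=> /andP[c0 c1] mb l0 f0.
have K : ip N (step N 1 f) (step N 1 f) <= ip N f f by apply: ip_step_le; rewrite ler01 lexx.
have E := ip_step N 1 f f.
(* Write the lazy step as [(1 - c)] times the identity plus [c] times [step N 1] and expand. Only
   the cross term uses the Poincare inequality; the square of [step N 1] is merely a contraction. *)
have D : ip N (step N c f) (step N c f) =
  (1 - c) ^+ 2 * ip N f f + 2 * (1 - c) * c * ip N (step N 1 f) f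
  + c ^+ 2 * ip N (step N 1 f) (step N 1 f).
  rewrite /ip !mulr_sumr -!big_split /=; apply: eq_bigr => x _.
  have -> : step N c f x = (1 - c) * f x + c * step N 1 f x by rewrite /step; ring.
  ring.
have P := poincare mb f0.
have P' : ip N f f / (4 * l) <= energy N f f by rewrite ler_pdivrMr; [lra | lra].
have -> : (1 - (1 - c) * c / (2 * l)) * ip N f f =
    ip N f f - 2 * ((1 - c) * c) * (ip N f f / (4 * l)).
  by field; rewrite lt0r_neq0.
rewrite D E.
have cc : 0 < (1 - c) * c by nra.
have : 2 * ((1 - c) * c) * (ip N f f / (4 * l)) <= 2 * ((1 - c) * c) * energy N f f.
  by rewrite ler_wpM2l //; lra.
have : c ^+ 2 * ip N (step N 1 f) (step N 1 f) <= c ^+ 2 * ip N f f.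
  by rewrite ler_wpM2l // sqr_ge0.
lra.
Qed.

(** On an eigenfunction of eigenvalue [la] this reads [4 * (1 - c) ^+ 2 * (1 - la) ^+ 2 <= (1 - la
    ^+ 2) ^+ 2], true since laziness gives [1 + la >= 2 * (1 - c)]. The right side is the squared
    norm of [v + step N c v = (2 - c) * v + c * k], which is expanded using that [step N 1] is a
    contraction. *)
Lemma step_diff_le N c f : 0 < c < 1 ->
  let g := step N c f in let h := step N c g in
  4 * (1 - c) ^+ 2 * ip N (fun y => g y - f y) (fun y => g y - f y) <=
  ip N f f - 2 * ip N g g + ip N h h.
Proof.
move=> /andP[c0 c1] /=; set g := step N c f; set h := step N c g.
pose v y := f y - g y; pose k := step N 1 v.
have K : ip N k k <= ip N v v by apply: ip_step_le; rewrite ler01 lexx.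
have -> : ip N (fun y => g y - f y) (fun y => g y - f y) = ip N v v.
  by apply: eq_bigr => x _; rewrite /v; ring.
have -> : ip N f f - 2 * ip N g g + ip N h h =
  ip N (fun y => (2 - c) * v y + c * k y) (fun y => (2 - c) * v y + c * k y).
  have -> : ip N g g = ip N h f by rewrite {1}/g ip_stepC ipC.
  rewrite /ip mulr_sumr -sumrN -!big_split /=; apply: eq_bigr => x _.
  have -> : (2 - c) * v x + c * k x = f x - h x.
    rewrite /k /h /v.
    have -> : step N 1 (fun y => f y - g y) x = step N 1 f x - step N 1 g x.
      by rewrite /step; ring.
    have -> : step N c g x = (1 - c) * g x + c * step N 1 g x by rewrite /step; ring.
    have -> : g x = (1 - c) * f x + c * step N 1 f x by rewrite /g /step; ring.
    ring.
  ring.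
have -> : ip N (fun y => (2 - c) * v y + c * k y) (fun y => (2 - c) * v y + c * k y) =
   (2 - c) ^+ 2 * ip N v v + 2 * ((2 - c) * c) * ip N v k + c ^+ 2 * ip N k k.
  by rewrite /ip !mulr_sumr -!big_split /=; apply: eq_bigr => x _; ring.
have : 0 <= ip N v v + 2 * ip N v k + ip N k k.
  have := ip_ge0 N (fun y => v y + k y); congr (_ <= _).
  by rewrite /ip !mulr_sumr -!big_split /=; apply: eq_bigr => x _; ring.
have cc : 0 < (2 - c) * c by nra.
move=> /(mulr_ge0 (ltW cc)) H.
have d0 : 0 < 2 * c * (1 - c) by nra.
have : 0 <= 2 * c * (1 - c) * (ip N v v - ip N k k) by rewrite mulr_ge0 ?subr_ge0 //; exact: ltW.
nra.
Qed.

End SpectralGap.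

Section Maximal.
Context {R : rcfType}.
Implicit Types (N : network R) (f g : nat -> R) (a : nat -> R).

(** Two summations by parts leave only boundary terms; monotonicity and positivity of [a] give their
    signs. *)
Lemma sum_second_diff a M : (forall u, 0 <= a u) -> (forall u, a u.+1 <= a u) ->
  \sum_(0 <= u < M) u%:R * (a u - 2 * a u.+1 + a u.+2) <= a 0%N.
Proof.
move=> a0 aS; case: M => [|M]; first by rewrite big_geq.
have -> : \sum_(0 <= u < M.+1) u%:R * (a u - 2 * a u.+1 + a u.+2) =
          a 1%N - a M.+1 - M%:R * (a M.+1 - a M.+2).
  elim: M => [|M IH]; first by rewrite big_nat1; ring.
  by rewrite big_nat_recr //= IH -!natr1; ring.
have : 0 <= M%:R * (a M.+1 - a M.+2) by rewrite mulr_ge0 // subr_ge0.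
have := aS 0%N; have := a0 M.+1; lra.
Qed.

Lemma sum_geometric_tail a (y : R) s k : (forall u, 0 <= a u) ->
  (forall u, a u.+1 <= (1 - y) * a u) -> y * \sum_(s <= u < s + k) a u <= a s.
Proof.
move=> a0 aS; suff : y * \sum_(s <= u < s + k) a u <= a s - a (s + k)%N.
  by have := a0 (s + k)%N; lra.
elim: k => [|k IH]; first by rewrite addn0 big_geq // mulr0 subrr.
rewrite addnS big_nat_recr ?leq_addr //= mulrDr; have := aS (s + k)%N; lra.
Qed.

(* A Littlewood-Paley replacement for the maximal inequality: the increments
   along the orbit are controlled by [sum_second_diff], its tail by the gap. *)
Lemma maximal_ineq N c i t l f s k (th : R) :
  0 < c < 1 -> median_bounds N i t l -> 0 < l -> mean N f = 0 -> (0 < s)%N -> 0 < th ->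
  let y := (1 - c) * c / (2 * l) in
  exists G : nat -> R,
    (forall x u, (x <= nsz N)%N -> (s <= u <= s + k)%N -> iter u (step N c) f x ^+ 2 <= G x) /\
    mean N G <= ip N f f * ((s%:R * y)^-1 + th / (4 * (1 - c) ^+ 2) + (th * s%:R * y)^-1).
Proof.
move=> c01 mb l0 f0 s0 th0 y; have /andP[c0 c1] := c01.
pose g u := iter u (step N c) f; pose a u := ip N (g u) (g u).
have g0 u : mean N (g u) = 0 by elim: u => [|u IH] //=; rewrite mean_step.
have a_ge0 u : 0 <= a u by exact: ip_ge0.
have y0 : 0 < y by rewrite /y divr_gt0 ?mulr_gt0 //; lra.
have a_gap u : a u.+1 <= (1 - y) * a u by exact: (step_gap c01 mb l0 (g0 u)).
clearbody y.
have a_dec u : a u.+1 <= a u by have := a_gap u; have := a_ge0 u; nra.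
have a_le0 u : a u <= a 0%N by elim: u => // u; exact/le_trans.
have s0R : 0 < s%:R :> R by rewrite ltr0n.
(* A bound for the increment of [g u x ^+ 2]: a difference of squares is a difference times a sum,
   split by the arithmetic-geometric mean inequality with weight [th * u]. The factor [u] is the one
   that [sum_second_diff] can absorb. *)
pose inc u x := th * u%:R * (g u.+1 x - g u x) ^+ 2 +
                (g u x ^+ 2 + g u.+1 x ^+ 2) / (2 * (th * u%:R)).
exists (fun x => g s x ^+ 2 + \sum_(s <= u < s + k) inc u x); split.
  move=> x u xn /andP[su usk]; rewrite -/(g u).
  have inc_ge0 v : 0 <= inc v x.
    have tv : 0 <= th * v%:R by rewrite mulr_ge0 ?ler0n // ltW.
    apply: addr_ge0; first by rewrite mulr_ge0 ?sqr_ge0.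
    by rewrite divr_ge0 ?addr_ge0 ?sqr_ge0 // mulr_ge0.
  apply: le_trans (_ : g s x ^+ 2 + \sum_(s <= v < u) inc v x <= _); last first.
    by rewrite lerD2l; apply: ler_sum_nat_ge0.
  rewrite -(subnKC su); move: (u - s)%N => d.
  elim: d => [|d IH]; first by rewrite addn0 big_geq // addr0.
  rewrite addnS big_nat_recr ?leq_addr //= addrA.
  apply: le_trans (_ : g (s + d)%N x ^+ 2 + inc (s + d)%N x <= _); last by rewrite lerD2r.
  rewrite /inc -[step N c _ x]/(g (s + d).+1 x); move: (g (s + d)%N x) (g (s + d).+1 x) => p q.
  have al0 : 0 < th * (s + d)%:R by rewrite mulr_gt0 // ltr0n addn_gt0 s0.
  move: (th * _) al0 => al al0; set be := (2 * al)^-1.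
  have be0 : 0 < be by rewrite invr_gt0; lra.
  have ab : al * be = 1 / 2 by rewrite /be; field; rewrite lt0r_neq0.
  have : 0 <= al * (q - p - be * (p + q)) ^+ 2 by rewrite mulr_ge0 ?sqr_ge0 // ltW.
  have -> : al * (q - p - be * (p + q)) ^+ 2 = al * (q - p) ^+ 2
    - 2 * (al * be) * ((q - p) * (p + q)) + (al * be) * be * (p + q) ^+ 2 by ring.
  rewrite ab; have : 0 <= be * (p - q) ^+ 2 by rewrite mulr_ge0 ?sqr_ge0 // ltW.
  lra.
have mean_inc u : mean N (inc u) =
    th * u%:R * ip N (fun x => g u.+1 x - g u x) (fun x => g u.+1 x - g u x)
    + (a u + a u.+1) / (2 * (th * u%:R)).
  rewrite /mean /a /ip -big_split mulr_sumr mulr_suml -big_split /=.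
  by apply: eq_bigr => x _; rewrite /inc -[step N c (g u)]/(g u.+1); ring.
have -> : mean N (fun x => g s x ^+ 2 + \sum_(s <= u < s + k) inc u x) =
          a s + \sum_(s <= u < s + k) mean N (inc u).
  rewrite /a ip_meanE /mean exchange_big -big_split /=; apply: eq_bigr => x _.
  by rewrite mulrDr mulr_sumr.
have d2 : 0 < 4 * (1 - c) ^+ 2 by rewrite mulr_gt0 // exprn_gt0 //; lra.
pose b u := a u - 2 * a u.+1 + a u.+2.
have b_ge u : 4 * (1 - c) ^+ 2 * ip N (fun x => g u.+1 x - g u x) (fun x => g u.+1 x - g u x) <= b u.
  exact: step_diff_le.
have b_ge0 u : 0 <= b u.
  by apply: le_trans (b_ge u); rewrite mulr_ge0 ?ip_ge0 // ltW.
have S1 : a s <= a 0%N / (s%:R * y).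
  rewrite ler_pdivlMr ?mulr_gt0 //.
  have := @sum_geometric_tail a y 0 s a_ge0 a_gap; rewrite add0n.
  apply: le_trans; rewrite (_ : a s * (s%:R * y) = y * (s%:R * a s)); last by ring.
  rewrite ler_pM2l // mulr_natl -[X in a s *+ X]subn0 -sumr_const_nat.
  rewrite !big_nat; apply: ler_sum => u /andP[_ us].
  rewrite -(subnKC (ltnW us)); elim: (s - u)%N => [|d IH]; first by rewrite addn0.
  by rewrite addnS; exact: le_trans IH.
have S2 : \sum_(s <= u < s + k) mean N (inc u) <=
    th / (4 * (1 - c) ^+ 2) * \sum_(s <= u < s + k) u%:R * b u +
    (th * s%:R)^-1 * \sum_(s <= u < s + k) a u.
  rewrite !mulr_sumr -big_split /= !big_nat; apply: ler_sum => u /andP[su _].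
  have u0 : 0 < u%:R :> R by rewrite ltr0n (leq_trans s0).
  rewrite mean_inc; apply: lerD.
    rewrite mulrA [_ / _ * _]mulrAC -[leRHS]mulrA ler_pM2l ?mulr_gt0 //.
    by rewrite mulrC ler_pdivlMr // mulrC.
  apply: le_trans (_ : a u / (th * u%:R) <= _).
    have -> : a u / (th * u%:R) = (2 * a u) / (2 * (th * u%:R)).
      by field; rewrite ?lt0r_neq0.
    rewrite ler_pM2r; first by have := a_dec u; lra.
    by rewrite invr_gt0 !mulr_gt0.
  rewrite mulrC ler_wpM2r // lef_pV2 ?posrE ?mulr_gt0 //.
  by rewrite ler_pM2l // ler_nat.
have S3 : \sum_(s <= u < s + k) u%:R * b u <= a 0%N.
  apply: le_trans (sum_second_diff (s + k) a_ge0 a_dec).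
  rewrite [leRHS](big_cat_nat (leq0n s) (leq_addr k s)) /= lerDr.
  by apply: sumr_ge0 => u _; exact: (mulr_ge0 (ler0n _ u) (b_ge0 u)).
have S4 : \sum_(s <= u < s + k) a u <= a 0%N / y.
  rewrite ler_pdivlMr // mulrC; apply: le_trans (a_le0 s).
  exact: sum_geometric_tail.
apply: le_trans (lerD S1 S2) _; rewrite -/(a 0%N).
have T3 := ler_wpM2l (_ : 0 <= th / (4 * (1 - c) ^+ 2)) S3.
have T4 := ler_wpM2l (_ : 0 <= (th * s%:R)^-1) S4.
apply: le_trans (lerD (lexx _) (lerD (T3 _) (T4 _))) _.
- by rewrite divr_ge0 // ltW.
- by rewrite invr_ge0 mulr_ge0 ?ler0n // ltW.
- have -> : (th * s%:R)^-1 * (a 0%N / y) = a 0%N * (th * s%:R * y)^-1.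
    by rewrite mulrCA -invfM.
  by rewrite le_eqVlt; apply/orP; left; apply/eqP; rewrite -/(a 0%N); ring.
Qed.

End Maximal.

(** * Mixing bounds for a network *)

Section MixingBounds.
Context {R : realType}.
Implicit Types (N : network R) (f : nat -> R) (c t l : R).

Lemma norm_step_le N c f (a : R) g x : 0 <= c <= 1 -> (x <= nsz N)%N ->
  (forall y, (y <= nsz N)%N -> `|f y| <= a + g y) -> `|step N c f x| <= a + step N c g x.
Proof.
move=> c01 xn fg; have B y : (y <= nsz N)%N -> - (a + g y) <= f y <= a + g y.
  by move=> yn; rewrite -ler_norml fg.
have L y yn := proj1 (andP (B y yn)); have U y yn := proj2 (andP (B y yn)).
rewrite -step_addc ler_norml; apply/andP; split.
  have -> : - step N c (fun y => a + g y) x = step N c (fun y => - (a + g y)) x.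
    by rewrite /step; ring.
  by apply: le_step => // *; apply: L => //; lia.
by apply: le_step => // *; apply: U => //; lia.
Qed.

Lemma norm_iter_step_le1 N c f u x : 0 <= c <= 1 ->
  (forall y, (y <= nsz N)%N -> `|f y| <= 1) -> (x <= nsz N)%N -> `|iter u (step N c) f x| <= 1.
Proof.
move=> c01 f1; elim: u x => [|u IH] x xn; first exact: f1.
rewrite /= -[leRHS]addr0 -[X in _ <= _ + X](step_cst N c 0 x).
by apply: norm_step_le => // y yn; rewrite addr0 IH.
Qed.

(* Strong Markov property at the first visit to [z]: only the values at [z] of
   the orbit of [f] matter afterwards. *)
Lemma iter_step_hitting N c f s k z (ka : R) x : 0 < c < 1 -> (z <= nsz N)%N ->
  (forall y, (y <= nsz N)%N -> `|f y| <= 1) ->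
  0 <= ka -> (forall u, (s <= u <= s + k)%N -> `|iter u (step N c) f z| <= ka) ->
  (x <= nsz N)%N -> `|iter (s + k) (step N c) f x| <= ka + surv N c z k x.
Proof.
move=> /andP[c0 c1] zn f1 ka0 Hz; have c01 : 0 <= c <= 1 by rewrite !ltW.
suff H j y : (j <= k)%N -> (y <= nsz N)%N ->
    `|iter (s + j) (step N c) f y| <= ka + surv N c z j y by apply: H.
elim: j y => [|j IH] y jk yn /=.
  case: eqVneq => [->|_]; first by rewrite addr0 addn0 Hz ?leqnn ?leq_addr.
  by apply: le_trans (norm_iter_step_le1 _ c01 f1 yn) _; rewrite /= lerDr.
case: eqVneq => [->|_]; first by rewrite addr0 Hz // leq_addr leq_add2l.
rewrite addnS /=; apply: norm_step_le => // y' y'n; apply: IH => //; exact: ltnW.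
Qed.

(** The time is cut as [m = s + k]: a stretch [s] of order [l], after which the orbit is small at
    most states, and a stretch [k] long enough to reach any bulk state. *)
Lemma mixing_upper c (eta : R) : 0 < c < 1 -> 0 < eta -> exists2 A : R, 0 < A &
  forall N i t l f m x, median_bounds N i t l -> 1 <= l -> l <= t ->
    (forall y, (y <= nsz N)%N -> `|f y| <= 1) -> mean N f = 0 -> (x <= nsz N)%N ->
    t / c + A * Num.sqrt (l * t) <= m%:R -> `|iter m (step N c) f x| <= eta.
Proof.
move=> c01 eta0; have /andP[c0 c1] := c01.
(* Half of [eta] is for the value at [z], half for the survival probability. With these [th] and
   [B], the three terms of [maximal_ineq] add up to at most [3 / 16 * ka ^+ 2], below the
   [ka ^+ 2 / 2] that a failure at every bulk state would force. *)
pose ka := eta / 2; pose th := ka ^+ 2 * (1 - c) ^+ 2 / 2.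
have ka0 : 0 < ka by rewrite divr_gt0.
have ka2 : 0 < ka ^+ 2 by rewrite exprn_gt0.
have d0 : 0 < 1 - c by lra.
have th0 : 0 < th by rewrite !mulr_gt0 ?exprn_gt0 ?invr_gt0.
pose B := 16 / ka ^+ 2 * (1 + th^-1).
have thV : 0 < th^-1 by rewrite invr_gt0.
have B0 : 0 < B by rewrite mulr_gt0 ?addr_gt0 // divr_gt0.
pose B' := B * 2 / ((1 - c) * c).
have B'0 : 0 < B' by rewrite divr_gt0 // mulr_gt0.
pose E := (1 + 100 / eta) / c.
have E0 : 0 < E by rewrite divr_gt0 // addr_gt0 // divr_gt0.
(* In units of the width: [E] serves Chebyshev's inequality, [B' + 1] the stretch [s] rounded up,
   and [4 / c] the excess [4 * l] of the mean hitting time; the width is at least [l]. *)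
exists (E + B' + 1 + 4 / c); first by rewrite !addr_gt0 // divr_gt0.
move=> N i t l f m x mb l1 lt f1 f0 xn Hm.
have l0 : 0 < l by lra.
set si := Num.sqrt (l * t) in Hm.
have si2 : si ^+ 2 = l * t by rewrite sqr_sqrtr // mulr_ge0 //; lra.
have lsi : l <= si.
  by rewrite -ler_sqr ?nnegrE ?sqrtr_ge0 // ?si2 ?expr2 ?ler_pM2l //; lra.
pose s := (Num.truncn (B' * l)).+1.
have /andP[sl su] : B' * l < s%:R <= B' * l + 1.
  have B'l : 0 <= B' * l by rewrite mulr_ge0 // ltW.
  have /andP[h1 h2] := truncn_itv B'l; rewrite h2 /= /s -natr1 lerD2r //.
have sm : (s <= m)%N.
  rewrite -(ler_nat R); apply: le_trans Hm; apply: (le_trans su).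
  have : 0 <= t / c by rewrite divr_ge0 //; lra.
  have : 0 <= (E + 4 / c) * si by rewrite mulr_ge0 ?sqrtr_ge0 // addr_ge0 ?ltW // divr_gt0.
  by nra.
pose k := (m - s)%N; have mE : m = (s + k)%N by rewrite subnKC.
have kE : k%:R = m%:R - s%:R :> R by rewrite natrB.
have D0 : 0 < E * si by rewrite mulr_gt0 //; lra.
have Hk : (t + 4 * l) / c + E * si <= k%:R.
  have -> : (t + 4 * l) / c = t / c + 4 / c * l by field; rewrite lt0r_neq0.
  have : 0 <= 4 / c * (si - l) by rewrite mulr_ge0 ?subr_ge0 // ltW // divr_gt0.
  rewrite kE; nra.
rewrite leNgt; apply/negP => Hx.
have [G [G1 G2]] := @maximal_ineq _ N c i t l f s k th c01 mb l0 f0 isT th0.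
have Gbulk z : (z <= nsz N)%N -> 1 / 4 <= lmass N z -> 1 / 4 <= rmass N z -> ka ^+ 2 < G z.
  move=> zn lz rz; rewrite ltNge; apply/negP => Gz; move: Hx; apply/negP; rewrite -leNgt.
  rewrite mE; apply: le_trans (_ : ka + surv N c z k x <= _).
    apply: iter_step_hitting => //; first exact: ltW.
    move=> u us; rewrite -ler_sqr ?nnegrE ?(ltW ka0) // real_normK ?num_real //.
    by apply: le_trans Gz; exact: G1.
  have c01' : 0 < c <= 1 by rewrite c0 ltW.
  have := surv_bulk c01' mb lt zn lz rz xn D0 Hk.
  have cE : (c * (E * si)) ^+ 2 = (1 + 100 / eta) ^+ 2 * (l * t).
    by rewrite -si2 /E; field; rewrite !lt0r_neq0.
  have lt0 : 0 < l * t by rewrite mulr_gt0 //; lra.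
  rewrite cE mulrA -[50 * l * t]mulrA ler_pM2r // => Hs.
  have : 0 <= surv N c z k x by apply: surv_ge0.
  have e0 : 0 < 100 / eta by rewrite divr_gt0.
  move: (surv _ _ _ _ _) Hs => S Hs S0.
  have : S * (100 / eta) <= 50 by nra.
  by rewrite mulrA ler_pdivrMr // /ka; lra.
have G_ge0 z : (z <= nsz N)%N -> 0 <= G z.
  by move=> zn; apply: le_trans (G1 z s zn _); rewrite ?sqr_ge0 // leqnn leq_addr.
have M1 : ka ^+ 2 * (1 / 2) <= mean N G.
  apply: le_trans (_ : ka ^+ 2 * \sum_(0 <= x < (nsz N).+1 | (1 / 4 <= lmass N x) && (1 / 4 <= rmass N x)) nw N x <= _).
    by rewrite ler_pM2l // mass_bulk.
  rewrite mulr_sumr big_mkcond /mean !big_nat; apply: ler_sum => z /andP[_ zn].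
  have w0 := ltW (@nw_gt0 _ N z zn).
  case: ifP => [/andP[lz rz]|_]; last by rewrite mulr_ge0 ?G_ge0.
  by rewrite mulrC ler_wpM2l // ltW // Gbulk.
have I1 : ip N f f <= 1.
  rewrite /ip -(nw_sum N) !big_nat; apply: ler_sum => z /andP[_ zn].
  rewrite -[leRHS]mulr1; apply: ler_wpM2l; first by rewrite ltW // nw_gt0.
  by rewrite -expr2 -real_normK ?num_real // expr_le1 // f1.
set y := (1 - c) * c / (2 * l) in G2.
have y0 : 0 < y by rewrite divr_gt0 ?mulr_gt0.
have sy : B <= s%:R * y.
  apply: le_trans (_ : B' * l * y <= _); last by rewrite ler_pM2r // ltW.
  by rewrite le_eqVlt; apply/orP; left; apply/eqP; rewrite /B' /y; field; rewrite !lt0r_neq0.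
have Q1 : (s%:R * y)^-1 <= B^-1 by rewrite lef_pV2 // posrE mulr_gt0 // ltr0n.
have Q2 : (th * s%:R * y)^-1 <= th^-1 * B^-1.
  by rewrite -mulrA invfM ler_pM2l.
have Q3 : (1 + th^-1) * B^-1 = ka ^+ 2 / 16.
  by rewrite /B; field; rewrite ?lt0r_neq0 //; lra.
have Q4 : th / (4 * (1 - c) ^+ 2) = ka ^+ 2 / 8.
  by rewrite /th; field; rewrite lt0r_neq0.
have Q0 : 0 <= (s%:R * y)^-1 + th / (4 * (1 - c) ^+ 2) + (th * s%:R * y)^-1.
  by rewrite !addr_ge0 ?invr_ge0 ?mulr_ge0 ?invr_ge0 ?mulr_ge0 ?ler0n ?sqr_ge0 ?ltW //.
have := ler_wpM2r Q0 I1; rewrite mul1r; nra.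
Qed.

End MixingBounds.

(** * Distinguishing sets and test functions for the lower bounds *)

Section MixingLower.
Context {R : realType}.
Implicit Types (N : network R) (f : nat -> R) (c t l : R).

(** A nearest-neighbour chain started at or below [q] cannot pass [q] without visiting it. *)
Lemma surv_le_iter N c q m x : 0 < c <= 1 -> (q <= nsz N)%N -> (x <= q)%N ->
  surv N c q m x <= iter m (step N c) (fun y => (y < q)%N%:R) x.
Proof.
move=> /andP[c0 c1] qn; have c01 : 0 <= c <= 1 by rewrite ltW.
have pos k y : (y <= nsz N)%N -> 0 <= iter k (step N c) (fun y => (y < q)%N%:R : R) y.
  elim: k y => [|k IH] y yn; first exact: ler0n.
  by rewrite -(step_cst N c 0 y); apply: le_step => // *; apply: IH; lia.
elim: m x => [|m IH] x xq /=; first by rewrite ltn_neqAle xq andbT.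
case: eqVneq => [->|xNq]; first exact: (pos m.+1).
have xq' : (x < q)%N by rewrite ltn_neqAle xNq.
by apply: le_step => // *; try apply: IH; lia.
Qed.

Lemma mean_prefix N q : (q <= (nsz N).+1)%N ->
  mean N (fun y => (y < q)%N%:R) = \sum_(0 <= x < q) nw N x.
Proof.
move=> qn; rewrite /mean (big_cat_nat (leq0n q) qn) /= [X in _ + X]big1_seq ?addr0.
  by apply: eq_big_nat => x /andP[_ ->]; rewrite mulr1.
by move=> x /andP[_]; rewrite mem_index_iota => /andP[qx _]; rewrite ltnNge qx mulr0.
Qed.

(** Only the mean of the hitting time enters, so the bound remains useful when [t] and [l] are
    comparable and the window exceeds [t]. The price is the set [[0, i)], whose mass may be as large
    as 1/2; hence the range [eps < 1 / 2] of the order estimates. *)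
Lemma hit_lower_left N c i t l : 0 < c < 1 -> median_bounds N i t l -> 0 < t -> hit N i 0 = t ->
  exists (p : nat -> bool) (x : nat), [/\ (x <= nsz N)%N, mean N (fun y => (p y)%:R) <= 1 / 2 &
   forall m, 1 - m%:R * c / t <= iter m (step N c) (fun y => (p y)%:R) x].
Proof.
move=> /andP[c0 c1] mb t0 ht; have ni := mb_le mb.
have c01 : 0 < c <= 1 by rewrite c0 ltW.
exists (fun y => (y < i)%N), 0%N; split => //.
  rewrite mean_prefix; last exact: ltnW.
  have := nw_sum N; rewrite (big_cat_nat (leq0n i) (ltnW (ni : i < (nsz N).+1)%N)) /=.
  have := mb_rmass mb; rewrite /rmass; lra.
move=> m; apply: le_trans (surv_le_iter m c01 ni (leq0n i)).
have := surv_mean c01 m ni; rewrite ht => H.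
have : (1 - surv N c i m 0) <= m%:R / (t / c) by rewrite ler_pdivlMr ?divr_gt0 // mulrC.
by rewrite invf_div mulrA; lra.
Qed.

(** The target is the first state [q] with [eta <= lmass N q], so that [[0, q)] has small mass.
    Since [eta * res N q i <= l], the mean time from [q] to [i] is at most [l / eta], and the mean
    time from 0 to [q] is still [t - O(l)]. *)
Lemma cutoff_lower_left c (eta : R) : 0 < c < 1 -> 0 < eta -> eta <= 1 / 2 ->
  exists2 A : R, 0 < A & forall N i t l, median_bounds N i t l -> 1 <= l -> l <= t -> hit N i 0 = t ->
  exists (p : nat -> bool) (x : nat), [/\ (x <= nsz N)%N, mean N (fun y => (p y)%:R) <= eta &
   forall m, m%:R <= t / c - A * Num.sqrt (l * t) ->
     1 - eta <= iter m (step N c) (fun y => (p y)%:R) x].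
Proof.
move=> /andP[c0 c1] eta0 eta2; have c01 : 0 < c <= 1 by rewrite c0 ltW.
pose D := (1 + 2 / eta) / c.
have e0 : 0 < 2 / eta by rewrite divr_gt0.
have D0 : 0 < D by rewrite divr_gt0 // addr_gt0.
have ec0 : 0 < (eta * c)^-1 by rewrite invr_gt0 mulr_gt0.
(* [D] makes the Chebyshev bound for [q] smaller than [eta]; the other term pays for the stretch
   from [q] to [i]. *)
exists (D + (eta * c)^-1); first by rewrite addr_gt0.
move=> N i t l mb l1 lt ht; have ni := mb_le mb.
have l0 : 0 < l by lra.
have lt0 : 0 < l * t by rewrite mulr_gt0 //; lra.
set si := Num.sqrt (l * t).
have si2 : si ^+ 2 = l * t by rewrite sqr_sqrtr // ltW.
have lsi : l <= si.
  by rewrite -ler_sqr ?nnegrE ?sqrtr_ge0 // ?si2 ?expr2 ?ler_pM2l // ltW.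
have exq : exists q, eta <= lmass N q by exists i; exact: le_trans (mb_lmass mb).
pose q := ex_minn exq.
have [Wq minq] : eta <= lmass N q /\ forall j, eta <= lmass N j -> (q <= j)%N.
  by rewrite /q; case: ex_minnP.
clearbody q.
have qi : (q <= i)%N by apply: minq; exact: le_trans (mb_lmass mb).
have qn : (q <= nsz N)%N := leq_trans qi ni.
exists (fun y => (y < q)%N), 0%N; split => //.
  rewrite mean_prefix; last exact: ltnW.
  case: (q) minq => [|q'] minq; first by rewrite big_geq // ltW.
  by rewrite leNgt; apply/negP => /ltW/minq; rewrite ltnn.
move=> m Hm; apply: le_trans (surv_le_iter m c01 qn (leq0n q)).
have Hl j : (j < q)%N -> lmass N j * res N j q <= l.
  move=> jq; apply: le_trans (mb_left mb (leq_trans jq qi)).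
  apply: ler_wpM2l; first by rewrite ltW // lmass_gt0 // (leq_trans (ltnW jq)).
  by rewrite (res_cat N (ltnW jq) qi) lerDl res_ge0.
have resq : eta * res N q i <= l.
  move: qi; rewrite leq_eqVlt => /predU1P[->|qi].
    by rewrite /res big_geq // mulr0 ltW.
  by apply: le_trans (mb_left mb qi); rewrite ler_wpM2r // res_ge0.
have hq := hit_cat N (leq0n q) qi; rewrite ht in hq.
have hqi := @hit_le_res _ N q i ni.
have hq0 := @hit_ge0 _ N i q ni.
have res_le : res N q i <= l / eta by rewrite ler_pdivlMr // mulrC.
have hqt : t / c - (eta * c)^-1 * si <= hit N q 0 / c.
  have -> : hit N q 0 = t - hit N i q by lra.
  have : hit N i q / c <= (eta * c)^-1 * si.
    rewrite ler_pdivrMr // (_ : (eta * c)^-1 * si * c = si / eta); last by field; rewrite !lt0r_neq0.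
    apply: (le_trans hqi); apply: (le_trans res_le).
    by rewrite ler_pM2r ?invr_gt0.
  by rewrite mulrBl; lra.
have gap : D * si <= hit N q 0 / c - m%:R by move: Hm hqt; lra.
have si0 : 0 <= si by rewrite sqrtr_ge0.
have Dsi : 0 <= D * si by rewrite mulr_ge0 // ltW.
have hm : m%:R <= hit N q 0 / c by lra.
have := surv_lower c01 qn Hl hm.
have sv1 : 0 <= 1 - surv N c q m 0 by rewrite subr_ge0 surv_le1.
have S1 : (1 - surv N c q m 0) * (D * si) ^+ 2 <=
          (1 - surv N c q m 0) * (hit N q 0 / c - m%:R) ^+ 2.
  by rewrite ler_wpM2l // ler_sqr ?nnegrE //; lra.
have S2 : 2 * l * hit N q 0 / c ^+ 2 <= 2 * l * t / c ^+ 2.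
  rewrite ler_pM2r ?invr_gt0 ?exprn_gt0 // ler_pM2l ?mulr_gt0 //; lra.
move=> S3; move: (le_trans S1 (le_trans S3 S2)).
have -> : 2 * l * t / c ^+ 2 = 2 / c ^+ 2 * (l * t) by ring.
have -> : (1 - surv N c q m 0) * (D * si) ^+ 2 =
   (1 - surv N c q m 0) * (1 + 2 / eta) ^+ 2 / c ^+ 2 * (l * t).
  by rewrite -si2 /D; field; rewrite !lt0r_neq0.
rewrite ler_pM2r // ler_pM2r ?invr_gt0 ?exprn_gt0 //.
move: (surv _ _ _ _ _) sv1 => S S0' S4.
suff : 1 - S <= eta by lra.
have : (1 - S) * (2 / eta) <= 2 by nra.
by rewrite mulrA ler_pdivrMr //; lra.
Qed.

(** The time-dependent conclusion [P] is a parameter so that both kinds of lower bound are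
    transported by the same reflection. *)
Lemma refl_indicator N c (P : nat -> R -> Prop) (b : R) :
  (exists (p : nat -> bool) (x : nat), [/\ (x <= nsz N)%N, mean (refl N) (fun y => (p y)%:R) <= b &
   forall m, P m (iter m (step (refl N) c) (fun y => (p y)%:R) x)]) ->
  exists (p : nat -> bool) (x : nat), [/\ (x <= nsz N)%N, mean N (fun y => (p y)%:R) <= b &
   forall m, P m (iter m (step N c) (fun y => (p y)%:R) x)].
Proof.
move=> [p [x [xn pb Pm]]]; exists (fun y => p (nsz N - y)%N), (nsz N - x)%N.
have E f g y k : (y <= nsz N)%N -> (forall z, (z <= nsz N)%N -> f z = g z) ->
    iter k (step (refl N) c) f y = iter k (step (refl N) c) g y :> R.
  move=> yn fg; elim: k y yn => [|k IH] y yn /=; first exact: fg.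
  exact: eq_step_le.
split; first exact: leq_subr.
  apply: le_trans pb; rewrite -(mean_refl N) /mean !big_nat le_eqVlt; apply/orP; left.
  by apply/eqP; apply: eq_bigr => z /andP[_ zn]; rewrite subKn.
move=> m; have := Pm m; rewrite -(iter_step_refl (N:=N)) ?leq_subr // subKn //.
rewrite (E _ (fun y => (p (nsz N - (nsz N - y))%N)%:R)) // => z zn.
by rewrite subKn.
Qed.

Lemma hit_lower N c i t l : 0 < c < 1 -> median_bounds N i t l -> 0 < t ->
  hit N i 0 = t \/ rhit N i (nsz N) = t ->
  exists (p : nat -> bool) (x : nat), [/\ (x <= nsz N)%N, mean N (fun y => (p y)%:R) <= 1 / 2 &
   forall m, 1 - m%:R * c / t <= iter m (step N c) (fun y => (p y)%:R) x].
Proof.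
move=> c01 mb t0 [ht|ht]; first exact: (hit_lower_left c01 mb).
apply: (@refl_indicator N c (fun m a => 1 - m%:R * c / t <= a)).
apply: (hit_lower_left c01 (median_bounds_refl mb)) => //.
by rewrite -(subnn (nsz N)) hit_refl.
Qed.

Lemma cutoff_lower c (eta : R) : 0 < c < 1 -> 0 < eta -> eta <= 1 / 2 ->
  exists2 A : R, 0 < A & forall N i t l, median_bounds N i t l -> 1 <= l -> l <= t ->
  hit N i 0 = t \/ rhit N i (nsz N) = t ->
  exists (p : nat -> bool) (x : nat), [/\ (x <= nsz N)%N, mean N (fun y => (p y)%:R) <= eta &
   forall m, m%:R <= t / c - A * Num.sqrt (l * t) ->
     1 - eta <= iter m (step N c) (fun y => (p y)%:R) x].
Proof.
move=> c01 eta0 eta2; have [A A0 HA] := cutoff_lower_left c01 eta0 eta2.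
exists A => // N i t l mb l1 lt [ht|ht]; first exact: (HA _ _ _ _ mb).
apply: (@refl_indicator N c (fun m a => m%:R <= t / c - A * Num.sqrt (l * t) -> 1 - eta <= a)).
apply: (HA _ _ _ _ (median_bounds_refl mb)) => //.
by rewrite -(subnn (nsz N)) hit_refl.
Qed.

(* The test function is the potential equal to [res j i] up to [j], to 0 from
   [i] on, and harmonic in between. *)
Lemma test_function_left N i j t l : median_bounds N i t l -> (j < i)%N ->
  exists F, [/\ mean N F = 0, 0 < ip N F F &
    energy N F F * (lmass N j * res N j i) <= 2 * ip N F F].
Proof.
move=> mb ji; have ni := mb_le mb.
pose F0 x := res N (maxn x j) i.
have F0i x : (i <= x)%N -> F0 x = 0 by move=> ix; rewrite /F0 /res big_geq // leq_max ix.
pose r := res N j i.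
have r0 : 0 < r.
  rewrite /r /res big_ltn // ltr_wpDr ?invr_gt0 ?ne_gt0 //; last by lia.
  exact: (@res_ge0 _ N j.+1 i).
have En : energy N F0 F0 = r.
  rewrite /energy (big_cat_nat (leq0n j) (leq_trans (ltnW ji) ni)) /=.
  rewrite big1_seq ?add0r; last first.
    move=> x /andP[_]; rewrite mem_index_iota => /andP[_ xj]; rewrite /F0.
    by rewrite (maxn_idPr (xj : (x.+1 <= j)%N)) (maxn_idPr (ltnW xj)) subrr !mulr0.
  rewrite (big_cat_nat (ltnW ji) ni) /= [X in _ + X]big1_seq ?addr0; last first.
    move=> x /andP[_]; rewrite mem_index_iota => /andP[ix _].
    by rewrite !F0i ?subrr ?mulr0 // ltnW.
  rewrite /r /res; apply: eq_big_nat => x /andP[jx xi].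
  rewrite /F0 (maxn_idPl jx) (maxn_idPl (leqW jx)) /res (big_ltn xi).
  by field; rewrite gt_eqF // ne_gt0 //; lia.
have [m mE] : exists m, mean N F0 = m by exists (mean N F0).
have I0 : lmass N j * r ^+ 2 <= ip N F0 F0.
  rewrite /ip (big_cat_nat (leq0n j.+1)) /=; last by lia.
  rewrite /lmass mulr_suml -[leLHS]addr0; apply: lerD.
    rewrite !big_nat le_eqVlt; apply/orP; left; apply/eqP; apply: eq_bigr => x /andP[_ xj].
    by rewrite /F0 (maxn_idPr (xj : (x <= j)%N)) expr2.
  rewrite big_nat; apply: sumr_ge0 => x /andP[_ xn]; apply: mulr_ge0; first by rewrite ltW // nw_gt0.
  by rewrite -expr2 sqr_ge0.
have pos : 0 < lmass N j * r ^+ 2.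
  by rewrite mulr_gt0 ?exprn_gt0 // lmass_gt0 //; lia.
clearbody F0.
have half : \sum_(0 <= x < i) nw N x <= 1 / 2.
  have := nw_sum N; rewrite (big_cat_nat (leq0n i) (ltnW (ni : i < (nsz N).+1)%N)) /=.
  have := mb_rmass mb; rewrite /rmass; lra.
have restr G : (forall x, (i <= x)%N -> G x = 0) ->
    \sum_(0 <= x < (nsz N).+1) nw N x * G x = \sum_(0 <= x < i) nw N x * G x :> R.
  move=> Gi; rewrite (big_cat_nat (leq0n i) (ltnW (ni : i < (nsz N).+1)%N)) /=.
  rewrite [X in _ + X]big1_seq ?addr0 // => x /andP[_]; rewrite mem_index_iota => /andP[ix _].
  by rewrite Gi // mulr0.
(* [F0] is supported in [[0, i)], of mass at most 1/2, so by Cauchy-Schwarz centring loses at most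
   half of the second moment. This is the factor 2 in the conclusion. *)
have m2 : 2 * m ^+ 2 <= ip N F0 F0.
  have : 0 <= \sum_(0 <= x < i) nw N x * (F0 x - 2 * m) ^+ 2.
    rewrite big_nat; apply: sumr_ge0 => x /andP[_ xi].
    by rewrite mulr_ge0 ?sqr_ge0 // ltW // nw_gt0 //; lia.
  have -> : \sum_(0 <= x < i) nw N x * (F0 x - 2 * m) ^+ 2 =
     ip N F0 F0 - 4 * m * mean N F0 + 4 * m ^+ 2 * \sum_(0 <= x < i) nw N x.
    have -> : ip N F0 F0 = \sum_(0 <= x < i) nw N x * (F0 x * F0 x).
      by rewrite /ip (restr (fun x => F0 x * F0 x)) // => x ix; rewrite F0i // mulr0.
    rewrite /mean (restr F0) // !mulr_sumr -sumrN -!big_split /=.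
    by apply: eq_bigr => x _; ring.
  rewrite mE; have := sqr_ge0 m; nra.
exists (fun x => F0 x - m).
have ipE : ip N (fun x => F0 x - m) (fun x => F0 x - m) = ip N F0 F0 - m ^+ 2.
  have -> : ip N (fun x => F0 x - m) (fun x => F0 x - m) =
     ip N F0 F0 - 2 * m * mean N F0 + m ^+ 2 * \sum_(0 <= x < (nsz N).+1) nw N x.
    rewrite /ip /mean !mulr_sumr -sumrN -!big_split /=.
    by apply: eq_bigr => x _; ring.
  by rewrite nw_sum mE; ring.
split.
- have -> : mean N (fun x => F0 x - m) = mean N F0 - m * \sum_(0 <= x < (nsz N).+1) nw N x.
    by rewrite /mean mulr_sumr -sumrN -big_split; apply: eq_bigr => x _ /=; ring.
  by rewrite nw_sum mulr1 mE subrr.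
- rewrite ipE; lra.
- rewrite ipE.
  have -> : energy N (fun x => F0 x - m) (fun x => F0 x - m) = r.
    by rewrite -En; apply: eq_bigr => x _; ring.
  rewrite -/r; move: I0; rewrite expr2; lra.
Qed.

Lemma test_function_right N i j t l : median_bounds N i t l -> (i < j <= nsz N)%N ->
  exists F, [/\ mean N F = 0, 0 < ip N F F &
    energy N F F * (rmass N j * res N i j) <= 2 * ip N F F].
Proof.
move=> mb /andP[ij jn].
have [|F [F0 F1 F2]] := @test_function_left _ _ (nsz N - j) _ _ (median_bounds_refl mb).
  by lia.
exists (fun x => F (nsz N - x)%N).
have K x : (x <= nsz N)%N -> F (nsz N - (nsz N - x))%N = F x by move=> xn; rewrite subKn.
have M : mean N (fun x => F (nsz N - x)%N) = mean (refl N) F.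
  by rewrite -mean_refl /mean !big_nat; apply: eq_bigr => x /andP[_ xn]; rewrite K.
have I : ip N (fun x => F (nsz N - x)%N) (fun x => F (nsz N - x)%N) = ip (refl N) F F.
  by rewrite -ip_refl /ip !big_nat; apply: eq_bigr => x /andP[_ xn]; rewrite K.
have E : energy N (fun x => F (nsz N - x)%N) (fun x => F (nsz N - x)%N) = energy (refl N) F F.
  by rewrite -energy_refl /energy !big_nat; apply: eq_bigr => x /andP[_ xn]; rewrite !K // ltnW.
by rewrite M I E -res_refl // -lmass_refl //; split.
Qed.

End MixingLower.

(** * Matrix exponential and Poisson weights *)

Section CauchyProduct.
Context {R : realType}.
Implicit Types (u v : nat -> R).

Let tri u v M := \sum_(0 <= k < M) \sum_(0 <= i < k.+1) u (k - i)%N * v i.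

Let triE u v M : tri u v M = \sum_(0 <= i < M) \sum_(0 <= a < M - i) u a * v i.
Proof.
rewrite /tri -(sum_triangle (fun i k => u (k - i)%N * v i)).
apply: eq_big_nat => i /andP[_ iM]; rewrite -{1}[i]add0n big_addn.
by apply: eq_bigr => a _; rewrite addnK.
Qed.

Let tri_diff u v M : series u M * series v M - tri u v M =
  \sum_(0 <= i < M) \sum_(M - i <= a < M) u a * v i.
Proof.
rewrite triE /series /= mulr_sumr -sumrB; apply: eq_big_nat => i /andP[_ iM].
rewrite mulr_suml (big_cat_nat (leq0n (M - i)) (leq_subr i M)) /=.
by rewrite addrAC subrr add0r.
Qed.

Lemma exp_coeffD (x y : R) k :
  \sum_(0 <= i < k.+1) exp_coeff x (k - i)%N * exp_coeff y i = exp_coeff (x + y) k.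
Proof.
rewrite big_mkord /exp_coeff /= exprDn mulr_suml; apply: eq_bigr => i _.
have ik : (i <= k)%N by rewrite -ltnS.
rewrite -(bin_fact ik) !natrM -mulr_natr.
have f0 j : j`!%:R != 0 :> R by rewrite pnatr_eq0 -lt0n fact_gt0.
have b0 : 'C(k, i)%:R != 0 :> R by rewrite pnatr_eq0 -lt0n bin_gt0.
by field; rewrite !f0 b0.
Qed.

(** The product of the partial sums differs from the partial sum of the Cauchy product by terms
    dominated by those of the same difference for [exp_coeff r], and there the difference tends to 0
    by [expRD]. *)
Lemma cvg_tri u v (r a b : R) : 0 <= r ->
  (forall k, `|u k| <= exp_coeff r k) -> (forall k, `|v k| <= exp_coeff r k) ->
  series u @ \oo --> a -> series v @ \oo --> b -> tri u v @ \oo --> a * b.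
Proof.
move=> r0 ur vr ua vb.
have expcv (x : R) : series (exp_coeff x) @ \oo --> expR x.
  exact: (is_cvg_series_exp_coeff x).
have dom0 : (fun M => series (exp_coeff r) M * series (exp_coeff r) M - tri (exp_coeff r) (exp_coeff r) M) @ \oo --> 0.
  have -> : 0 = expR r * expR r - expR (r + r) :> R by rewrite expRD subrr.
  apply: cvgB; first by apply: cvgM; exact: expcv.
  rewrite (_ : tri _ _ = series (exp_coeff (r + r))); first exact: expcv.
  by apply/funext => M; rewrite /tri /series /=; apply: eq_bigr => k _; rewrite exp_coeffD.
have d0 : (fun M => series u M * series v M - tri u v M) @ \oo --> 0.
  apply: norm_cvg0; apply: (@squeeze_cvgr _ _ _ _ (fun=> 0) _ _ _ 0 (cvg_cst _) dom0).
  near=> M; rewrite normr_ge0 /= !tri_diff.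
  apply: le_trans (ler_norm_sum _ _ _) _; apply: ler_sum => i _.
  apply: le_trans (ler_norm_sum _ _ _) _; apply: ler_sum => j _.
  by rewrite normrM ler_pM.
have -> : tri u v = (fun M => series u M * series v M - (series u M * series v M - tri u v M)).
  by apply/funext => M; rewrite opprB addrC subrK.
by rewrite -[a * b]subr0; apply: cvgB => //; exact: cvgM.
Unshelve. all: by end_near.
Qed.

End CauchyProduct.

Section Poisson.
Context {R : realType} {n : nat}.
Implicit Types (P : 'M[R]_n.+1) (s : R).

Definition poisson s m : R := expR (- s) * exp_coeff s m.

Lemma cvg_mx (M : nat -> 'M[R]_n.+1) (L : 'M[R]_n.+1) :
  (forall x y, (fun k => M k x y) @ \oo --> L x y) -> M @ \oo --> L.
Proof.
move=> ML; apply/cvgrPdist_lt => eps eps0.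
have H : \forall k \near \oo, forall ij : 'I_n.+1 * 'I_n.+1, `|L ij.1 ij.2 - M k ij.1 ij.2| < eps.
  by apply: filter_forall => -[i j] /=; move/cvgrPdist_lt: (ML i j); apply.
near=> k.
have Hk : forall ij : 'I_n.+1 * 'I_n.+1, `|L ij.1 ij.2 - M k ij.1 ij.2| < eps.
  by near: k; exact: H.
rewrite [ltLHS]/Num.Def.normr /= mx_normrE; apply/bigmax_ltP; split => // ij _.
by rewrite !mxE.
Unshelve. all: by end_near.
Qed.

(** [P] commutes with the identity, so the binomial formula turns each entry of the exponential
    series into a Cauchy product of the series of [s *: P] and of [- s]. *)
Lemma expmx_poisson P s : 0 <= s -> (forall k x y, `|(P ^+ k) x y| <= 1) ->
  forall x y, series (fun m => poisson s m * (P ^+ m) x y) @ \oo --> expmx (s *: (P - 1)) x y.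
Proof.
move=> s0 P1.
pose u x y k := exp_coeff s k * (P ^+ k) x y.
have fV k : (k`!%:R : R)^-1 = k`!%:R^-1 by [].
have u_le x y k : `|u x y k| <= exp_coeff s k.
  rewrite normrM ger0_norm ?exp_coeff_ge0 //.
  by rewrite -[leRHS]mulr1 ler_wpM2l ?exp_coeff_ge0.
have v_le k : `|exp_coeff (- s) k| <= exp_coeff s k.
  by rewrite /exp_coeff /= normrM normrX normrN normfV !ger0_norm.
have cvu x y : cvgn (series (u x y)).
  apply: normed_cvg; apply: (series_le_cvg _ _ (u_le x y)) => [k|k|].
  - exact: normr_ge0.
  - exact: exp_coeff_ge0.
  - exact: is_cvg_series_exp_coeff.
have cvv : series (exp_coeff (- s)) @ \oo --> expR (- s).
  exact: (is_cvg_series_exp_coeff (- s)).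
pose L : 'M[R]_n.+1 := \matrix_(x, y) (limn (series (u x y)) * expR (- s)).
have SE M x y : series (fun k => (k`!%:R)^-1 *: (s *: (P - 1)) ^+ k) M x y =
    \sum_(0 <= k < M) \sum_(0 <= i < k.+1) u x y (k - i)%N * exp_coeff (- s) i.
  rewrite /series /= summxE; apply: eq_bigr => k _.
  have -> : s *: (P - 1) = s *: P + (- s) *: 1 by rewrite scalerBr scaleNr.
  rewrite exprDn_comm; last first.
    rewrite /GRing.comm -!scalerAr -!scalerAl mulr1 mul1r !scalerA.
    by congr (_ *: _); exact: mulrC.
  rewrite mxE summxE mulr_sumr big_mkord; apply: eq_bigr => i _.
  have ik : (i <= k)%N by rewrite -ltnS.
  rewrite !exprZn expr1n mulmxnE -scalerAl -scalerAr mulr1 !mxE.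
  rewrite -(bin_fact ik) !natrM /u /exp_coeff /= -mulr_natr.
  have f0 j : j`!%:R != 0 :> R by rewrite pnatr_eq0 -lt0n fact_gt0.
  have b0 : 'C(k, i)%:R != 0 :> R by rewrite pnatr_eq0 -lt0n bin_gt0.
  by field; rewrite !f0 b0.
have cvL : series (fun k => (k`!%:R)^-1 *: (s *: (P - 1)) ^+ k) @ \oo --> L.
  apply: cvg_mx => x y; rewrite (eq_cvg _ _ (SE ^~ x ^~ y)) mxE.
  by apply: (cvg_tri s0 (u_le x y) v_le) => //; exact: cvu.
move=> x y; rewrite /expmx (cvg_lim _ cvL); last exact: norm_hausdorff.
rewrite mxE mulrC.
have -> : series (fun m => poisson s m * (P ^+ m) x y) = (fun M => expR (- s) * series (u x y) M).
  by apply/funext => M; rewrite /series /= mulr_sumr; apply: eq_bigr => m _; rewrite /poisson /u mulrA.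
by apply: cvgM; [exact: cvg_cst | exact: cvu].
Qed.

End Poisson.

Section PoissonMean.
Context {R : realType}.
Implicit Types (b : nat -> R) (s y k : R).

Lemma poisson_ge0 s m : 0 <= s -> 0 <= poisson s m.
Proof. by move=> s0; rewrite mulr_ge0 ?expR_ge0 ?exp_coeff_ge0. Qed.

Lemma cvg_poisson s : series (poisson s) @ \oo --> (1 : R).
Proof.
have -> : series (poisson s) = (fun M => expR (- s) * series (exp_coeff s) M).
  by apply/funext => M; rewrite /series /= mulr_sumr.
rewrite -(expR0 R) -[0](addNr s) expRD; apply: cvgM; first exact: cvg_cst.
exact: (is_cvg_series_exp_coeff s).
Qed.

Lemma poissonS s m : m.+1%:R * poisson s m.+1 = s * poisson s m.
Proof.
rewrite /poisson /exp_coeff /= factS natrM exprS; field.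
by rewrite nat1r !pnatr_eq0 -lt0n fact_gt0.
Qed.

(** An exact formula for truncated sums: the last term is nonpositive once [s <= M.+1], so the
    variance bound needs no convergence of second moments. *)
Lemma poisson_variance s M : \sum_(0 <= m < M.+1) poisson s m * (m%:R - s) ^+ 2 =
  s * \sum_(0 <= m < M.+1) poisson s m + s * (s - M.+1%:R) * poisson s M.
Proof.
elim: M => [|M IH]; first by rewrite !big_nat1; ring.
rewrite big_nat_recr //= IH [in RHS]big_nat_recr //=.
have E := poissonS s M; rewrite [M.+2%:R]mulrSr.
have -> : s * (s - M.+1%:R) * poisson s M = (s - M.+1%:R) * (M.+1%:R * poisson s M.+1).
  by rewrite E; ring.
ring.
Qed.

Lemma poisson_mean_le b s y k B : 0 <= s -> 0 <= k ->
  (forall m, b m <= y + k * (m%:R - s) ^+ 2) ->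
  series (fun m => poisson s m * b m) @ \oo --> B -> B <= y + k * s.
Proof.
move=> s0 k0 bm cB.
have cS : (fun M => (y + k * s) * series (poisson s) M) @ \oo --> (y + k * s).
  by rewrite -[X in _ --> X]mulr1; apply: cvgM; [exact: cvg_cst | exact: cvg_poisson].
apply: (ler_cvg_to cB cS).
exists (Num.truncn s).+1 => // M /= sM.
case: M sM => // M sM; rewrite /series /=.
have sM' : s <= M.+1%:R.
  apply: le_trans (_ : (Num.truncn s).+1%:R <= _); first exact/ltW/truncnS_gt.
  by rewrite ler_nat.
apply: le_trans (_ : \sum_(0 <= m < M.+1) poisson s m * (y + k * (m%:R - s) ^+ 2) <= _).
  by apply: ler_sum => m _; rewrite ler_wpM2l ?poisson_ge0.
have -> : \sum_(0 <= m < M.+1) poisson s m * (y + k * (m%:R - s) ^+ 2) =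
   y * \sum_(0 <= m < M.+1) poisson s m + k * \sum_(0 <= m < M.+1) poisson s m * (m%:R - s) ^+ 2.
  by rewrite !mulr_sumr -big_split; apply: eq_bigr => m _ /=; ring.
rewrite poisson_variance.
have : 0 <= k * (s * (M.+1%:R - s) * poisson s M).
  apply: mulr_ge0 => //; apply: mulr_ge0; last exact: poisson_ge0.
  by rewrite mulr_ge0 // subr_ge0.
lra.
Qed.

Lemma poisson_mean_ge b s y k B : 0 <= s -> 0 <= k ->
  (forall m, y - k * (m%:R - s) ^+ 2 <= b m) ->
  series (fun m => poisson s m * b m) @ \oo --> B -> y - k * s <= B.
Proof.
move=> s0 k0 bm cB.
have : - B <= - y + k * s.
  apply: (@poisson_mean_le (fun m => - b m) s (- y) k) => //.
    by move=> m; have := bm m; lra.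
  have -> : series (fun m => poisson s m * - b m) = (fun M => - series (fun m => poisson s m * b m) M).
    by apply/funext => M; rewrite /series /= -sumrN; apply: eq_bigr => m _; rewrite mulrN.
  exact: cvgN.
lra.
Qed.

Lemma poisson_geometric_ge b s (rho : R) B : 0 <= s ->
  (forall m, rho ^+ m * b 0%N <= b m) ->
  series (fun m => poisson s m * b m) @ \oo --> B ->
  expR (- s * (1 - rho)) * b 0%N <= B.
Proof.
move=> s0 bm cB.
have cS : (fun M => expR (- s) * b 0%N * series (exp_coeff (s * rho)) M) @ \oo --> expR (- s * (1 - rho)) * b 0%N.
  have -> : expR (- s * (1 - rho)) * b 0%N = expR (- s) * b 0%N * expR (s * rho).
    by rewrite mulrAC -expRD; congr (expR _ * _); ring.
  by apply: cvgM; [exact: cvg_cst | exact: (is_cvg_series_exp_coeff (s * rho))].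
apply: (ler_cvg_to cS cB); near=> M; rewrite /series /= mulr_sumr; apply: ler_sum => m _.
have := ler_wpM2l (poisson_ge0 m s0) (bm m); apply: le_trans.
rewrite /poisson /exp_coeff /= exprMn le_eqVlt; apply/orP; left; apply/eqP; ring.
Unshelve. all: by end_near.
Qed.

End PoissonMean.

(** * Total variation and contraction *)

Section TotalVariation.
Context {R : realType} {n : nat}.
Implicit Types (P M : 'M[R]_n.+1) (mu nu pi : 'rV[R]_n.+1) (f g : 'cV[R]_n.+1).

Lemma cvg_sum (I : finType) (h : I -> nat -> R) (l : I -> R) :
  (forall i, h i @ \oo --> l i) -> (fun k => \sum_i h i k) @ \oo --> \sum_i l i.
Proof.
move=> hl; elim: (index_enum I) => [|i r IH].
  by under eq_fun do rewrite big_nil; rewrite big_nil; exact: cvg_cst.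
under eq_fun do rewrite big_cons.
by rewrite big_cons; apply: cvgD.
Qed.

Lemma has_ubound_range (T : finType) (h : T -> R) : has_ubound (range h).
Proof.
exists (\sum_i `|h i|) => _ [i _ <-]; rewrite (bigD1 i) //=.
by apply: le_trans (ler_norm _) _; rewrite lerDl sumr_ge0.
Qed.

Lemma max_tv_le P pi (e : R) :
  (forall x A, mass (row x P) A - mass pi A <= e) -> max_tv_dist P pi <= e.
Proof.
move=> H; apply: ge_sup; first by exists (tv_dist (row ord0 P) pi), ord0.
move=> _ [x _ <-]; apply: ge_sup; first by eexists; exists finset.set0.
by move=> _ [A _ <-].
Qed.

Lemma max_tv_ge P pi x A : mass (row x P) A - mass pi A <= max_tv_dist P pi.
Proof.
apply: le_trans (_ : tv_dist (row x P) pi <= _).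
  by apply: ub_le_sup; [exact: has_ubound_range | exists A].
by apply: ub_le_sup; [exact: has_ubound_range | exists x].
Qed.

Definition row_sums1 P := forall x, \sum_y P x y = 1.
Definition reversible pi P := forall x y, pi 0 x * P x y = pi 0 y * P y x.
Definition mean_mx pi f := \sum_x pi 0 x * f x 0.
Definition ip_mx pi f g := \sum_x pi 0 x * (f x 0 * g x 0).
Definition contracts pi P (ka : R) := forall f (a : R), mean_mx pi f = 0 ->
  (forall x, `|f x 0| <= a) -> forall x, `|(P *m f) x 0| <= ka * a.

(** For [f] of mean 0 the row of [P] may be replaced by its difference with [pi], whose L1 norm is
    twice the total variation, attained on [A]. *)
Lemma tv_contracts P pi (e : R) : row_sums1 P -> \sum_x pi 0 x = 1 ->
  max_tv_dist P pi <= e -> contracts pi P (2 * e).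
Proof.
move=> P1 pi1 Pe f a f0 fa x.
pose A := [set y : 'I_n.+1 | pi 0 y <= P x y]%SET.
have a0 : 0 <= a by apply: le_trans (fa ord0).
have -> : (P *m f) x 0 = \sum_y (P x y - pi 0 y) * f y 0.
  transitivity ((\sum_y P x y * f y 0) - mean_mx pi f); first by rewrite mxE f0 subr0.
  rewrite /mean_mx -sumrB; apply: eq_bigr => y _.
  by rewrite mulrBl.
apply: le_trans (ler_norm_sum _ _ _) _.
have HA : \sum_(y in A) (P x y - pi 0 y) <= e.
  apply: le_trans Pe; apply: le_trans (max_tv_ge P pi x A).
  by rewrite /mass -sumrB le_eqVlt; apply/orP; left; apply/eqP; apply: eq_bigr => y _; rewrite mxE.
have HS : \sum_y (P x y - pi 0 y) = 0 by rewrite sumrB P1 pi1 subrr.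
have HE : \sum_y `|P x y - pi 0 y| = 2 * \sum_(y in A) (P x y - pi 0 y).
  transitivity (\sum_y `|P x y - pi 0 y| + \sum_y (P x y - pi 0 y)); first by rewrite HS addr0.
  rewrite -big_split /= (bigID (mem A)) /= [X in _ + X]big1 ?addr0.
    rewrite mulr_sumr; apply: eq_bigr => y; rewrite inE => yA.
    by rewrite ger0_norm ?subr_ge0 //; ring.
  by move=> y; rewrite inE -ltNge => yA; rewrite ltr0_norm ?subr_lt0 // addNr.
apply: le_trans (_ : \sum_y `|P x y - pi 0 y| * a <= _).
  by apply: ler_sum => y _; rewrite normrM ler_wpM2l.
by rewrite -mulr_suml ler_wpM2r // HE ler_wpM2l.
Qed.

Lemma ip_mx_ge0 pi f : (forall x, 0 <= pi 0 x) -> 0 <= ip_mx pi f f.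
Proof. by move=> pi0; apply: sumr_ge0 => x _; rewrite mulr_ge0 // -expr2 sqr_ge0. Qed.

Lemma ip_mx_CS pi f g : (forall x, 0 <= pi 0 x) ->
  ip_mx pi f g ^+ 2 <= ip_mx pi f f * ip_mx pi g g.
Proof.
move=> pi0; have Q (a b : R) : 0 <= a ^+ 2 * ip_mx pi f f + 2 * a * b * ip_mx pi f g + b ^+ 2 * ip_mx pi g g.
  have := ip_mx_ge0 (a *: f + b *: g) pi0; congr (_ <= _).
  rewrite /ip_mx !mulr_sumr -!big_split /=; apply: eq_bigr => x _; rewrite !mxE; ring.
have := ip_mx_ge0 g pi0; rewrite le_eqVlt => /predU1P[g0|g0].
  rewrite -g0 mulr0; have := Q (- (1 + ip_mx pi f f)^-1 * ip_mx pi f g) 1; rewrite -g0.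
  have := Q (ip_mx pi f g) (- (1 + ip_mx pi f f)); rewrite -g0.
  have := ip_mx_ge0 f pi0; have := sqr_ge0 (ip_mx pi f g); nra.
have := Q (ip_mx pi g g) (- ip_mx pi f g).
have -> : ip_mx pi g g ^+ 2 * ip_mx pi f f +
   2 * ip_mx pi g g * - ip_mx pi f g * ip_mx pi f g +
   (- ip_mx pi f g) ^+ 2 * ip_mx pi g g =
   ip_mx pi g g * (ip_mx pi f f * ip_mx pi g g - ip_mx pi f g ^+ 2) by ring.
by rewrite pmulr_rge0 // subr_ge0.
Qed.

Lemma reversible_adj pi M f g : reversible pi M ->
  ip_mx pi (M *m f) g = ip_mx pi f (M *m g).
Proof.
move=> rM; rewrite /ip_mx.
under eq_bigr => x _ do rewrite mxE mulr_suml mulr_sumr.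
rewrite exchange_big /=; apply: eq_bigr => y _; rewrite mxE !mulr_sumr.
apply: eq_bigr => x _.
have -> : pi 0 x * (M x y * f y 0 * g x 0) = pi 0 x * M x y * (f y 0 * g x 0) by ring.
by rewrite rM; ring.
Qed.

Lemma reversible_mul pi M : reversible pi M -> reversible pi (M *m M).
Proof.
move=> rM x y; rewrite !mxE !mulr_sumr; apply: eq_bigr => z _.
by rewrite mulrA rM mulrAC rM; ring.
Qed.

Lemma reversible_mean pi M f : reversible pi M -> row_sums1 M ->
  mean_mx pi (M *m f) = mean_mx pi f.
Proof.
move=> rM M1; rewrite /mean_mx.
under eq_bigr => x _ do rewrite mxE mulr_sumr.
rewrite exchange_big /=; apply: eq_bigr => y _.
under eq_bigr => x _ do rewrite mulrA rM mulrAC.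
by rewrite -mulr_sumr M1 mulr1.
Qed.

Lemma row_sums1_mul M P : row_sums1 M -> row_sums1 P -> row_sums1 (M *m P).
Proof.
move=> M1 P1 x; under eq_bigr => y _ do rewrite mxE.
by rewrite exchange_big /= -[RHS](M1 x); apply: eq_bigr => z _; rewrite -mulr_sumr P1 mulr1.
Qed.

Lemma contracts_mul pi M P (ka la : R) : 0 <= la -> reversible pi P -> row_sums1 P ->
  contracts pi M ka -> contracts pi P la -> contracts pi (M *m P) (ka * la).
Proof.
move=> la0 rP P1 cM cP f a f0 fa x; rewrite -mulmxA -mulrA.
by apply: cM; [rewrite reversible_mean | exact: cP].
Qed.

(* By Cauchy-Schwarz the ratio [<M f, f> / <f, f>] is at most squared when [M]
   is, while the contraction rate is squared exactly: iterating, the constants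
   disappear. *)
Lemma contracts_ip pi M (ka : R) f : (forall x, 0 <= pi 0 x) -> \sum_x pi 0 x = 1 ->
  reversible pi M -> row_sums1 M -> 0 < ka -> contracts pi M ka -> mean_mx pi f = 0 ->
  ip_mx pi (M *m f) f <= ka * ip_mx pi f f.
Proof.
move=> pi0 pi1 rM M1 ka0 cM f0.
have := ip_mx_ge0 f pi0; rewrite le_eqVlt => /predU1P[/esym f2|f2].
  have := ip_mx_CS (M *m f) f pi0; rewrite f2 !mulr0.
  by have := sqr_ge0 (ip_mx pi (M *m f) f); nra.
pose r := ip_mx pi (M *m f) f / ip_mx pi f f.
rewrite leNgt; apply/negP => H.
have rka : ka < r by rewrite ltr_pdivlMr.
have r0 : 0 < r by exact: lt_trans rka.
pose a := \sum_x `|f x 0|.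
have fa x : `|f x 0| <= a by rewrite /a (bigD1 x) //= lerDl sumr_ge0.
have a0 : 0 <= a by exact: sumr_ge0.
have key k : exists Q, [/\ reversible pi Q, row_sums1 Q, contracts pi Q (ka ^+ (2 ^ k)) &
    r ^+ (2 ^ k) * ip_mx pi f f <= ip_mx pi (Q *m f) f].
  elim: k => [|k [Q [rQ Q1 cQ HQ]]].
    by exists M; split => //; rewrite !expr1 divfK // gt_eqF.
  exists (Q *m Q); rewrite expnS mul2n -addnn !exprD; split.
  - exact: reversible_mul.
  - exact: row_sums1_mul.
  - by apply: contracts_mul => //; rewrite exprn_ge0 // ltW.
  - rewrite -mulmxA reversible_adj //.
    have := ip_mx_CS (Q *m f) f pi0; rewrite -ler_pdivrMr //; apply: le_trans.
    rewrite ler_pdivlMr //; move: HQ; set q := r ^+ (2 ^ k).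
    have q0 : 0 < q by rewrite exprn_gt0.
    move: (ip_mx pi (Q *m f) f) (ip_mx pi f f) f2 => u v v0 quv.
    have -> : q * q * v * v = (q * v) ^+ 2 by ring.
    by rewrite ler_sqr ?nnegrE // ?(le_trans _ quv) // mulr_ge0 // ltW.
pose h := r / ka - 1.
have h0 : 0 < h by rewrite subr_gt0 ltr_pdivlMr // mul1r.
(* The sup norm contraction of [Q] bounds [<Q f, f>] by [a ^+ 2 * ka ^+ (2 ^ k)]. So the powers of
   [r / ka > 1] would stay bounded, which Bernoulli's inequality refutes. *)
have bound k : (1 + h) ^+ (2 ^ k) * ip_mx pi f f <= a ^+ 2.
  have [Q [rQ Q1 cQ HQ]] := key k.
  have -> : 1 + h = r / ka by rewrite /h addrC subrK.
  rewrite expr_div_n mulrAC ler_pdivrMr ?exprn_gt0 //; apply: (le_trans HQ).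
  have -> : a ^+ 2 * ka ^+ (2 ^ k) = \sum_x pi 0 x * (ka ^+ (2 ^ k) * a * a).
    by rewrite -mulr_suml pi1; ring.
  apply: ler_sum => x _; rewrite ler_wpM2l //; apply: le_trans (ler_norm _) _.
  by rewrite normrM ler_pM // cQ.
have bern k : 1 + k%:R * h <= (1 + h) ^+ k.
  elim: k => [|k IH]; first by rewrite mul0r addr0 expr0.
  rewrite exprS -natr1; have := ler_wpM2l (_ : 0 <= 1 + h) IH.
  by move=> /(_ ltac:(lra)); have : 0 <= k%:R * h ^+ 2 by [rewrite mulr_ge0 // sqr_ge0]; nra.
pose K := (Num.truncn (a ^+ 2 / ip_mx pi f f / h)).+1.
have := bound K; rewrite -ler_pdivlMr //; apply/negP; rewrite -ltNge.
have K1 : a ^+ 2 / ip_mx pi f f / h < K%:R by exact: truncnS_gt.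
rewrite ltr_pdivrMr // in K1; apply: (lt_le_trans K1).
apply: le_trans (bern (2 ^ K)%N); apply: le_trans (_ : (2 ^ K)%:R * h <= _); last by rewrite lerDr.
by rewrite ler_pM2r // ler_nat ltnW // ltn_expl.
Qed.

(** An arbitrary linear functional of the kernel covers both uses: a row paired with a function, and
    a quadratic form. *)
Lemma semigroup_functional P s (C : 'I_n.+1 -> 'I_n.+1 -> R) :
  0 <= s -> (forall k x y, `|(P ^+ k) x y| <= 1) ->
  series (fun m => poisson s m * \sum_x \sum_y C x y * (P ^+ m) x y) @ \oo -->
  \sum_x \sum_y C x y * expmx (s *: (P - 1)) x y.
Proof.
move=> s0 P1.
have -> : series (fun m => poisson s m * \sum_x \sum_y C x y * (P ^+ m) x y) =
   (fun k => \sum_x \sum_y C x y * series (fun m => poisson s m * (P ^+ m) x y) k).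
  apply/funext => k; rewrite /series /=.
  under eq_bigr => m _ do rewrite mulr_sumr.
  rewrite exchange_big /=; apply: eq_bigr => x _.
  under eq_bigr => m _ do rewrite mulr_sumr.
  rewrite exchange_big /=; apply: eq_bigr => y _.
  by rewrite mulr_sumr; apply: eq_bigr => m _; rewrite mulrCA.
apply: cvg_sum => x; apply: cvg_sum => y; apply: cvgM; first exact: cvg_cst.
exact: expmx_poisson.
Qed.

End TotalVariation.

(** * The network of a birth and death chain *)

Section ChainNetwork.
Context {R : realType} {n : nat}.
Variables (X : bd_chain R n) (pi : 'rV[R]_n.+1).
Hypothesis irr : irreducible_kernel (bd_kernel X).
Hypothesis st : stationary_distribution (bd_kernel X) pi.
Local Notation K := (bd_kernel X).

Let pn k := pi 0 (inord k).
Let bn k := birth X (inord k).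
Let dn k := death X (inord k).
Let hn k := hold X (inord k).

Lemma sum_ord_inord (P : pred nat) (F : 'I_n.+1 -> R) :
  \sum_(k < n.+1 | P k) F k = \sum_(0 <= k < n.+1 | P k) F (inord k).
Proof. by rewrite big_mkord; apply: eq_bigr => k _; rewrite inord_val. Qed.

Lemma sum_ord_delta (k : nat) (F : nat -> R) :
  \sum_(y < n.+1) (y == k :> nat)%:R * F y = if (k <= n)%N then F k else 0.
Proof.
case: (leqP k n) => kn; last first.
  by rewrite big1 // => y _; rewrite ltn_eqF ?mul0r // (leq_trans (ltn_ord y)).
rewrite (bigD1 (Ordinal (kn : (k < n.+1)%N))) //= eqxx mul1r big1 ?addr0 // => y.
by rewrite -val_eqE /= => /negPf ->; rewrite mul0r.
Qed.

Lemma bd_kernelE (x y : 'I_n.+1) : K x y =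
  (y == x.+1 :> nat)%:R * birth X x + (x == y.+1 :> nat)%:R * death X x
  + (x == y)%:R * hold X x.
Proof.
rewrite mxE; case: (eqVneq (y : nat) x.+1) => [yx|yx].
  have -> : (x == y.+1 :> nat) = false by lia.
  have -> : (x == y) = false by rewrite -val_eqE /=; lia.
  by rewrite mul1r !mul0r !addr0.
case: (eqVneq (x : nat) y.+1) => [xy|xy].
  have -> : (x == y) = false by rewrite -val_eqE /=; lia.
  by rewrite mul1r !mul0r addr0 add0r.
by case: eqVneq => _; rewrite ?mul1r !mul0r !add0r.
Qed.

Lemma bd_kernel_row (x : 'I_n.+1) (F : nat -> R) :
  \sum_y K x y * F y = birth X x * F x.+1 + death X x * F x.-1 + hold X x * F x.
Proof.
under eq_bigr => y _ do rewrite bd_kernelE !mulrDl.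
rewrite !big_split /=; congr (_ + _ + _).
- under eq_bigr => y _ do rewrite mulrAC mulrC.
  rewrite -mulr_sumr sum_ord_delta; case: ltnP => // nx.
  have -> : x = ord_max by apply/val_inj/eqP; rewrite eqn_leq /= nx -ltnS ltn_ord.
  by rewrite birth_last !mul0r.
- case: x => [[|x] xn] /=.
    have -> : death X (Ordinal xn) = 0.
      by rewrite (_ : Ordinal xn = ord0) ?death_first //; exact: val_inj.
    by rewrite big1 ?mul0r // => y _; rewrite !mul0r.
  under eq_bigr => y _ do rewrite mulrAC mulrC eqSS eq_sym.
  by rewrite -mulr_sumr sum_ord_delta ltnW.
- under eq_bigr => y _ do rewrite mulrAC mulrC eq_sym -val_eqE.
  by rewrite -mulr_sumr sum_ord_delta -ltnS ltn_ord.
Qed.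

Lemma bd_kernel_ge0 (x y : 'I_n.+1) : 0 <= K x y.
Proof.
by rewrite bd_kernelE !addr_ge0 ?mulr_ge0 ?ler0n ?birth_ge0 ?death_ge0 ?hold_ge0.
Qed.

Lemma pow_ge0 m (x y : 'I_n.+1) : 0 <= (K ^+ m) x y.
Proof.
elim: m x y => [|m IH] x y; first by rewrite expr0 !mxE; case: (x == y).
by rewrite exprS mxE sumr_ge0 // => z _; rewrite mulr_ge0 ?bd_kernel_ge0.
Qed.

(** If the death rate at [i] vanished, no power of the kernel would lead from [[i, n]] into
    [[0, i)]. *)
Lemma death_gt0 (i : 'I_n.+1) : (0 < i)%N -> 0 < death X i.
Proof.
move=> i_n; rewrite lt_neqAle death_ge0 andbT; apply/eqP => bi.
have i1 : (i.-1 < n.+1)%N by rewrite (leq_ltn_trans (leq_pred _)).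
have [m] := irr i (Ordinal i1); apply/negP; rewrite -leNgt.
suff H : forall x y : 'I_n.+1, (y < i <= x)%N -> (K ^+ m) x y = 0.
  by rewrite H ?leqnn //= prednK ?leqnn.
elim: m => [|m IH] x y /andP[yi ix].
  by rewrite expr0 mxE; have -> : (x == y) = false by rewrite -val_eqE /=; lia.
rewrite exprSr mxE big1 // => z _; case: (ltnP z i) => zi; first by rewrite IH ?mul0r ?zi.
rewrite bd_kernelE; have -> : (y == z.+1 :> nat) = false by lia.
have -> : (z == y) = false by rewrite -val_eqE /=; lia.
rewrite !mul0r addr0 add0r; case: eqVneq => [yz|_]; last by rewrite mul0r mulr0.
have -> : z = i by apply/val_inj => /=; lia.
by rewrite -bi !mulr0.
Qed.

Lemma pi_ge0 x : 0 <= pi 0 x. Proof. by case: st. Qed.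
Lemma pi_sum : \sum_x pi 0 x = 1. Proof. by case: st. Qed.
Lemma pi_stat : pi *m K = pi. Proof. by case: st. Qed.

Lemma pi_gt0 y : 0 < pi 0 y.
Proof.
have [x px] : exists x, 0 < pi 0 x.
  apply/not_existsP => H; have := pi_sum; rewrite big1; first by move/esym/eqP; rewrite oner_eq0.
  by move=> x _; apply/eqP; rewrite eq_le pi_ge0 leNgt andbT; apply/negP/H.
have [m Kxy] := irr x y.
have Em : pi *m K ^+ m = pi.
  elim: m {Kxy} => [|m IH]; first by rewrite expr0 mulmx1.
  by rewrite exprS mulmxA pi_stat.
rewrite -Em mxE (bigD1 x) //= ltr_wpDr ?mulr_gt0 // sumr_ge0 // => z _.
by rewrite mulr_ge0 ?pi_ge0 ?pow_ge0.
Qed.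

Lemma pi_stat_nat y : (y <= n)%N ->
  pn y = (if (0 < y)%N then pn y.-1 * bn y.-1 else 0)
       + (if (y < n)%N then pn y.+1 * dn y.+1 else 0) + pn y * hn y.
Proof.
move=> yn; rewrite [LHS]/pn -{1}pi_stat mxE.
under eq_bigr => x _ do rewrite bd_kernelE !mulrDr.
rewrite !big_split /= inordK //; congr (_ + _ + _).
- case: y yn => [|y] yn; first by rewrite big1 // => x _; rewrite mul0r mulr0.
  transitivity (\sum_(x < n.+1) (x == y :> nat)%:R * (pn x * bn x)).
    by apply: eq_bigr => x _; rewrite eqSS eq_sym mulrCA /pn /bn inord_val.
  by rewrite (sum_ord_delta y (fun k => pn k * bn k)) ltnW.
- transitivity (\sum_(x < n.+1) (x == y.+1 :> nat)%:R * (pn x * dn x)).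
    by apply: eq_bigr => x _; rewrite mulrCA /pn /dn inord_val.
  by rewrite (sum_ord_delta y.+1 (fun k => pn k * dn k)).
- transitivity (\sum_(x < n.+1) (x == y :> nat)%:R * (pn x * hn x)).
    by apply: eq_bigr => x _; rewrite -val_eqE /= inordK // mulrCA /pn /hn inord_val.
  by rewrite (sum_ord_delta y (fun k => pn k * hn k)) yn.
Qed.

Lemma rates_nat k : bn k + dn k + hn k = 1.
Proof. exact: bd_rates_sum. Qed.

Lemma dn0 : dn 0 = 0.
Proof. by rewrite /dn (_ : inord 0 = ord0) ?death_first //; apply/val_inj; rewrite /= inordK. Qed.

Lemma bnn : bn n = 0.
Proof. by rewrite /bn (_ : inord n = ord_max) ?birth_last //; apply/val_inj; rewrite /= inordK. Qed.

(** Stationarity at [k] says that the net flux through the edge above [k] equals that through the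
    edge below; it is 0 at the left end, hence everywhere. *)
Lemma detailed_balance k : (k < n)%N -> pn k * bn k = pn k.+1 * dn k.+1.
Proof.
elim: k => [|k IH] kn; have := pi_stat_nat (ltnW kn); rewrite kn /=.
  by have := rates_nat 0; rewrite dn0 => H1 H2; have : pn 0 * (bn 0 + 0 + hn 0) = pn 0 by [rewrite H1 mulr1]; lra.
rewrite IH ?(ltnW kn) // => H2; have H1 := rates_nat k.+1.
have : pn k.+1 * (bn k.+1 + dn k.+1 + hn k.+1) = pn k.+1 by rewrite H1 mulr1.
lra.
Qed.

Let en x := if (0 < x <= n)%N then pn x * dn x else 0.

Let enS x : (x <= n)%N -> en x.+1 = pn x * bn x.
Proof.
rewrite /en /= leq_eqVlt => /predU1P[->|xn]; first by rewrite ltnn bnn mulr0.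
by rewrite xn detailed_balance.
Qed.

Let en_le_n x : (x <= n)%N -> en x = pn x * dn x.
Proof. by case: x => [|x] xn; rewrite /en ?dn0 ?mulr0 //= xn. Qed.

Let pn_gt0 x : (x <= n)%N -> 0 < pn x. Proof. by move=> _; exact: pi_gt0. Qed.
Let pn_sum : \sum_(0 <= x < n.+1) pn x = 1.
Proof. by rewrite -(sum_ord_inord xpredT) pi_sum. Qed.
Let en_gt0 x : (0 < x <= n)%N -> 0 < en x.
Proof.
by move=> /andP[x0 xn]; rewrite en_le_n // mulr_gt0 ?pi_gt0 // death_gt0 // inordK.
Qed.
Let en_first : en 0 = 0. Proof. by []. Qed.
Let en_last : en n.+1 = 0. Proof. by rewrite /en ltnn andbF. Qed.
Let en_le x : (x <= n)%N -> en x + en x.+1 <= pn x.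
Proof.
move=> xn; rewrite enS // en_le_n // -mulrDr -[leRHS]mulr1 ler_wpM2l ?pi_ge0 //.
by have := rates_nat x; have := hold_ge0 X (inord x); rewrite -/(hn x); lra.
Qed.

Definition bd_network : network R := Network pn_gt0 pn_sum en_gt0 en_first en_last en_le.
Local Notation N := bd_network.

Variable delta : R.
Hypothesis delta01 : 0 <= delta <= 1.
Local Notation P := (lazy delta K).

Lemma lazyE (K0 : 'M[R]_n.+1) x y :
  lazy delta K0 x y = delta * (x == y)%:R + (1 - delta) * K0 x y.
Proof. by rewrite !mxE. Qed.

Lemma lazy_row (x : 'I_n.+1) (F : nat -> R) : \sum_y P x y * F y = step N (1 - delta) F x.
Proof.
have xn : (x <= n)%N by rewrite -ltnS.
have px := lt0r_neq0 (pi_gt0 x).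
rewrite /step /= enS // en_le_n // /pn /bn /dn inord_val.
transitivity (delta * F x + (1 - delta) * \sum_y K x y * F y).
  under eq_bigr => y _ do rewrite lazyE mulrDl -!mulrA.
  rewrite big_split /= -!mulr_sumr; congr (delta * _ + _).
  rewrite (bigD1 x) //= eqxx mul1r big1 ?addr0 // => y yx.
  by rewrite eq_sym (negPf yx) mul0r.
rewrite bd_kernel_row (_ : hold X x = 1 - birth X x - death X x); last by rewrite -(bd_rates_sum X x); ring.
by field.
Qed.

Lemma lazy_pow m (x : 'I_n.+1) (F : nat -> R) :
  \sum_y (P ^+ m) x y * F y = iter m (step N (1 - delta)) F x.
Proof.
elim: m x => [|m IH] x.
  rewrite expr0 (bigD1 x) //= mxE eqxx mul1r big1 ?addr0 // => y yx.
  by rewrite mxE eq_sym (negPf yx) mul0r.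
rewrite exprS iterS -lazy_row.
under eq_bigr => y _ do rewrite mxE mulr_suml.
rewrite exchange_big /=; apply: eq_bigr => z _; rewrite -IH mulr_sumr.
by apply: eq_bigr => y _; rewrite mulrA.
Qed.

Lemma lazy_pow_le1 m (x y : 'I_n.+1) : `|(P ^+ m) x y| <= 1.
Proof.
have -> : (P ^+ m) x y = iter m (step N (1 - delta)) (fun z => (z == y :> nat)%:R) x.
  rewrite -lazy_pow (bigD1 y) //= eqxx mulr1 big1 ?addr0 // => z zy.
  by move: zy; rewrite -val_eqE /= => /negPf ->; rewrite mulr0.
apply: norm_iter_step_le1; first by case/andP: delta01 => d0 d1; apply/andP; split; lra.
- by move=> z _; case: (z == y :> nat); rewrite ?normr1 ?normr0.
- by rewrite /= -ltnS.
Qed.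

Lemma lazy_row_sums1 m : row_sums1 (P ^+ m).
Proof.
move=> x; have := lazy_pow m x (fun=> 1).
have -> : iter m (step N (1 - delta)) (fun=> 1) x = 1.
  by elim: m (x : nat) => //= m IH y; rewrite (eq_step _ _ _ IH) step_cst.
by move=> <-; apply: eq_bigr => y _; rewrite mulr1.
Qed.

Lemma bd_reversible : reversible pi K.
Proof.
have H (x y : 'I_n.+1) : (y == x.+1 :> nat)%:R * (pi 0 x * birth X x) = (y == x.+1 :> nat)%:R * (pi 0 y * death X y).
  case: eqVneq => [yx|_]; last by rewrite !mul0r.
  have xn : (x < n)%N by have := ltn_ord y; rewrite yx.
  have := detailed_balance xn; rewrite /pn /bn /dn inord_val.
  by rewrite (_ : inord x.+1 = y) => [->|] //; apply/val_inj; rewrite /= inordK ?yx.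
have E (x y : 'I_n.+1) : pi 0 x * K x y = (y == x.+1 :> nat)%:R * (pi 0 x * birth X x) +
    (x == y.+1 :> nat)%:R * (pi 0 x * death X x) + (x == y)%:R * (pi 0 x * hold X x).
  by rewrite bd_kernelE; ring.
move=> x y; rewrite !E (H x y) (H y x); congr (_ + _); first by rewrite addrC.
by rewrite eq_sym; case: eqVneq => [->|_] //; rewrite !mul0r.
Qed.

Lemma lazy_pow_reversible m : reversible pi (P ^+ m).
Proof.
have rP : reversible pi P.
  move=> x y; rewrite !lazyE !mulrDr [_ * ((1 - _) * _)]mulrCA bd_reversible; congr (_ + _); last by ring.
  by rewrite eq_sym; case: eqVneq => [->|_] //; rewrite !mulr0.
elim: m => [|m IH] x y.
  by rewrite expr0 !mxE eq_sym; case: eqVneq => [->|_] //; rewrite !mulr0.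
rewrite {1}exprS exprSr !mxE !mulr_sumr; apply: eq_bigr => z _.
by rewrite mulrA rP mulrAC IH; ring.
Qed.

Lemma mass_leE (k : 'I_n.+1) : mass_le pi k = lmass N k.
Proof.
rewrite /mass_le /mass /lmass (big_nat_widen 0 k.+1 n.+1) //= big_mkord.
by apply: eq_big => [x|x _]; rewrite ?inE ?ltnS // /pn inord_val.
Qed.

Lemma mass_geE (k : 'I_n.+1) : mass_ge pi k = rmass N k.
Proof.
rewrite /mass_ge /mass /rmass (big_nat_widenl k 0) //= big_mkord.
by apply: eq_big => [x|x _]; rewrite ?inE // /pn inord_val.
Qed.

Lemma cond_birth (k : 'I_n.+1) : pi 0 k * birth X k = ne N k.+1.
Proof. by rewrite /= enS -1?ltnS // /pn /bn inord_val. Qed.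

Lemma cond_death (k : 'I_n.+1) : pi 0 k * death X k = ne N k.
Proof. by rewrite /= en_le_n -1?ltnS // /pn /dn inord_val. Qed.

Lemma bd_tE (i : 'I_n.+1) : bd_t X pi i = Num.max (hit N i 0) (rhit N i n).
Proof.
rewrite /bd_t /hit /rhit; congr Num.max.
  under eq_bigr => k _ do rewrite mass_leE cond_birth.
  rewrite -(big_mkord (fun k => k < i)%N (fun k => lmass N k / ne N k.+1)).
  by rewrite [RHS](big_nat_widen 0 i n.+1) // ltnW.
under eq_bigr => k _ do rewrite mass_geE cond_death.
rewrite -(big_mkord (fun k => i < k)%N (fun k => rmass N k / ne N k)).
transitivity (\sum_(i.+1 <= k < n.+1) rmass N k / ne N k); last by rewrite big_add1.
by rewrite [RHS](big_nat_widenl i.+1 0).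
Qed.

Let ell_left (i j : 'I_n.+1) : \sum_(k < n.+1 | (j <= k < i)%N) mass_le pi j / (pi 0 k * birth X k)
  = lmass N j * res N j i.
Proof.
under eq_bigr => k _ do rewrite mass_leE cond_birth.
rewrite -(big_mkord (fun k => j <= k < i)%N (fun k => lmass N j / ne N k.+1)) -mulr_sumr.
congr (_ * _); rewrite /res (big_nat_widen j i n.+1) 1?ltnW //.
by rewrite (big_nat_widenl j 0) //; apply: eq_bigl => k; rewrite andbC.
Qed.

Let ell_right (i j : 'I_n.+1) : \sum_(k < n.+1 | (i < k <= j)%N) mass_ge pi j / (pi 0 k * death X k)
  = rmass N j * res N i j.
Proof.
under eq_bigr => k _ do rewrite mass_geE cond_death.
rewrite -(big_mkord (fun k => i < k <= j)%N (fun k => rmass N j / ne N k)) -mulr_sumr.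
congr (_ * _); rewrite /res -[RHS](big_add1 _ _ i j.+1 xpredT (fun k => (ne N k)^-1)).
rewrite (big_nat_widen i.+1 j.+1 n.+1) //.
by rewrite (big_nat_widenl i.+1 0) //; apply: eq_bigl => k; rewrite andbC ltnS.
Qed.

Lemma bd_ell_leP (i : 'I_n.+1) (b : R) : 0 <= b ->
  (forall j, (j < i)%N -> lmass N j * res N j i <= b) ->
  (forall j, (i < j <= n)%N -> rmass N j * res N i j <= b) -> bd_ell X pi i <= b.
Proof.
move=> b0 Hl Hr; rewrite /bd_ell ge_max; apply/andP; split; apply: bigmax_le => // j ij.
  by rewrite ell_left Hl.
by rewrite ell_right Hr // ij -ltnS ltn_ord.
Qed.

Lemma bd_ell_left (i : 'I_n.+1) j : (j < i)%N -> lmass N j * res N j i <= bd_ell X pi i.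
Proof.
move=> ji; have jn : (j < n.+1)%N by rewrite (ltn_trans ji).
rewrite /bd_ell le_max -(ell_left i (Ordinal jn)); apply/orP; left.
exact: (@le_bigmax_cond _ _ _ _ (Ordinal jn)).
Qed.

Lemma bd_ell_right (i : 'I_n.+1) j : (i < j <= n)%N -> rmass N j * res N i j <= bd_ell X pi i.
Proof.
move=> /andP[ij jn]; rewrite /bd_ell le_max -(ell_right i (Ordinal (jn : (j < n.+1)%N))); apply/orP; right.
exact: (@le_bigmax_cond _ _ _ _ (Ordinal (jn : (j < n.+1)%N))).
Qed.

Lemma bd_ell_ge0 (i : 'I_n.+1) : 0 <= bd_ell X pi i.
Proof. by rewrite /bd_ell le_max bigmax_ge_id. Qed.

Variable i : 'I_n.+1.
Hypothesis med : median_state pi i.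
Local Notation t := (bd_t X pi i).
Local Notation l := (bd_ell X pi i).

Lemma bd_median_bounds : median_bounds N i t l.
Proof.
case: med => ml mg; split.
- by rewrite /= -ltnS.
- by rewrite -mass_leE.
- by rewrite -mass_geE.
- by rewrite bd_tE le_max lexx.
- by rewrite bd_tE le_max lexx orbT.
- exact: bd_ell_ge0.
- exact: bd_ell_left.
- exact: bd_ell_right.
Qed.

Lemma bd_t_attained : hit N i 0 = t \/ rhit N i (nsz N) = t.
Proof. by rewrite bd_tE; case: leP => _; [right | left]. Qed.

(** An edge between [i] and a neighbour already contributes at least 1: its conductance is at most
    the weight of the neighbour, hence at most the mass on that side. This puts rounding and Poisson
    errors inside the window. *)
Lemma bd_ell_ge1 : (0 < n)%N -> 1 <= l.
Proof.
move=> n0; have mb := bd_median_bounds; have ni := mb_le mb.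
have ele x : (x <= n)%N -> en x <= pn x /\ en x.+1 <= pn x.
  move=> xn; have := en_le xn; have := @ne_ge0 _ N x.+1 xn.
  have := @ne_ge0 _ N x (leqW xn); rewrite /=; lra.
case: (posnP i) => [i0|i0].
  have H := mb_right mb (_ : (i < n <= n)%N); rewrite i0 n0 leqnn in H.
  have i1 : (i < 1 <= nsz N)%N by rewrite i0.
  apply: le_trans (mb_right mb i1); rewrite i0 /res big_nat1.
  rewrite ler_pdivlMr ?ne_gt0 // mul1r.
  apply: le_trans (proj1 (ele 1%N n0)) _; rewrite /rmass big_ltn //= lerDl.
  by rewrite big_nat sumr_ge0 // => k /andP[_ kn]; rewrite pi_ge0.
have i1 : (i.-1 < i)%N by rewrite prednK.
apply: le_trans (mb_left mb i1); rewrite /res big_ltn // [X in _ + X]big_geq ?addr0 ?prednK //.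
have i2 : (i.-1 <= n)%N by rewrite (leq_trans (leq_pred _)).
rewrite ler_pdivlMr; last by rewrite ne_gt0 // i0.
rewrite mul1r -{1}(prednK i0); apply: le_trans (proj2 (ele _ i2)) _; rewrite /lmass big_nat_recr //= lerDr.
by rewrite big_nat sumr_ge0 // => k /andP[_ kn]; rewrite pi_ge0.
Qed.

Lemma bd_t_ge0 : 0 <= t.
Proof. by apply: le_trans (mb_hit bd_median_bounds); apply: hit_ge0; rewrite /= -ltnS. Qed.

Lemma bd_ell_le_t : l <= t.
Proof.
have mb := bd_median_bounds; have ni := mb_le mb.
apply: bd_ell_leP; first exact: bd_t_ge0.
  move=> j ji; apply: le_trans (mb_hit mb).
  apply: le_trans (le_hit (leq0n j) (ltnW ji) ni); rewrite /res /hit mulr_sumr !big_nat.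
  apply: ler_sum => k /andP[jk ki]; rewrite ler_wpM2r ?invr_ge0 ?le_lmass ?ne_ge0 //.
  - by rewrite ltnS (leq_trans (ltnW ki)).
  - by rewrite (leq_trans (ltnW ki)).
move=> j /andP[ij jn]; apply: le_trans (mb_rhit mb); rewrite /res /rhit mulr_sumr.
apply: le_trans (_ : \sum_(i <= k < j) rmass N k.+1 / ne N k.+1 <= _).
  rewrite !big_nat; apply: ler_sum => k /andP[ik kj].
  apply: ler_wpM2r; last by apply: le_rmass => //; exact: leqW.
  by rewrite invr_ge0 ne_ge0 // ltnS (leq_trans (ltnW kj)).
apply: ler_sum_nat_ge0 => // k /andP[_ kn]; rewrite divr_ge0 ?ne_ge0 //; last by rewrite ltnW.
by rewrite ltW // rmass_gt0.
Qed.

(** Every term of the two sums is at least 1, and the sums have [n] terms together. It makes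
    additive constants negligible for large [n]. *)
Lemma bd_t_ge : n%:R / 2 <= t.
Proof.
have mb := bd_median_bounds; have ni := mb_le mb.
have h1 : i%:R <= hit N i 0.
  rewrite -[i in i%:R]subn0 -sumr_const_nat /hit !big_nat; apply: ler_sum => k /andP[_ ki].
  have kn : (k < n)%N := leq_trans ki ni.
  rewrite ler_pdivlMr ?ne_gt0 // mul1r; apply: le_trans (_ : nw N k <= _).
    have := @ne_le _ N k (ltnW kn); have := @ne_ge0 _ N k (leqW (ltnW kn)); lra.
  rewrite /lmass big_nat_recr //= lerDr big_nat sumr_ge0 // => x _; exact: pi_ge0.
have h2 : (n - i)%:R <= rhit N i n.
  rewrite -sumr_const_nat /rhit !big_nat; apply: ler_sum => k /andP[_ kn].
  rewrite ler_pdivlMr ?ne_gt0 // mul1r; apply: le_trans (_ : nw N k.+1 <= _).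
    have := @ne_le _ N k.+1 kn; have := @ne_ge0 _ N k.+2 kn; lra.
  rewrite /rmass big_ltn //= lerDl big_nat sumr_ge0 // => x _; exact: pi_ge0.
have := mb_hit mb; have := mb_rhit mb; rewrite natrB // in h2; rewrite /=; lra.
Qed.

End ChainNetwork.

(** * Log-convexity of moments, in place of spectral measures *)

Section LogConvexity.
Context {R : realType}.
Variable N : network R.
Implicit Types (f g F : nat -> R) (c : R).

Lemma discriminant_le (a b d : R) : 0 <= d ->
  (forall s, 0 <= a + 2 * s * b + s ^+ 2 * d) -> b ^+ 2 <= a * d.
Proof.
rewrite le_eqVlt => /predU1P[<-|d0] H.
  rewrite mulr0; have [->|bN] := eqVneq b 0; first by rewrite expr0n.
  have := H (- (a + 1) / (2 * b)).
  have -> : a + 2 * (- (a + 1) / (2 * b)) * b + (- (a + 1) / (2 * b)) ^+ 2 * 0 = -1.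
    by field.
  by rewrite lerNr oppr0 ler10.
have := H (- b / d).
have -> : a + 2 * (- b / d) * b + (- b / d) ^+ 2 * d = (a * d - b ^+ 2) / d.
  by field; rewrite gt_eqF.
by rewrite pmulr_lge0 ?invr_gt0 // subr_ge0.
Qed.

Lemma ip_CS f g : ip N f g ^+ 2 <= ip N f f * ip N g g.
Proof.
apply: discriminant_le => [|s]; first exact: ip_ge0.
have := ip_ge0 N (fun y => f y + s * g y); congr (_ <= _).
by rewrite /ip !mulr_sumr -!big_split /=; apply: eq_bigr => x _; ring.
Qed.

(** Log-convexity makes the ratio of consecutive terms nondecreasing; for moments this replaces
    Jensen's inequality for the spectral measure. *)
Lemma log_convex_ge (a : nat -> R) (rho : R) : (forall m, 0 <= a m) ->
  (forall m, a m.+1 ^+ 2 <= a m * a m.+2) -> 0 <= rho -> rho * a 0%N <= a 1%N ->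
  forall m, rho ^+ m * a 0%N <= a m.
Proof.
move=> a0 lc rho0 a1.
have step m : rho * a m <= a m.+1.
  elim: m => // m IH; have := a0 m.+1; rewrite le_eqVlt => /predU1P[<-|am1].
    by rewrite mulr0.
  have am : 0 < a m.
    rewrite lt_neqAle a0 andbT; apply/eqP => am; have := lc m; rewrite -am mul0r.
    by rewrite leNgt exprn_gt0.
  rewrite -(ler_pM2l am); apply: le_trans (lc m); rewrite mulrA [a m * rho]mulrC expr2.
  by rewrite ler_pM2r.
elim=> [|m IH]; first by rewrite mul1r.
by rewrite exprS -mulrA; apply: le_trans (step m); rewrite ler_wpM2l.
Qed.

Lemma ip_iterC c m f g : ip N (iter m (step N c) f) g = ip N f (iter m (step N c) g).
Proof. by elim: m g => // m IH g; rewrite iterS ip_stepC IH -iterSr. Qed.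

Lemma iter_step_lin c m (a b : R) f g x : iter m (step N c) (fun y => a * f y + b * g y) x =
  a * iter m (step N c) f x + b * iter m (step N c) g x.
Proof.
elim: m x => // m IH x; rewrite !iterS -step_lin; exact: eq_step.
Qed.

(** [step N (1 / 2)] is the average of the identity and of [step N 1], which is a contraction, so
    its spectrum is nonnegative. *)
Lemma step_half_psd f : 0 <= ip N (step N (1 / 2) f) f.
Proof.
have K : ip N (step N 1 f) (step N 1 f) <= ip N f f by apply: ip_step_le; rewrite ler01 lexx.
have : 0 <= ip N f f + 2 * ip N (step N 1 f) f + ip N (step N 1 f) (step N 1 f).
  have := ip_ge0 N (fun y => f y + step N 1 f y); congr (_ <= _).
  by rewrite /ip !mulr_sumr -!big_split /=; apply: eq_bigr => x _; ring.
move=> H; have : 0 <= ip N f f + ip N (step N 1 f) f by lra.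
by rewrite !ip_step; lra.
Qed.

Lemma iter_half_psd m f : 0 <= ip N (iter m (step N (1 / 2)) f) f.
Proof.
rewrite -(odd_double_half m) -addnn; set j := m./2.
case: (odd m); last by rewrite add0n iterD ip_iterC ip_ge0.
rewrite addnA iterD ip_iterC add1n iterS -ip_stepC.
exact: step_half_psd.
Qed.

(** The iterates of a nonnegative operator give nonnegative forms; Cauchy-Schwarz for each of them,
    applied to [F] and its image, is the log-convexity of the moments of all orders. *)
Lemma ip_iter_half_ge F m : 0 < ip N F F ->
  (1 - energy N F F / ip N F F / 2) ^+ m * ip N F F <= ip N (iter m (step N (1 / 2)) F) F.
Proof.
move=> F0; pose a m := ip N (iter m (step N (1 / 2)) F) F.
have a1 : a 1%N = (1 - energy N F F / ip N F F / 2) * ip N F F.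
  by rewrite /a /= ip_step; field; rewrite gt_eqF.
apply: (@log_convex_ge a) => [k|k||]; first exact: iter_half_psd.
- apply: discriminant_le => [|s]; first exact: iter_half_psd.
  have := iter_half_psd k (fun y => 1 * F y + s * step N (1 / 2) F y).
  have -> : iter k (step N (1 / 2)) (fun y => 1 * F y + s * step N (1 / 2) F y) =
      (fun y => 1 * iter k (step N (1 / 2)) F y + s * iter k (step N (1 / 2)) (step N (1 / 2) F) y).
    by apply/funext => y; exact: iter_step_lin.
  rewrite ip_lin mul1r -iterSr.
  have E g : ip N g (fun y => 1 * F y + s * step N (1 / 2) F y) = ip N g F + s * ip N (step N (1 / 2) g) F.
    by rewrite ip_stepC /ip mulr_sumr -big_split; apply: eq_bigr => x _ /=; ring.
  by rewrite !E -!iterS /a; congr (_ <= _); ring.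
- have := iter_half_psd 1 F; rewrite -/(a 1%N) a1 pmulr_lge0 //.
- by rewrite a1.
Qed.

(** For general [c] odd moments may be negative. Only even ones, the squared norms of the iterates,
    are used, with ratio the square of [1 - c * la]. *)
Lemma ip_iter_ge c F m : 0 < ip N F F ->
  (1 - c * (energy N F F / ip N F F)) ^+ (m + m) * ip N F F <= ip N (iter (m + m) (step N c) F) F.
Proof.
move=> F0; pose a m := ip N (iter m (step N c) F) (iter m (step N c) F).
rewrite iterD ip_iterC -/(a m) exprD -exprMn -expr2.
have a1 : ip N (step N c F) F = (1 - c * (energy N F F / ip N F F)) * ip N F F.
  by rewrite ip_step; field; rewrite gt_eqF.
apply: (@log_convex_ge a) => [k|k||]; first exact: ip_ge0.
- have := ip_CS (iter k (step N c) F) (iter k.+2 (step N c) F); congr (_ ^+ 2 <= _).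
  by rewrite iterS -ip_stepC.
- exact: sqr_ge0.
- have := ip_CS (step N c F) F; rewrite a1 exprMn -[ip N (step N c F) (step N c F)]/(a 1%N).
  by rewrite [X in _ * X]expr2 mulrA ler_pM2r.
Qed.

End LogConvexity.

(** * From kernels to the network: centred indicators, semigroup, relaxation bounds *)

Section ChainKernels.
Context {R : realType} {n : nat}.
Variables (X : bd_chain R n) (pi : 'rV[R]_n.+1).
Hypothesis irr : irreducible_kernel (bd_kernel X).
Hypothesis st : stationary_distribution (bd_kernel X) pi.
Local Notation K := (bd_kernel X).
Local Notation N := (bd_network irr st).
Implicit Types (A : {set 'I_n.+1}) (x y : 'I_n.+1) (F : nat -> R) (delta T : R).

Lemma mean_bd F : mean N F = \sum_x pi 0 x * F x.
Proof. by rewrite /mean big_mkord /=; apply: eq_bigr => x _; rewrite inord_val. Qed.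

Lemma ip_bd F : ip N F F = ip_mx pi (\col_x F x) (\col_x F x).
Proof. by rewrite /ip /ip_mx big_mkord /=; apply: eq_bigr => x _; rewrite inord_val !mxE. Qed.

Lemma mass_sum (mu : 'rV[R]_n.+1) A : mass mu A = \sum_y mu 0 y * (y \in A)%:R.
Proof.
rewrite /mass big_mkcond; apply: eq_bigr => y _.
by case: (y \in A); rewrite ?mulr1 ?mulr0.
Qed.

Lemma mass_pi A : 0 <= mass pi A <= 1.
Proof.
have p0 := pi_ge0 st; apply/andP; split; first exact: sumr_ge0.
rewrite -(pi_sum st) mass_sum; apply: ler_sum => y _.
by rewrite -[leRHS]mulr1 ler_wpM2l // lern1 leq_b1.
Qed.

(* The indicator of [A], centred and extended to all of [nat]. *)
Definition centered A (y : nat) : R := (inord y \in A)%:R - mass pi A.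

Lemma centered_le1 A (y : nat) : `|centered A y| <= 1.
Proof.
have /andP[m0 m1] := mass_pi A; rewrite ler_norml /centered; apply/andP.
by case: (_ \in A) => /=; split; lra.
Qed.

Lemma mean_centered A : mean N (centered A) = 0.
Proof.
rewrite mean_bd; under eq_bigr => x _ do rewrite /centered inord_val mulrBr.
by rewrite sumrB -mass_sum -mulr_suml (pi_sum st) mul1r subrr.
Qed.

Lemma row_centered (M : 'M[R]_n.+1) x A : row_sums1 M ->
  mass (row x M) A - mass pi A = \sum_y M x y * centered A y.
Proof.
move=> M1; under eq_bigr => y _ do rewrite /centered inord_val mulrBr.
rewrite sumrB -mulr_suml M1 mul1r mass_sum; congr (_ - _).
by apply: eq_bigr => y _; rewrite mxE.
Qed.

Lemma mass_lazy delta m x A : mass (row x (lazy delta K ^+ m)) A - mass pi A =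
  iter m (step N (1 - delta)) (centered A) x.
Proof. by rewrite row_centered; [exact: lazy_pow | exact: (lazy_row_sums1 irr st)]. Qed.

Lemma iter_centered c m (p : nat -> bool) (x : nat) :
  (x <= n)%N -> iter m (step N c) (centered [set y : 'I_n.+1 | p y]%SET) x =
  iter m (step N c) (fun z : nat => (p z)%:R) x - mean N (fun z : nat => (p z)%:R).
Proof.
move=> xn; have mE : mass pi [set y : 'I_n.+1 | p y]%SET = mean N (fun z : nat => (p z)%:R).
  by rewrite mass_sum mean_bd; apply: eq_bigr => y _; rewrite inE.
elim: m x xn => [|m IH] x xn; first by rewrite /= /centered mE inE inordK.
rewrite !iterS addrC -step_addc; apply: eq_step_le => // y yn.
by rewrite IH // addrC.
Qed.

Lemma lazy_half01 : 0 <= (1 / 2 : R) <= 1. Proof. by apply/andP; split; lra. Qed.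

Lemma semigroup_lazy T : semigroup K T = expmx ((2 * T) *: (lazy (1 / 2) K - 1)).
Proof.
rewrite /semigroup; congr expmx; apply/matrixP => x y; rewrite /lazy.
by move: K => Q; rewrite !mxE; field.
Qed.

Section Continuous.
Variable T : R.
Hypothesis T0 : 0 <= T.
Local Notation H := (semigroup K T).
Local Notation P := (lazy (1 / 2) K).

Let s0 : 0 <= 2 * T. Proof. by rewrite mulr_ge0. Qed.
Let P1 k x y : `|(P ^+ k) x y| <= 1. Proof. exact: (lazy_pow_le1 irr st lazy_half01). Qed.

Lemma cvg_semigroup_row x (G : 'I_n.+1 -> R) :
  series (fun m => poisson (2 * T) m * \sum_y (P ^+ m) x y * G y) @ \oo --> \sum_y H x y * G y.
Proof.
have E (Q : 'M[R]_n.+1) : \sum_x' \sum_y (x' == x)%:R * G y * Q x' y = \sum_y Q x y * G y.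
  rewrite (bigD1 x) //= [X in _ + X]big1 ?addr0.
    by apply: eq_bigr => y _; rewrite eqxx mul1r mulrC.
  by move=> x' /negPf ->; rewrite big1 // => y _; rewrite !mul0r.
have := semigroup_functional (C := fun x' y => (x' == x)%:R * G y) s0 P1.
rewrite -semigroup_lazy E.
by under eq_fun do rewrite E.
Qed.

Lemma semigroup_row_sums1 : row_sums1 H.
Proof.
move=> x; have := @cvg_semigroup_row x (fun=> 1).
have -> : (fun m => poisson (2 * T) m * \sum_y (P ^+ m) x y * 1) = poisson (2 * T).
  by apply/funext => m; rewrite -mulr_suml mulr1 (lazy_row_sums1 irr st (1 / 2) m x) mulr1.
move=> /cvg_unique => /(_ _ _ (cvg_poisson (2 * T))) <- //.
by apply: eq_bigr => y _; rewrite mulr1.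
Qed.

Lemma semigroup_reversible : reversible pi H.
Proof.
move=> x y; rewrite semigroup_lazy.
have A (u v : 'I_n.+1) : series (fun m => pi 0 u * (poisson (2 * T) m * (P ^+ m) u v)) @ \oo -->
    pi 0 u * expmx ((2 * T) *: (P - 1)) u v.
  have -> : series (fun m => pi 0 u * (poisson (2 * T) m * (P ^+ m) u v)) =
     (fun k => pi 0 u * series (fun m => poisson (2 * T) m * (P ^+ m) u v) k).
    by apply/funext => k; rewrite /series /= mulr_sumr.
  by apply: cvgM; [exact: cvg_cst | exact: expmx_poisson].
have := A y x.
have -> : (fun m => pi 0 y * (poisson (2 * T) m * (P ^+ m) y x)) =
          (fun m => pi 0 x * (poisson (2 * T) m * (P ^+ m) x y)).
  apply/funext => m; rewrite mulrCA (lazy_pow_reversible st (1 / 2) m y x).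
  exact: mulrCA.
by move=> /cvg_unique => /(_ _ _ (A x y)) ->.
Qed.

Lemma cvg_semigroup_ip F :
  series (fun m => poisson (2 * T) m * ip N (iter m (step N (1 / 2)) F) F) @ \oo -->
  ip_mx pi (H *m \col_x F x) (\col_x F x).
Proof.
have E (Q : 'M[R]_n.+1) : \sum_(x < n.+1) \sum_(y < n.+1) (pi 0 x * (F y * F x)) * Q x y =
    ip_mx pi (Q *m \col_x F x) (\col_x F x).
  rewrite /ip_mx; apply: eq_bigr => x _; rewrite !mxE mulr_suml mulr_sumr.
  by apply: eq_bigr => y _; rewrite mxE; ring.
have := semigroup_functional (C := fun x y : 'I_n.+1 => pi 0 x * (F y * F x)) s0 P1.
rewrite -semigroup_lazy E.
have -> // : (fun m => poisson (2 * T) m * \sum_(x < n.+1) \sum_(y < n.+1) pi 0 x * (F y * F x) * (P ^+ m) x y)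
  = (fun m => poisson (2 * T) m * ip N (iter m (step N (1 / 2)) F) F).
apply/funext => m; congr (_ * _); rewrite E /ip_mx /ip big_mkord; apply: eq_bigr => x _.
rewrite /= inord_val !mxE; congr (_ * (_ * _)).
under eq_bigr => y _ do rewrite mxE.
rewrite (lazy_pow irr st); congr (iter m (step N _) F x); by field.
Qed.

Lemma mass_semigroup x A :
  series (fun m => poisson (2 * T) m * iter m (step N (1 / 2)) (centered A) x) @ \oo -->
  mass (row x H) A - mass pi A.
Proof.
rewrite row_centered; last exact: semigroup_row_sums1.
have := @cvg_semigroup_row x (fun y => centered A y).
have -> // : (fun m => poisson (2 * T) m * \sum_y (P ^+ m) x y * centered A y) =
  (fun m => poisson (2 * T) m * iter m (step N (1 / 2)) (centered A) x).
apply/funext => m; rewrite (lazy_pow irr st); congr (_ * iter m (step N _) _ _); by field.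
Qed.

End Continuous.

(* A rate of contraction in sup norm of order [exp (- 2 k)] forces a relaxation
   time, hence a Hardy constant, at most of order [m / k]. *)
Lemma lazy_tv_gap delta (k : R) m F (v : R) : 0 < delta < 1 -> 0 <= k ->
  mean N F = 0 -> 0 < ip N F F -> energy N F F * v <= 2 * ip N F F -> 0 <= v ->
  max_tv_dist (lazy delta K ^+ m) pi <= expR (- (2 * k)) / 2 ->
  v <= 4 \/ k * v <= 2 * m%:R.
Proof.
move=> /andP[d0 d1] k0 F0 F1 Ev v0 tvm.
have c01 : 0 <= delta <= 1 by rewrite !ltW.
pose c := 1 - delta; pose la := energy N F F / ip N F F.
have la0 : 0 <= la by rewrite divr_ge0 ?energy_ge0 // ltW.
have lav : la * v <= 2 by rewrite /la mulrAC ler_pdivrMr.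
(* A large [la] gives no useful lower bound for the powers of [1 - c * la], but then [la * v <= 2]
   bounds [v] directly. *)
have [cla|cla] := leP (c * la) (1 / 2); last first.
  left; have cle : c <= 1 by rewrite /c; lra.
  have la1 : 1 / 2 < la by apply: (lt_le_trans cla); rewrite ler_piMl.
  nra.
right.
pose e := expR (- (2 * k)); have e0 : 0 < e by exact: expR_gt0.
have CM : contracts pi (lazy delta K ^+ m) e.
  have -> : e = 2 * (e / 2) by field.
  by apply: tv_contracts => //; [exact: (lazy_row_sums1 irr st) | exact: (pi_sum st)].
have rP := lazy_pow_reversible st delta m.
have rs := lazy_row_sums1 irr st delta m.
have CMM := contracts_mul (ltW e0) rP rs CM CM.
have F0' : mean_mx pi (\col_x F x) = 0.
  by rewrite -F0 mean_bd; apply: eq_bigr => x _; rewrite mxE.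
have := contracts_ip (pi_ge0 st) (pi_sum st) (reversible_mul rP) (row_sums1_mul rs rs)
  (mulr_gt0 e0 e0) CMM F0'.
rewrite -ip_bd.
have -> : ip_mx pi (lazy delta K ^+ m *m lazy delta K ^+ m *m \col_x F x) (\col_x F x) =
  ip N (iter (m + m) (step N c) F) F.
  rewrite -[lazy delta K ^+ m *m _]exprD /ip /ip_mx big_mkord; apply: eq_bigr => x _.
  rewrite /= inord_val !mxE; congr (_ * (_ * _)).
  by under eq_bigr => y _ do rewrite mxE; rewrite (lazy_pow irr st).
move=> H; have := le_trans (ip_iter_ge c m F1) H; rewrite ler_pM2r // -/la.
have -> : e * e = expR (- (4 * k)) by rewrite /e -expRD; congr expR; ring.
(* For [0 <= x <= 1 / 2] one has [(1 - x) * (1 + 2 * x) >= 1]. *)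
have low : expR (- (2 * (c * la))) <= 1 - c * la.
  have cl0 : 0 <= c * la by rewrite mulr_ge0 // subr_ge0 ltW.
  have h1 : 1 + 2 * (c * la) <= expR (2 * (c * la)) by exact: expR_ge1Dx.
  rewrite expRN -[leLHS]mul1r ler_pdivrMr ?expR_gt0 //.
  have p : 0 <= 1 - c * la by lra.
  have := ler_wpM2l p h1; nra.
have low2 : expR (- (2 * (c * la))) ^+ (m + m) <= (1 - c * la) ^+ (m + m).
  by rewrite lerXn2r ?nnegrE ?expR_ge0 //; lra.
move/(le_trans low2); rewrite -expRM_natl ler_expR natrD => H2.
have H3 : k <= c * la * m%:R by lra.
have H4 : c * la * m%:R * v <= 2 * m%:R.
  have c1 : c <= 1 by rewrite /c; lra.
  have : c * (la * v) <= 2.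
    by apply: le_trans lav; rewrite ler_piMl // mulr_ge0.
  move/(ler_wpM2r (ler0n R m)); lra.
by apply: le_trans H4; rewrite ler_wpM2r.
Qed.

(** No exceptional case is needed: the Poisson average of the geometric lower bound is
    [expR (- T * la)] for every value of [la]. *)
Lemma semigroup_tv_gap (k : R) T F (v : R) : 0 <= T -> 0 <= k ->
  mean N F = 0 -> 0 < ip N F F -> energy N F F * v <= 2 * ip N F F -> 0 <= v ->
  max_tv_dist (semigroup K T) pi <= expR (- k) / 2 -> k * v <= 2 * T.
Proof.
move=> T0 k0 F0 F1 Ev v0 tvm.
pose la := energy N F F / ip N F F.
have la0 : 0 <= la by rewrite divr_ge0 ?energy_ge0 // ltW.
have lav : la * v <= 2 by rewrite /la mulrAC ler_pdivrMr.
pose e := expR (- k); have e0 : 0 < e by exact: expR_gt0.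
have rs := semigroup_row_sums1 T0.
have CM : contracts pi (semigroup K T) e.
  have -> : e = 2 * (e / 2) by field.
  by apply: tv_contracts => //; exact: (pi_sum st).
have F0' : mean_mx pi (\col_x F x) = 0.
  by rewrite -F0 mean_bd; apply: eq_bigr => x _; rewrite mxE.
have := contracts_ip (pi_ge0 st) (pi_sum st) (semigroup_reversible T0) rs e0 CM F0'.
rewrite -ip_bd => H.
have s0 : 0 <= 2 * T by rewrite mulr_ge0.
have := poisson_geometric_ge s0 (fun m => ip_iter_half_ge m F1) (cvg_semigroup_ip T0 (F := F)).
move=> /= /le_trans => /(_ _ H); rewrite ler_pM2r // /e ler_expR -/la => H2.
have H3 : k <= T * la by lra.
have H4 : T * la * v <= 2 * T.
  by rewrite -mulrA mulrC ler_wpM2r.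
by apply: le_trans H4; rewrite ler_wpM2r.
Qed.

End ChainKernels.

(** * Mixing times *)

Section PoissonConcentration.
Context {R : realType}.
Implicit Types (b : nat -> R) (s B : R).

(** Chebyshev's inequality in integrated form: [b] lies below the parabola
    [e + (m - s) ^+ 2 / (s - m1) ^+ 2], and the Poisson variance is [s]. *)
Lemma poisson_upper b s (m1 e : R) B : 0 <= s -> m1 < s -> (forall m, b m <= 1) ->
  (forall m, m1 <= m%:R -> b m <= e) -> 0 <= e ->
  series (fun m => poisson s m * b m) @ \oo --> B -> B <= e + s / (s - m1) ^+ 2.
Proof.
move=> s0 ms b1 be e0 cv; have d0 : 0 < (s - m1) ^+ 2 by rewrite exprn_gt0 // subr_gt0.
rewrite [s / _]mulrC; apply: (poisson_mean_le s0 _ _ cv); first by rewrite invr_ge0 ltW.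
move=> m; case: (lerP m1 m%:R) => mm.
  by apply: le_trans (be m mm) _; rewrite lerDl mulr_ge0 ?sqr_ge0 // invr_ge0 ltW.
apply: le_trans (b1 m) _; apply: ler_wpDl => //.
rewrite mulrC ler_pdivlMr // mul1r -[leRHS]sqrrN opprB.
by rewrite ler_sqr ?nnegrE; lra.
Qed.

Lemma poisson_lower b s (m1 y : R) B : 0 <= s -> s < m1 -> (forall m, - 1 <= b m) ->
  (forall m, m%:R <= m1 -> y <= b m) -> y <= 1 ->
  series (fun m => poisson s m * b m) @ \oo --> B -> y - 2 * (s / (m1 - s) ^+ 2) <= B.
Proof.
move=> s0 ms b1 be y1 cv; have d0 : 0 < (m1 - s) ^+ 2 by rewrite exprn_gt0 // subr_gt0.
have -> : 2 * (s / (m1 - s) ^+ 2) = 2 / (m1 - s) ^+ 2 * s by ring.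
apply: (poisson_mean_ge s0 _ _ cv); first by rewrite divr_ge0 // ltW.
move=> m; case: (lerP m%:R m1) => mm.
  by apply: le_trans (be m mm); rewrite gerBl mulr_ge0 ?sqr_ge0 // divr_ge0 // ltW.
apply: le_trans (b1 m).
have : 1 <= (m%:R - s) ^+ 2 / (m1 - s) ^+ 2.
  by rewrite ler_pdivlMr // mul1r ler_sqr ?nnegrE; lra.
have -> : 2 / (m1 - s) ^+ 2 * (m%:R - s) ^+ 2 = 2 * ((m%:R - s) ^+ 2 / (m1 - s) ^+ 2) by ring.
lra.
Qed.

End PoissonConcentration.

Section Thresholds.
Context {R : realType}.
Implicit Types (delta eps : R).

Definition irreducible_with_median n (X : bd_chain R n) (pi : 'rV[R]_n.+1) (i : 'I_n.+1) : Prop :=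
  [/\ (0 < n)%N, irreducible_kernel (bd_kernel X),
      stationary_distribution (bd_kernel X) pi & median_state pi i].

Local Notation width X pi i := (Num.sqrt (bd_ell X pi i * bd_t X pi i)).

Lemma width_bounds n (X : bd_chain R n) pi i : irreducible_with_median X pi i ->
  [/\ 1 <= bd_ell X pi i, bd_ell X pi i <= width X pi i, width X pi i <= bd_t X pi i
    & width X pi i ^+ 2 = bd_ell X pi i * bd_t X pi i].
Proof.
move=> [n0 irr st med]; have l1 := bd_ell_ge1 irr st med n0; have lt := bd_ell_le_t irr st med.
have t0 : 0 <= bd_t X pi i by lra.
have l0 : 0 <= bd_ell X pi i by lra.
have s2 : width X pi i ^+ 2 = bd_ell X pi i * bd_t X pi i by rewrite sqr_sqrtr // mulr_ge0.
split => //; rewrite -ler_sqr ?nnegrE ?sqrtr_ge0 // s2 expr2.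
  by rewrite ler_wpM2l.
by rewrite ler_wpM2r.
Qed.

Lemma lazy_upper delta eps : 0 < delta < 1 -> 0 < eps -> exists2 A : R, 0 < A &
  forall n (X : bd_chain R n) pi i m, irreducible_with_median X pi i ->
    bd_t X pi i / (1 - delta) + A * width X pi i <= m%:R ->
    max_tv_dist (lazy delta (bd_kernel X) ^+ m) pi <= eps.
Proof.
move=> /andP[d0 d1] eps0; have c01 : 0 < 1 - delta < 1 by apply/andP; split; lra.
have [A A0 HA] := mixing_upper c01 eps0; exists A => // n X pi i m good Hm.
have [l1 lw wt _] := width_bounds good; case: good => n0 irr st med.
apply: max_tv_le => x B; rewrite (mass_lazy irr st).
apply: le_trans (ler_norm _) _.
apply: (HA (bd_network irr st) i _ _ _ _ _ (bd_median_bounds irr st med)) => //.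
- exact: le_trans wt.
- by move=> y _; exact: (centered_le1 st).
- exact: (mean_centered irr st).
- by rewrite /= -ltnS.
Qed.

Lemma cont_upper eps : 0 < eps -> exists2 A : R, 0 < A &
  forall n (X : bd_chain R n) pi i T, irreducible_with_median X pi i ->
    bd_t X pi i + A * width X pi i <= T ->
    max_tv_dist (semigroup (bd_kernel X) T) pi <= eps.
Proof.
move=> eps0; have c01 : 0 < (1 / 2 : R) < 1 by apply/andP; split; lra.
have e2 : 0 < eps / 2 by rewrite divr_gt0.
have [A1 A10 HA] := mixing_upper c01 e2.
(* With [w] the width and [d >= D * w] the distance from the discrete threshold to the Poisson mean,
   that mean [d + 2 * t + A1 * w] is at most [(3 + A1) * w * d], since [1 <= w] and [t <= w ^+ 2].
   This [D] brings it below [eps / 2 * d ^+ 2], however large [T] is. *)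
pose D := 1 + 4 * (3 + A1) / eps.
have D1 : 0 < 4 * (3 + A1) / eps by rewrite divr_gt0 // mulr_gt0 //; lra.
have Deps : 3 + A1 <= eps / 2 * D.
  have -> : eps / 2 * D = eps / 2 + 2 * (3 + A1) by rewrite /D; field; rewrite gt_eqF.
  lra.
have D1' : 1 <= D by rewrite /D lerDl ltW.
clearbody D.
exists (D + A1); first by lra.
move=> n X pi i T good HT.
have [l1 lw wt w2] := width_bounds good; case: good => n0 irr st med.
have T0 : 0 <= T.
  apply: le_trans HT; have : 0 <= (D + A1) * width X pi i by rewrite mulr_ge0 ?sqrtr_ge0 //; lra.
  lra.
apply: max_tv_le => x B.
have Hb := fun m => HA _ _ _ _ (centered pi B) m x (bd_median_bounds irr st med) l1 (le_trans lw wt)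
  (fun y _ => centered_le1 st B y) (mean_centered irr st B) (ltn_ord x).
have B1 m : iter m (step (bd_network irr st) (1 / 2)) (centered pi B) x <= 1.
  apply: le_trans (ler_norm _) _; apply: norm_iter_step_le1; first exact: lazy_half01.
    by move=> y _; exact: (centered_le1 st).
  by rewrite /= -ltnS.
have cv := mass_semigroup irr st T0 (x := x) (A := B).
have Tlow : 2 * bd_t X pi i + A1 * width X pi i < 2 * T.
  have : 0 < width X pi i by lra.
  by nra.
have t2 : bd_t X pi i / (1 / 2) = 2 * bd_t X pi i by field.
apply: le_trans (poisson_upper (e := eps / 2) _ Tlow B1 _ _ cv) _.
- by rewrite mulr_ge0.
- by move=> m Hm; apply: le_trans (ler_norm _) _; apply: Hb; rewrite t2.
- exact: ltW.
rewrite [leRHS](splitr eps) lerD2l ler_pdivrMr; last by rewrite exprn_gt0 // subr_gt0.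
move: (bd_t X pi i) (bd_ell X pi i) (width X pi i) l1 lw wt w2 HT Tlow => t l w l1 lw wt w2 HT Tlow.
clear -l1 lw wt w2 HT Tlow Deps D1' A10 e2.
set q := eps / 2 in Deps e2 *; clearbody q.
set d := 2 * T - (2 * t + A1 * w).
have dD : D * w <= d by rewrite /d; nra.
have dE : 2 * T = d + (2 * t + A1 * w) by rewrite /d; ring.
rewrite dE; clearbody d; clear dE HT Tlow.
have w1 : 1 <= w by lra.
have w0 : 0 <= w by lra.
have tw : t <= w * w by rewrite -expr2 w2 ler_peMl //; lra.
have dw : w <= d by apply: le_trans dD; rewrite ler_peMl.
have d0 : 0 <= d by lra.
have h1 : (3 + A1) * w <= q * d.
  apply: le_trans (ler_wpM2l (ltW e2) dD); rewrite mulrA ler_wpM2r //.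
have h2 : (3 + A1) * w * d <= q * d ^+ 2 by rewrite expr2 mulrA ler_wpM2r.
apply: le_trans h2.
have h3 : w * w <= w * d by rewrite ler_wpM2l.
have h4 : d <= w * d by rewrite ler_peMl.
have h5 : A1 * w <= A1 * t by rewrite ler_pM2l.
have h6 : A1 * t <= A1 * (w * d) by rewrite ler_pM2l //; lra.
lra.
Qed.

Lemma lazy_lower delta eps : 0 < delta < 1 -> 0 < eps < 1 -> exists2 A : R, 0 < A &
  forall n (X : bd_chain R n) pi i m, irreducible_with_median X pi i ->
    m%:R <= bd_t X pi i / (1 - delta) - A * width X pi i ->
    eps < max_tv_dist (lazy delta (bd_kernel X) ^+ m) pi.
Proof.
move=> /andP[d0 d1] /andP[e0 e1]; have c01 : 0 < 1 - delta < 1 by apply/andP; split; lra.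
(* The distinguishing set yields a distance of at least [1 - 2 * eta = (1 + eps) / 2], which exceeds
   [eps]. *)
pose eta := (1 - eps) / 4.
have eta0 : 0 < eta by rewrite divr_gt0 // subr_gt0.
have eta2 : eta <= 1 / 2 by rewrite /eta; lra.
have [A A0 HA] := cutoff_lower c01 eta0 eta2; exists A => // n X pi i m good Hm.
have [l1 lw wt _] := width_bounds good; case: good => n0 irr st med.
have [p [x [xn mp Hp]]] := HA _ _ _ _ (bd_median_bounds irr st med) l1 (le_trans lw wt) (bd_t_attained irr st i).
have := max_tv_ge (lazy delta (bd_kernel X) ^+ m) pi (Ordinal (xn : (x < n.+1)%N)) [set y : 'I_n.+1 | p y]%SET.
rewrite (mass_lazy irr st) (iter_centered irr st) //=; have := Hp m Hm.
move: mp; rewrite /eta; lra.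
Qed.

Lemma cont_lower eps : 0 < eps < 1 -> exists2 A : R, 0 < A &
  forall n (X : bd_chain R n) pi i T, irreducible_with_median X pi i -> 0 <= T ->
    T <= bd_t X pi i - A * width X pi i ->
    eps < max_tv_dist (semigroup (bd_kernel X) T) pi.
Proof.
move=> /andP[e0 e1]; have c01 : 0 < (1 / 2 : R) < 1 by apply/andP; split; lra.
pose eta := (1 - eps) / 8.
have eta0 : 0 < eta by rewrite divr_gt0 // subr_gt0.
have eta2 : eta <= 1 / 2 by rewrite /eta; lra.
have [A1 A10 HA] := cutoff_lower c01 eta0 eta2.
(* The Poisson loss is [2 * (2 * T) / d ^+ 2] with [T <= t <= w ^+ 2] and [d >= D * w]; this [D]
   makes it at most [(1 - eps) / 4]. *)
pose D := 1 + 16 / (1 - eps).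
have q0 : 0 < (1 - eps) / 4 by rewrite divr_gt0 // subr_gt0.
have D1 : 0 < 16 / (1 - eps) by rewrite divr_gt0 // subr_gt0.
have Deps : 4 <= (1 - eps) / 4 * D.
  have -> : (1 - eps) / 4 * D = (1 - eps) / 4 + 4 by rewrite /D; field; rewrite gt_eqF // subr_gt0.
  lra.
have D1' : 1 <= D by rewrite /D lerDl ltW.
clearbody D.
exists (D + A1); first by lra.
move=> n X pi i T good T0 HT.
have [l1 lw wt w2] := width_bounds good; case: good => n0 irr st med.
have [p [x [xn mp Hp]]] := HA _ _ _ _ (bd_median_bounds irr st med) l1 (le_trans lw wt) (bd_t_attained irr st i).
have xn' : (x < n.+1)%N := xn.
have := max_tv_ge (semigroup (bd_kernel X) T) pi (Ordinal xn') [set y : 'I_n.+1 | p y]%SET.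
apply: lt_le_trans.
have cv := mass_semigroup irr st T0 (x := Ordinal xn') (A := [set y : 'I_n.+1 | p y]%SET).
have Tlow : 2 * T < 2 * bd_t X pi i - A1 * width X pi i.
  have : 0 < width X pi i by lra.
  by nra.
have t2 : bd_t X pi i / (1 / 2) = 2 * bd_t X pi i by field.
apply: lt_le_trans (poisson_lower (y := 1 - 2 * eta) _ Tlow _ _ _ cv); last first.
- by rewrite gerBl mulr_ge0 // ltW.
- move=> m Hm; rewrite (iter_centered irr st) //=.
  by have := Hp m; rewrite t2 => /(_ Hm); lra.
- move=> m; rewrite lerNl; apply: le_trans (ler_norm _) _; rewrite normrN.
  apply: norm_iter_step_le1 => //; first exact: lazy_half01.
  by move=> y _; exact: (centered_le1 st).
- by rewrite mulr_ge0.
have -> : eps = 1 - 2 * eta - 3 * ((1 - eps) / 4) by rewrite /eta; field.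
rewrite ltrD2l ltrN2.
apply: le_lt_trans (_ : (1 - eps) / 4 < _); last by lra.
move: (bd_t X pi i) (bd_ell X pi i) (width X pi i) l1 lw wt w2 HT Tlow => t l w l1 lw wt w2 HT Tlow.
rewrite mulrA ler_pdivrMr; last by rewrite exprn_gt0 // subr_gt0.
clear -l1 lw wt w2 HT Tlow Deps D1' A10 q0 T0.
set q := (1 - eps) / 4 in Deps q0 *; clearbody q.
set d := (2 * t - A1 * w) - 2 * T.
have w0 : 0 <= w by lra.
have dD : D * w <= d by rewrite /d; nra.
have Tt : T <= t.
  have : 0 <= (D + A1) * w by rewrite mulr_ge0 //; lra.
  lra.
clearbody d; clear HT Tlow.
have tw : t <= w * w by rewrite -expr2 w2 ler_peMl //; lra.
have dw : w <= d by apply: le_trans dD; rewrite ler_peMl.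
have h1 : 4 * w <= q * d.
  by apply: le_trans (ler_wpM2l (ltW q0) dD); rewrite mulrA ler_wpM2r.
have h2 : 4 * w * w <= q * d ^+ 2.
  rewrite expr2 mulrA; apply: ler_pM => //; first by rewrite mulr_ge0.
lra.
Qed.

Lemma lazy_lower_half delta eps n (X : bd_chain R n) pi i m : 0 < delta < 1 ->
  irreducible_with_median X pi i ->
  m%:R * (1 - delta) < (1 / 2 - eps) * bd_t X pi i ->
  eps < max_tv_dist (lazy delta (bd_kernel X) ^+ m) pi.
Proof.
move=> /andP[d0 d1] good Hm; have c01 : 0 < 1 - delta < 1 by apply/andP; split; lra.
have [l1 lw wt w2] := width_bounds good; case: good => n0 irr st med.
have t0 : 0 < bd_t X pi i by lra.
have [p [x [xn mp Hp]]] := hit_lower c01 (bd_median_bounds irr st med) t0 (bd_t_attained irr st i).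
have := max_tv_ge (lazy delta (bd_kernel X) ^+ m) pi (Ordinal (xn : (x < n.+1)%N)) [set y : 'I_n.+1 | p y]%SET.
rewrite (mass_lazy irr st) (iter_centered irr st) //=; have := Hp m.
have : m%:R * (1 - delta) / bd_t X pi i < 1 / 2 - eps by rewrite ltr_pdivrMr.
lra.
Qed.

Lemma cont_lower_half eps n (X : bd_chain R n) pi i T : 0 <= T ->
  irreducible_with_median X pi i ->
  3 * T + 1 / 2 < (1 - 2 * eps) * bd_t X pi i ->
  eps < max_tv_dist (semigroup (bd_kernel X) T) pi.
Proof.
move=> T0 good HT; have c01 : 0 < (1 / 2 : R) < 1 by apply/andP; split; lra.
have [l1 lw wt w2] := width_bounds good; case: good => n0 irr st med.
have t0 : 0 < bd_t X pi i by lra.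
have [p [x [xn mp Hp]]] := hit_lower c01 (bd_median_bounds irr st med) t0 (bd_t_attained irr st i).
have xn' : (x < n.+1)%N := xn.
have := max_tv_ge (semigroup (bd_kernel X) T) pi (Ordinal xn') [set y : 'I_n.+1 | p y]%SET.
apply: lt_le_trans.
have cv := mass_semigroup irr st T0 (x := Ordinal xn') (A := [set y : 'I_n.+1 | p y]%SET).
have s0 : 0 <= 2 * T by rewrite mulr_ge0.
set t := bd_t X pi i in HT t0 Hp.
have tV : 0 < t^-1 by rewrite invr_gt0.
have k0 : 0 <= t^-1 / 4 by rewrite divr_ge0 // ltW.
apply: lt_le_trans (poisson_mean_ge (y := 1 / 2 - t^-1 * (2 * T + 1 / 2) / 2) s0 k0 _ cv).
  have : t^-1 * (3 * T + 1 / 2) < 1 - 2 * eps by rewrite mulrC ltr_pdivrMr.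
  lra.
move=> m; rewrite (iter_centered irr st) //=; have := Hp m.
have -> : m%:R * (1 / 2) / t = t^-1 * m%:R / 2 by ring.
(* The averaging lemma takes quadratic minorants, so [m] is bounded by
   [2 * T + 1 / 2 + (m - 2 * T) ^+ 2 / 2]. The Poisson variance [2 * T] then adds [T], whence
   [3 * T + 1 / 2] in the hypothesis. *)
have : t^-1 * m%:R <= t^-1 * (2 * T + 1 / 2 + (m%:R - 2 * T) ^+ 2 / 2).
  by rewrite ler_pM2l //; have := sqr_ge0 (m%:R - 2 * T - 1); nra.
lra.
Qed.

Lemma lazy_gap delta (k : R) n (X : bd_chain R n) pi i m : 0 < delta < 1 -> 0 < k ->
  irreducible_with_median X pi i ->
  max_tv_dist (lazy delta (bd_kernel X) ^+ m) pi <= expR (- (2 * k)) / 2 ->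
  bd_ell X pi i <= Num.max 4 (2 * m%:R / k).
Proof.
move=> d01 k0 [n0 irr st med] tvm; have mb := bd_median_bounds irr st med.
have ni := mb_le mb.
have key F v : mean (bd_network irr st) F = 0 -> 0 < ip (bd_network irr st) F F ->
    energy (bd_network irr st) F F * v <= 2 * ip (bd_network irr st) F F -> 0 <= v ->
    v <= Num.max 4 (2 * m%:R / k).
  move=> F0 F1 F2 v0; rewrite le_max.
  have [->//|kv] := lazy_tv_gap d01 (ltW k0) F0 F1 F2 v0 tvm.
  by rewrite ler_pdivlMr // [v * k]mulrC kv orbT.
apply: (bd_ell_leP (irr := irr) (st := st)); first by rewrite le_max ler0n.
- move=> j ji; have [F [F0 F1 F2]] := test_function_left mb ji; apply: (key F) => //.
  by rewrite mulr_ge0 ?res_ge0 // ltW // lmass_gt0 // (leq_trans (ltnW ji)).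
- move=> j ij; have [F [F0 F1 F2]] := test_function_right mb ij; apply: (key F) => //.
  by case/andP: ij => _ jn; rewrite mulr_ge0 ?res_ge0 // ltW // rmass_gt0.
Qed.

Lemma cont_gap (k : R) n (X : bd_chain R n) pi i T : 0 <= T -> 0 < k ->
  irreducible_with_median X pi i ->
  max_tv_dist (semigroup (bd_kernel X) T) pi <= expR (- k) / 2 ->
  bd_ell X pi i <= 2 * T / k.
Proof.
move=> T0 k0 [n0 irr st med] tvm; have mb := bd_median_bounds irr st med.
have ni := mb_le mb.
have key F v : mean (bd_network irr st) F = 0 -> 0 < ip (bd_network irr st) F F ->
    energy (bd_network irr st) F F * v <= 2 * ip (bd_network irr st) F F -> 0 <= v ->
    v <= 2 * T / k.
  move=> F0 F1 F2 v0; rewrite ler_pdivlMr // [v * k]mulrC.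
  exact: (semigroup_tv_gap T0 (ltW k0) F0 F1 F2 v0 tvm).
apply: (bd_ell_leP (irr := irr) (st := st)); first by rewrite divr_ge0 ?mulr_ge0 // ltW.
- move=> j ji; have [F [F0 F1 F2]] := test_function_left mb ji; apply: (key F) => //.
  by rewrite mulr_ge0 ?res_ge0 // ltW // lmass_gt0 // (leq_trans (ltnW ji)).
- move=> j ij; have [F [F0 F1 F2]] := test_function_right mb ij; apply: (key F) => //.
  by case/andP: ij => _ jn; rewrite mulr_ge0 ?res_ge0 // ltW // rmass_gt0.
Qed.

End Thresholds.

Section MixingTimes.
Context {R : realType}.
Implicit Types (delta eps : R).
Local Notation width X pi i := (Num.sqrt (bd_ell X pi i * bd_t X pi i)).

Lemma cont_set_nonempty n (X : bd_chain R n) pi i eps : irreducible_with_median X pi i -> 0 < eps ->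
  [set T : R | 0 <= T /\ max_tv_dist (semigroup (bd_kernel X) T) pi <= eps] !=set0.
Proof.
move=> good eps0; have [A A0 HA] := cont_upper eps0; have [l1 lw wt _] := width_bounds good.
exists (bd_t X pi i + A * width X pi i); split; last exact: (HA _ _ _ _ _ good).
by rewrite addr_ge0 ?mulr_ge0 ?sqrtr_ge0 //; lra.
Qed.

Lemma tv_mixing_cont_ge n (X : bd_chain R n) pi i eps x : irreducible_with_median X pi i -> 0 < eps ->
  (forall T, 0 <= T -> max_tv_dist (semigroup (bd_kernel X) T) pi <= eps -> x <= T) ->
  x <= tv_mixing_cont (bd_kernel X) pi eps.
Proof.
move=> good eps0 H; apply: lb_le_inf; first exact: (cont_set_nonempty good).
by move=> T [T0 HT]; exact: H.
Qed.

Lemma tv_mixing_cont_le n (X : bd_chain R n) pi eps x : 0 <= x ->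
  max_tv_dist (semigroup (bd_kernel X) x) pi <= eps -> tv_mixing_cont (bd_kernel X) pi eps <= x.
Proof. by move=> x0 H; apply: ge_inf; [exists 0 => T [] | split]. Qed.

Lemma lazy_upper_nat n (X : bd_chain R n) pi i delta (A eps : R) : 0 < delta < 1 -> 0 < A ->
  irreducible_with_median X pi i ->
  (forall m, bd_t X pi i / (1 - delta) + A * width X pi i <= m%:R ->
    max_tv_dist (lazy delta (bd_kernel X) ^+ m) pi <= eps) ->
  exists2 m, m%:R <= bd_t X pi i / (1 - delta) + A * width X pi i + 1 &
    max_tv_dist (lazy delta (bd_kernel X) ^+ m) pi <= eps.
Proof.
move=> /andP[d0 d1] A0 good HA; have [l1 lw wt _] := width_bounds good.
set x := _ + A * _ in HA *.
have x0 : 0 <= x.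
  by rewrite /x addr_ge0 ?mulr_ge0 ?sqrtr_ge0 ?invr_ge0 //; lra.
have /andP[h1 h2] := truncn_itv x0.
exists (Num.truncn x).+1; first by rewrite -natr1 lerD2r.
by apply: HA; exact: ltW.
Qed.

Lemma lazy_set_nonempty n (X : bd_chain R n) pi i delta eps : 0 < delta < 1 ->
  irreducible_with_median X pi i -> 0 < eps ->
  [set (m%:R : R) | m in [set m : nat | max_tv_dist (lazy delta (bd_kernel X) ^+ m) pi <= eps]] !=set0.
Proof.
move=> d01 good eps0; have [A A0 HA] := lazy_upper d01 eps0.
have [m _ Hm] := lazy_upper_nat d01 A0 good (fun m => HA _ _ _ _ m good).
by exists m%:R, m.
Qed.

Lemma tv_mixing_lazy_ge n (X : bd_chain R n) pi i delta eps x : 0 < delta < 1 ->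
  irreducible_with_median X pi i -> 0 < eps ->
  (forall m, max_tv_dist (lazy delta (bd_kernel X) ^+ m) pi <= eps -> x <= m%:R) ->
  x <= tv_mixing_lazy delta (bd_kernel X) pi eps.
Proof.
move=> d01 good eps0 H; apply: lb_le_inf; first exact: (lazy_set_nonempty d01 good).
by move=> _ [m Hm <-]; exact: H.
Qed.

Lemma tv_mixing_lazy_le n (X : bd_chain R n) pi delta eps m :
  max_tv_dist (lazy delta (bd_kernel X) ^+ m) pi <= eps ->
  tv_mixing_lazy delta (bd_kernel X) pi eps <= m%:R.
Proof. by move=> H; apply: ge_inf; [exists 0 => _ [k _ <-] | exists m]. Qed.

Lemma tv_mixing_cont_near eps : 0 < eps < 1 -> exists2 A : R, 0 < A &
  forall n (X : bd_chain R n) pi i, irreducible_with_median X pi i ->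
    `|tv_mixing_cont (bd_kernel X) pi eps - bd_t X pi i| <= A * width X pi i.
Proof.
move=> /andP[e0 e1]; have [A A0 HA] := cont_upper e0.
have [B B0 HB] := cont_lower (introT andP (conj e0 e1)).
exists (A + B); first exact: addr_gt0.
move=> n X pi i good; have [l1 lw wt _] := width_bounds good.
have w0 : 0 <= width X pi i by rewrite sqrtr_ge0.
have Aw : 0 <= A * width X pi i by rewrite mulr_ge0 // ltW.
have Bw : 0 <= B * width X pi i by rewrite mulr_ge0 // ltW.
have U : tv_mixing_cont (bd_kernel X) pi eps <= bd_t X pi i + A * width X pi i.
  by apply: tv_mixing_cont_le; [lra | exact: (HA _ _ _ _ _ good)].
have L : bd_t X pi i - B * width X pi i <= tv_mixing_cont (bd_kernel X) pi eps.
  apply: (tv_mixing_cont_ge good e0) => T T0 HT; rewrite leNgt; apply/negP => /ltW Tl.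
  by have := HB _ _ _ _ _ good T0 Tl; rewrite ltNge HT.
by rewrite ler_norml mulrDl; apply/andP; split; lra.
Qed.

Lemma tv_mixing_lazy_near delta eps : 0 < delta < 1 -> 0 < eps < 1 -> exists2 A : R, 0 < A &
  forall n (X : bd_chain R n) pi i, irreducible_with_median X pi i ->
    `|tv_mixing_lazy delta (bd_kernel X) pi eps - bd_t X pi i / (1 - delta)| <= A * width X pi i.
Proof.
move=> d01 /andP[e0 e1]; have [A A0 HA] := lazy_upper d01 e0.
have [B B0 HB] := lazy_lower d01 (introT andP (conj e0 e1)).
exists (A + 1 + B); first by rewrite !addr_gt0.
move=> n X pi i good; have [l1 lw wt _] := width_bounds good.
have w0 : 1 <= width X pi i by lra.
have Aw : 0 <= A * width X pi i by rewrite mulr_ge0 //; lra.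
have Bw : 0 <= B * width X pi i by rewrite mulr_ge0 //; lra.
have [m Hm1 Hm2] := lazy_upper_nat d01 A0 good (fun m => HA _ _ _ _ m good).
have U : tv_mixing_lazy delta (bd_kernel X) pi eps <= m%:R by exact: tv_mixing_lazy_le.
have L : bd_t X pi i / (1 - delta) - B * width X pi i <= tv_mixing_lazy delta (bd_kernel X) pi eps.
  apply: (tv_mixing_lazy_ge d01 good e0) => k Hk; rewrite leNgt; apply/negP => /ltW kl.
  by have := HB _ _ _ _ _ good kl; rewrite ltNge Hk.
by rewrite ler_norml !mulrDl mul1r; apply/andP; split; lra.
Qed.

Lemma tv_mixing_cont_order eps : 0 < eps < 1 / 2 -> exists2 C : R, 1 < C &
  forall n (X : bd_chain R n) pi i, irreducible_with_median X pi i -> C <= n%:R ->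
    C^-1 * bd_t X pi i <= tv_mixing_cont (bd_kernel X) pi eps <= C * bd_t X pi i.
Proof.
move=> /andP[e0 e1]; have e01 : 0 < eps < 1 by rewrite e0 /=; lra.
have [A A0 HA] := tv_mixing_cont_near e01.
pose a := 1 / 2 - eps; have a0 : 0 < a by rewrite /a; lra.
have ai : 0 < a^-1 by rewrite invr_gt0.
exists (1 + A + 3 * a^-1); first by rewrite -addrA ltrDl addr_gt0 // mulr_gt0.
move=> n X pi i good Cn; have [l1 lw wt _] := width_bounds good.
have := HA _ _ _ _ good; rewrite ler_norml => /andP[_ U].
have t0 : 0 < bd_t X pi i by lra.
have tn : n%:R / 2 <= bd_t X pi i by case: good => n0 irr st med; exact: (bd_t_ge irr st med).
(* This is where [n] must be large: [t >= n / 2] absorbs the additive 1/2 of [cont_lower_half]. *)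
have at1 : 3 / 2 <= a * bd_t X pi i.
  have : 3 * a^-1 <= 2 * bd_t X pi i by lra.
  by move/(ler_wpM2l (ltW a0)); rewrite mulrCA divff ?gt_eqF //; lra.
apply/andP; split; last first.
  have := ler_wpM2l (ltW A0) wt.
  have : 0 <= a^-1 * bd_t X pi i by rewrite mulr_ge0 // ltW.
  lra.
have CV : (1 + A + 3 * a^-1)^-1 * bd_t X pi i <= a / 3 * bd_t X pi i.
  rewrite ler_pM2r // -[a / 3]invrK lef_pV2 ?posrE ?invr_gt0 ?divr_gt0 //.
    by rewrite invf_div; lra.
  by rewrite !addr_gt0 // mulr_gt0.
apply: (le_trans CV); apply: (tv_mixing_cont_ge good e0) => T T0 HT.
rewrite leNgt; apply/negP => Tl.
have Ht : 3 * T + 1 / 2 < (1 - 2 * eps) * bd_t X pi i.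
  have -> : 1 - 2 * eps = 2 * a by rewrite /a; field.
  lra.
by have := cont_lower_half T0 good Ht; rewrite ltNge HT.
Qed.

Lemma tv_mixing_lazy_order delta eps : 0 < delta < 1 -> 0 < eps < 1 / 2 -> exists2 C : R, 1 < C &
  forall n (X : bd_chain R n) pi i, irreducible_with_median X pi i ->
    C^-1 * bd_t X pi i <= tv_mixing_lazy delta (bd_kernel X) pi eps <= C * bd_t X pi i.
Proof.
move=> d01 /andP[e0 e1]; have e01 : 0 < eps < 1 by rewrite e0 /=; lra.
have /andP[d0 d1] := d01.
have [A A0 HA] := tv_mixing_lazy_near d01 e01.
pose a := 1 / 2 - eps; have a0 : 0 < a by rewrite /a; lra.
have ai : 0 < a^-1 by rewrite invr_gt0.
have ci : 0 < (1 - delta)^-1 by rewrite invr_gt0 subr_gt0.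
exists (1 + A + a^-1 + (1 - delta)^-1); first by rewrite -!addrA ltrDl !addr_gt0.
move=> n X pi i good; have [l1 lw wt _] := width_bounds good.
have := HA _ _ _ _ good; rewrite ler_norml => /andP[_ U].
have t0 : 0 < bd_t X pi i by lra.
apply/andP; split; last first.
  have := ler_wpM2l (ltW A0) wt.
  have : 0 <= a^-1 * bd_t X pi i by rewrite mulr_ge0 // ltW.
  lra.
have CV : (1 + A + a^-1 + (1 - delta)^-1)^-1 * bd_t X pi i <= a * bd_t X pi i.
  by rewrite ler_pM2r // -[a]invrK lef_pV2 ?posrE ?invr_gt0 //; lra.
apply: (le_trans CV); apply: (tv_mixing_lazy_ge d01 good e0) => m Hm.
rewrite leNgt; apply/negP => ml.
have m1 : m%:R * (1 - delta) <= m%:R :> R by rewrite ler_piMr //; lra.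
by have := lazy_lower_half d01 good (le_lt_trans m1 ml); rewrite ltNge Hm.
Qed.

(** The width divided by [t] is the square root of [l / t], so [T n eps / t n] has the limit [c]
    whatever [eps] is. *)
Lemma cutoff_of_near (t l : nat -> R) (T : nat -> R -> R) (c : R) : 0 < c ->
  (\forall n \near \oo, 0 < l n /\ 0 < t n) ->
  (forall eps, 0 < eps < 1 -> exists A : R, 0 < A /\
     \forall n \near \oo, `|T n eps - t n * c| <= A * Num.sqrt (l n * t n)) ->
  t n / l n @[n --> \oo] --> +oo -> has_cutoff T.
Proof.
move=> c0 tl0 HT tl.
have lim eps : 0 < eps < 1 -> T n eps / t n @[n --> \oo] --> c.
  move=> /HT[A [A0 HA]]; apply/cvgrPdist_le => e e0.
  move/cvgryPge: tl => /(_ ((A / e) ^+ 2)) tl.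
  near=> n.
  have [ln tn] : 0 < l n /\ 0 < t n by near: n.
  have Hn : `|T n eps - t n * c| <= A * Num.sqrt (l n * t n) by near: n.
  have tln : (A / e) ^+ 2 <= t n / l n by near: n.
  have -> : c - T n eps / t n = - (T n eps - t n * c) / t n by field; rewrite gt_eqF.
  rewrite normrM normrN normfV (gtr0_norm tn) ler_pdivrMr //; apply: (le_trans Hn).
  rewrite -ler_sqr ?nnegrE ?mulr_ge0 ?sqrtr_ge0 ?(ltW e0) ?(ltW A0) ?(ltW tn) //.
  rewrite !exprMn sqr_sqrtr; last by rewrite mulr_ge0 // ltW.
  move: tln; rewrite expr_div_n ler_pdivrMr ?exprn_gt0 // mulrAC ler_pdivlMr //.
  move=> /(ler_wpM2r (ltW tn)); have -> : e ^+ 2 * t n ^+ 2 = t n * e ^+ 2 * t n by ring.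
  by move=> h; rewrite mulrA.
move=> eps eta e0 ee e1.
have h1 : 0 < eps < 1 by rewrite e0 (lt_trans ee).
have h2 : 0 < eta < 1 by rewrite e1 (lt_trans e0).
have cN0 : c != 0 by rewrite gt_eqF.
have H : (fun n => T n eps / t n * (T n eta / t n)^-1) @ \oo --> (1 : R).
  by rewrite -(divff cN0); apply: cvgM; [exact: lim | apply: cvgV => //; exact: lim].
apply: cvg_trans H; apply: near_eq_cvg; near=> n.
have [ln tn] : 0 < l n /\ 0 < t n by near: n.
rewrite /= invfM invrK mulrA mulrAC; congr (_ / _).
by rewrite mulfVK // gt_eqF.
Unshelve. all: by end_near.
Qed.

(** The level 1/4 lies in the range where the mixing time is known to be [O(t)]; a cutoff carries
    this to every smaller level at the cost of a factor 2 independent of [eps]. *)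
Lemma near_of_cutoff (t : nat -> R) (T : nat -> R -> R) (eps C : R) : 0 < eps < 1 / 4 ->
  (\forall n \near \oo, 0 < T n (1 / 4) /\ T n (1 / 4) <= C * t n) ->
  has_cutoff T -> \forall n \near \oo, T n eps <= 2 * (C * t n).
Proof.
move=> /andP[e0 e1] HT cut.
have : T n eps / T n (1 / 4) @[n --> \oo] --> (1 : R) by apply: cut => //; lra.
move/cvgr_lt => /(_ 2 ltac:(lra)) H.
near=> n.
have [p u] : 0 < T n (1 / 4) /\ T n (1 / 4) <= C * t n by near: n.
have : T n eps / T n (1 / 4) < 2 by near: n.
rewrite ltr_pdivrMr // => h; lra.
Unshelve. all: by end_near.
Qed.

End MixingTimes.

(** * Equivalence of cutoff and divergence of the ratio *)

Section CutoffEquivalence.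
Context {R : realType}.
Variables (F : forall n, bd_chain R n) (pi : forall n, 'rV[R]_n.+1) (i : forall n, 'I_n.+1).
Hypothesis irrF : irreducible_bd_family F pi.
Hypothesis medF : median_family pi i.

Let t n := bd_t (F n) (pi n) (i n).
Let l n := bd_ell (F n) (pi n) (i n).

Let good n : (0 < n)%N -> irreducible_with_median (F n) (pi n) (i n).
Proof. by move=> n0; have [irr st] := irrF n0; split => //; exact: medF. Qed.

Let near_good : \forall n \near \oo, irreducible_with_median (F n) (pi n) (i n).
Proof. by exists 1%N => // n /= n1; exact: good. Qed.

Let near_pos : \forall n \near \oo, 0 < l n /\ 0 < t n.
Proof.
exists 1%N => // n /= n1; have [l1 lw wt _] := width_bounds (good n1).
by rewrite /l /t; split; lra.
Qed.

Lemma cont_cutoff : t n / l n @[n --> \oo] --> +oo ->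
  has_cutoff (fun n => tv_mixing_cont (bd_kernel (F n)) (pi n)).
Proof.
apply: (cutoff_of_near ltr01 near_pos) => eps e01; have [A A0 HA] := tv_mixing_cont_near e01.
exists A; split => //; exists 1%N => // n /= n1; rewrite mulr1; exact: HA (good n1).
Qed.

Lemma lazy_cutoff (delta : R) : 0 < delta < 1 -> t n / l n @[n --> \oo] --> +oo ->
  has_cutoff (fun n => tv_mixing_lazy delta (bd_kernel (F n)) (pi n)).
Proof.
move=> d01; have c0 : 0 < (1 - delta)^-1 by rewrite invr_gt0 subr_gt0; case/andP: d01.
apply: (cutoff_of_near c0 near_pos) => eps e01; have [A A0 HA] := tv_mixing_lazy_near d01 e01.
exists A; split => //; exists 1%N => // n /= n1; exact: HA (good n1).
Qed.

Let rate_eps (k : R) : 1 <= k -> 0 < expR (- k) / 2 < 1 / 4.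
Proof.
move=> k1; rewrite divr_gt0 ?expR_gt0 //= expRN.
have h : 2 < expR k by have := expR_gt1Dx (_ : k != 0); rewrite gt_eqF; lra.
have : (expR k)^-1 < 2^-1 by rewrite ltf_pV2 ?posrE //; lra.
lra.
Qed.

Let quarter : 0 < (1 / 4 : R) < 1 / 2.
Proof. by apply/andP; split; lra. Qed.

Let ratio_ge (A C k tn ln : R) : 0 < ln -> 0 < tn -> 0 < C -> 4 * C * `|A| <= k ->
  k * ln <= 4 * (C * tn) -> A <= tn / ln.
Proof.
move=> l0 t0 C0 Ak kl; apply: le_trans (ler_norm A) _; rewrite ler_pdivlMr //.
rewrite -(ler_pM2l (_ : 0 < 4 * C)) ?mulr_gt0 // mulrA -[leRHS]mulrA.
by apply: le_trans kl; rewrite ler_wpM2r // ltW.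
Qed.

Lemma cont_cutoff_ratio : has_cutoff (fun n => tv_mixing_cont (bd_kernel (F n)) (pi n)) ->
  t n / l n @[n --> \oo] --> +oo.
Proof.
move=> cut; apply/cvgryPge => A.
have [C C1 HC] := tv_mixing_cont_order quarter.
(* At the level [expR (- k) / 2] the gap gives [k * l n / 2 <= T] and the cutoff
   [T <= 2 * (C * t n)], so the ratio is at least [k / (4 * C)]. The absolute value keeps [1 <= k]
   for negative [A]. *)
pose k := 1 + 4 * C * `|A|.
have C0 : 0 < C by lra.
have k1 : 1 <= k by rewrite lerDl !mulr_ge0 // ltW.
have N0 : \forall n \near \oo, 0 < tv_mixing_cont (bd_kernel (F n)) (pi n) (1 / 4) /\
    tv_mixing_cont (bd_kernel (F n)) (pi n) (1 / 4) <= C * t n.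
  near=> n.
  have gn : irreducible_with_median (F n) (pi n) (i n) by near: n.
  have [ln tn] : 0 < l n /\ 0 < t n by near: n.
  have Cn : C <= n%:R by near: n; exact: nbhs_infty_ger.
  have /andP[lo hi] := HC _ _ _ _ gn Cn; split => //.
  by apply: lt_le_trans lo; rewrite mulr_gt0 ?invr_gt0.
have /andP[e0 e1] := rate_eps k1.
have near2 := near_of_cutoff (rate_eps k1) N0 cut.
near=> n.
have gn : irreducible_with_median (F n) (pi n) (i n) by near: n.
have [ln tn] : 0 < l n /\ 0 < t n by near: n.
have Tn : tv_mixing_cont (bd_kernel (F n)) (pi n) (expR (- k) / 2) <= 2 * (C * t n) by near: n.
have lT : k * l n / 2 <= tv_mixing_cont (bd_kernel (F n)) (pi n) (expR (- k) / 2).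
  apply: (tv_mixing_cont_ge gn e0) => T T0 HT; have kp : 0 < k by lra.
  by have := cont_gap T0 kp gn HT; rewrite -/(l n) ler_pdivlMr // => h; lra.
apply: (@ratio_ge _ C k) => //; first by rewrite /k lerDr.
lra.
Unshelve. all: by end_near.
Qed.

Lemma lazy_cutoff_ratio (delta : R) : 0 < delta < 1 ->
  has_cutoff (fun n => tv_mixing_lazy delta (bd_kernel (F n)) (pi n)) ->
  t n / l n @[n --> \oo] --> +oo.
Proof.
move=> d01 cut; apply/cvgryPge => A.
have [C C1 HC] := tv_mixing_lazy_order d01 quarter.
pose k := 1 + 4 * C * `|A|.
have C0 : 0 < C by lra.
have k1 : 1 <= k by rewrite lerDl !mulr_ge0 // ltW.
have k2 : 1 <= 2 * k by lra.
have N0 : \forall n \near \oo, 0 < tv_mixing_lazy delta (bd_kernel (F n)) (pi n) (1 / 4) /\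
    tv_mixing_lazy delta (bd_kernel (F n)) (pi n) (1 / 4) <= C * t n.
  near=> n.
  have gn : irreducible_with_median (F n) (pi n) (i n) by near: n.
  have [ln tn] : 0 < l n /\ 0 < t n by near: n.
  have /andP[lo hi] := HC _ _ _ _ gn; split => //.
  by apply: lt_le_trans lo; rewrite mulr_gt0 ?invr_gt0.
have /andP[e0 e1] := rate_eps k2.
have near2 := near_of_cutoff (rate_eps k2) N0 cut.
near=> n.
have gn : irreducible_with_median (F n) (pi n) (i n) by near: n.
have [ln tn] : 0 < l n /\ 0 < t n by near: n.
have Tn : tv_mixing_lazy delta (bd_kernel (F n)) (pi n) (expR (- (2 * k)) / 2) <= 2 * (C * t n) by near: n.
have An : 8 * A <= n%:R by near: n; exact: nbhs_infty_ger.
have tge : n%:R / 2 <= t n by case: gn => n0 irr st med; exact: (bd_t_ge irr st med).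
(* [lazy_gap] gives no information when [l n <= 4]; the ratio is then large because [t n >= n / 2],
   whence the condition [8 * A <= n]. *)
have [l4|l4] := leP (l n) 4.
  have [A0|A0] := leP A 0; first by apply: (le_trans A0); rewrite divr_ge0 // ltW.
  rewrite ler_pdivlMr //; apply: le_trans (ler_wpM2l (ltW A0) l4) _; lra.
have lT : k * l n / 2 <= tv_mixing_lazy delta (bd_kernel (F n)) (pi n) (expR (- (2 * k)) / 2).
  apply: (tv_mixing_lazy_ge d01 gn e0) => m Hm; have kp : 0 < k by lra.
  have := lazy_gap d01 kp gn Hm; rewrite -/(l n) le_max leNgt l4 /= ler_pdivlMr // => h; lra.
apply: (@ratio_ge _ C k) => //; first by rewrite /k lerDr.
lra.
Unshelve. all: by end_near.
Qed.

End CutoffEquivalence.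

Theorem theorem1p3 (R : realType) :
  (forall eps delta : R, 0 < eps < 1 / 2 -> 0 < delta < 1 ->
    exists C : R, 1 < C /\
      forall (F : forall n, bd_chain R n) (pi : forall n, 'rV[R]_n.+1)
             (i : forall n, 'I_n.+1),
        irreducible_bd_family F pi -> median_family pi i ->
        \forall n \near \oo,
          let t := bd_t (F n) (pi n) (i n) in
          let Tc := tv_mixing_cont (bd_kernel (F n)) (pi n) eps in
          let Td := tv_mixing_lazy delta (bd_kernel (F n)) (pi n) eps in
          [/\ C^-1 * t <= Num.min Tc Td,
              Num.min Tc Td <= Num.max Tc Td &
              Num.max Tc Td <= C * t]) /\
  (forall (F : forall n, bd_chain R n) (pi : forall n, 'rV[R]_n.+1)
          (i : forall n, 'I_n.+1),
     irreducible_bd_family F pi -> median_family pi i ->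
     forall delta : R, 0 < delta < 1 ->
       [<-> has_cutoff (fun n => tv_mixing_cont (bd_kernel (F n)) (pi n));
            has_cutoff (fun n => tv_mixing_lazy delta (bd_kernel (F n)) (pi n));
            bd_t (F n) (pi n) (i n) / bd_ell (F n) (pi n) (i n)
              @[n --> \oo] --> +oo]).
Proof.
split; last first.
  move=> F pi i irrF medF delta d01; tfae.
  - by move=> cut; apply: (lazy_cutoff irrF medF d01); exact: cont_cutoff_ratio.
  - exact: lazy_cutoff_ratio.
  - exact: cont_cutoff.
move=> eps delta e01 d01.
have [C1 C11 H1] := tv_mixing_cont_order e01.
have [C2 C21 H2] := tv_mixing_lazy_order d01 e01.
exists (C1 + C2); split; first by lra.
move=> F pi i irrF medF; near=> n => /=.
have n0 : (0 < n)%N by near: n; exact: nbhs_infty_gt.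
have gn : irreducible_with_median (F n) (pi n) (i n).
  by have [irr st] := irrF n n0; split => //; exact: medF.
have Cn : C1 <= n%:R by near: n; exact: nbhs_infty_ger.
have /andP[lo1 hi1] := H1 _ _ _ _ gn Cn.
have /andP[lo2 hi2] := H2 _ _ _ _ gn.
have [l1 lw wt _] := width_bounds gn.
have t0 : 0 <= bd_t (F n) (pi n) (i n) by lra.
have inv1 : (C1 + C2)^-1 <= C1^-1 by rewrite lef_pV2 ?posrE; lra.
have inv2 : (C1 + C2)^-1 <= C2^-1 by rewrite lef_pV2 ?posrE; lra.
split.
- rewrite le_min (le_trans _ lo1) ?(le_trans _ lo2) // ler_wpM2r //.
- by rewrite ge_min le_max lexx.
- rewrite ge_max (le_trans hi1) ?(le_trans hi2) // ler_wpM2r //; lra.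
Unshelve. all: by end_near.
Qed.
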